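(* Fix $p\in\mathbb{N}$ and suppose that, for each $n\in\mathbb{N}$, $F_n$ is a normalized (i.e. $\mathbb{E}[F_n]=0$, $\operatorname{Var}(F_n)=1$) degenerate $U$-statistic of order $p$ based on an independent, finite or countably infinite sequence $\mathbb{X}_n$ of random variables defined on some probability space $(\Omega_n,\mathcal{F}_n,\mathbb{P}_n)$. If $\lim_{n\to\infty}\mathbb{E}[F_n^4]=3$ and $\lim_{n\to\infty}\varrho^2(F_n)=0$, then $F_n$ converges in distribution to $Z\sim N(0,1)$ as $n\to\infty$.
   Context: Let $\mathbb{X}=(X_k)_{k\in\mathbb{N}}$ be independent random variables on a probability space with probability measure $\mathbb{P}$, $X_k$ taking values in an arbitrary measurable space $(E_k,\mathcal{B}_k)$. A finite sequence is included by appending constant random variables. Let $\mathcal{F}_M=\sigma(X_j: j\in M)$ for $M\subseteq\mathbb{N}$ and $\mathcal{G}_k=\sigma(X_j: j\neq k)$. Let $F=f(\mathbb{X})\in L^2(\mathbb{P})$ with $f:\prod_k E_k\to\mathbb{R}$ measurable with respect to the product $\sigma$-field. For finite $M\subseteq\mathbb{N}$ put $F_M:=\sum_{L\subseteq M}(-1)^{|M|-|L|}\mathbb{E}[F\mid\mathcal{F}_L]$. The $F_M$ are pairwise orthogonal in $L^2(\mathbb{P})$ and $F=\sum_{M\subseteq\mathbb{N},|M|<\infty}F_M$ with unconditional convergence in $L^2(\mathbb{P})$. For $p\in\mathbb{N}$, $F$ is called a (not necessarily symmetric, completely) degenerate $U$-statistic of order $p$ based on $\mathbb{X}$ if $F=\sum_{M\subseteq\mathbb{N}:|M|=p}F_M$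 a.s., i.e. if $F_M=0$ a.s. for all finite $M\subseteq\mathbb{N}$ with $|M|\neq p$. The influence of $X_k$ on $F$ is $\operatorname{Inf}_k(F):=\mathbb{E}[\operatorname{Var}(F\mid\mathcal{G}_k)]=\sum_{M\text{ finite},\,k\in M}\mathbb{E}[F_M^2]$, and $\varrho^2(F):=\sup_{k}\operatorname{Inf}_k(F)$. *)

(* Defs.v *)
From HB Require Import structures.
From mathcomp Require Import all_boot all_order all_algebra finmap.
From mathcomp Require Import all_classical all_reals all_analysis.
From mathcomp Require Import measurable_realfun.

Set Implicit Arguments.
Unset Strict Implicit.
Unset Printing Implicit Defensive.
Import Order.TTheory GRing.Theory Num.Theory.
Import numFieldNormedType.Exports.
Local Open Scope classical_set_scope.
Local Open Scope ring_scope.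

Section conditional_expectation.
Context d (T : measurableType d) (R : realType) (P : probability T R).

(* [Y] is a version of the conditional expectation of [F] given the sigma-field
   <<s G>> generated by the family of sets [G]. *)
Definition is_cond_exp (G : set (set T)) (F Y : T -> R) : Prop :=
  [/\ measurable_fun [set: g_sigma_algebraType G] Y,
      P.-integrable [set: T] (EFin \o Y) &
      forall A : set T, <<s G >> A ->
        (\int[P]_(x in A) (Y x)%:E = \int[P]_(x in A) (F x)%:E)%E].

(* A chosen version; the default value 0 is only reached when there is none,
   which does not happen for integrable [F] and G `<=` measurable, see
   [cond_expP] below. *)
Definition cond_exp (G : set (set T)) (F : T -> R) : T -> R :=
  xget (cst 0) [set Y | is_cond_exp G F Y].

Lemma cond_expP (G : set (set T)) (F : T -> R) :
  G `<=` measurable -> P.-integrable [set: T] (EFin \o F) ->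
  is_cond_exp G F (cond_exp G F).
Proof.
move=> Gm intF; apply: xgetPex.
pose T' : measurableType G.-sigma := g_sigma_algebraType G.
have sGm : <<s G >> `<=` @measurable _ T.
  by apply: smallest_sub => //; exact: sigma_algebra_measurable.
pose h : T -> T' := id.
have mh : measurable_fun [set: T] h.
  by move=> _ A mA; rewrite setTI; exact: sGm.
have hG (A : set T') : measurable A -> @measurable _ T (h @^-1` A).
  exact: sGm.
pose hM := MeasurableFun.Pack
  (MeasurableFun.Class (isMeasurableFun.Build _ _ T T' h mh)).
pose Q : probability T' R := distribution P hM.
pose nu0 (A : set T') : \bar R := induced_charge intF (h @^-1` A).
have nu00 : nu0 set0 = 0%E by rewrite /nu0 preimage_set0 charge0.
have nu0_fin (A : set T') : measurable A -> nu0 A \is a fin_num.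
  by move=> mA; apply: (fin_num_measure (induced_charge intF)); exact: hG.
have nu0_add : semi_sigma_additive nu0.
  move=> A mA tA mUA.
  apply: (@charge_semi_sigma_additive _ _ _ (induced_charge intF) A) => //.
    by move=> n; exact: (hG _ (mA n)).
  exact: (hG _ mUA).
pose nu : {charge set T' -> \bar R} :=
  HB.pack nu0 (isCharge.Build _ T' R nu0 nu00 nu0_fin nu0_add).
have nuQ : nu `<< Q.
  apply/null_content_dominatesP => A mA QA0.
  apply: null_set_integral; [exact: (hG _ mA)| |exact: QA0].
  by apply: (measurable_funS measurableT) => //; exact: measurable_int intF.
pose Y : T' -> \bar R := Radon_Nikodym nu Q.
have Yfin x : Y x \is a fin_num by exact: Radon_Nikodym_fin_num.
have intY : Q.-integrable [set: T'] Y by exact: Radon_Nikodym_integrable.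
have YE : EFin \o (fine \o Y) = Y.
  by apply/funext => x /=; rewrite fineK.
have mY : measurable_fun [set: T'] Y by exact: measurable_int intY.
have intPY : P.-integrable [set: T] Y.
  apply/integrableP; split.
    exact: (measurableT_comp mY mh).
  have /integrableP[_] := intY; rewrite ge0_integral_distribution//.
  exact: measurableT_comp.
exists (fine \o Y); split.
- by apply: measurableT_comp => //; apply: measurable_fine.
- by rewrite YE.
- move=> A mA; transitivity (nu A) => //.
  rewrite (Radon_Nikodym_integral nuQ mA).
  rewrite (@integral_pushforward _ _ _ _ _ h mh P A Y mY) //; last first.
    exact: (integrableS measurableT (sGm _ mA) (@subsetT _ _) intPY).
  by apply: eq_integral => x _ /=; rewrite fineK.
Qed.

Definition cond_var (G : set (set T)) (F : T -> R) : T -> R :=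
  cond_exp G (fun x => (F x - cond_exp G F x) ^+ 2).

End conditional_expectation.

Section sequences_of_random_variables.
Context (R : realType) (d : measure_display) (T : measurableType d).
Context (P : probability T R).
Context (dE : nat -> measure_display) (E : forall k, measurableType (dE k)).
Context (X : forall k, {RV P >-> E k}).

Definition independent_RVs : Prop :=
  forall (J : {fset nat}) (A : forall k, set (E k)),
    (forall k, measurable (A k)) ->
    (P (\bigcap_(k in [set` J]) (X k @^-1` A k)) =
     \prod_(k <- J) P (X k @^-1` A k))%E.

(* generator of the sigma-field sigma(X_j : j \in M) *)
Definition RV_gen (M : set nat) : set (set T) :=
  \bigcup_(j in M) preimage_set_system [set: T] (X j) measurable.

Lemma RV_gen_measurable (M : set nat) : RV_gen M `<=` measurable.
Proof.
by move=> _ [j _ [B mB <-]]; exact: (measurable_funPT (X j) measurableT _ mB).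
Qed.

(* generator of the product sigma-field on \prod_k E_k *)
Definition prod_gen : set (set (forall k, E k)) :=
  \bigcup_(k in [set: nat])
    preimage_set_system [set: forall k, E k] (fun x => x k) measurable.

(* F = f(X) for some product-measurable f *)
Definition based_on (F : T -> R) : Prop :=
  exists2 f : (forall k, E k) -> R,
    measurable_fun [set: g_sigma_algebraType prod_gen] f &
    forall w, F w = f (fun k => X k w).

(* the component F_M of the Hoeffding decomposition *)
Definition Hoeffding_comp (F : T -> R) (M : {fset nat}) (w : T) : R :=
  \sum_(L <- fpowerset M)
    (-1) ^+ (#|` M| - #|` L|) * cond_exp P (RV_gen [set` L]) F w.

(* The a.s. identity F = \sum_(|M| = p) F_M is expressed by the vanishing of the
   other components of the decomposition. *)
Definition degenerate_Ustat (p : nat) (F : T -> R) : Prop :=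
  [/\ F \in Lfun P 2%:E, based_on F &
      forall M : {fset nat}, #|` M| <> p ->
        {ae P, forall w, Hoeffding_comp F M w = 0}].

Definition influence (F : T -> R) (k : nat) : \bar R :=
  ('E_P[cond_var P (RV_gen (~` [set k])) F])%E.

Definition max_influence (F : T -> R) : \bar R :=
  ereal_sup (range (influence F)).

End sequences_of_random_variables.

(* The [F n] may live on different probability spaces; [mu] is the law of the
   limit. *)
Definition cvg_in_distribution (R : realType) (d : nat -> measure_display)
    (T : forall n, measurableType (d n)) (P : forall n, probability (T n) R)
    (F : forall n, {RV (P n) >-> R})
    (mu : probability (measurableTypeR R) R) : Prop :=
  forall g : R -> R, continuous g -> (exists C, forall x, `|g x| <= C) ->
    ('E_(P n)[g \o F n] @[n --> \oo] --> \int[mu]_x (g x)%:E)%E.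

(* Main.v *)
(* The law of F is compared with that of functions on a finite product space.
   If each X_k, k < N, is replaced by a finite-valued function of it, the
   conditional expectation of F given these discrete variables is again
   degenerate of order p (independence makes the discretisation commute with
   all E[. | F_L]), its influences and fourth moment do not exceed those of F,
   and it is L^2-close to F when the discretisation is fine.

   On a finite product space let d_k = F - E_k F, E_k integrating out the k-th
   coordinate, and 2 Gamma = sum_k (d_k^2 + E_k d_k^2) = 2p F^2 - sum_k (F^2 -
   E_k F^2) = sum_M (2p - |M|) U_M, where F^2 = sum_M U_M is the Hoeffding
   decomposition.  The components with |M| = 2p do not contribute to Gamma, and
   their total second moment is at least 2 Var(F)^2 minus a multiple of the
   maximal influence: expanding it as a sum over four disjoint sets gives the
   squares E(sum_A E[F_AB F_AC | B, C])^2 up to terms with a common index.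
   Hence, if E F^4 is at most about 3 and the influences are small, so are
   U_M for 0 < |M| < 2p, Var(Gamma), and by
     3 E[F^2 Gamma] - p E F^4 = sum_k E[d_k^4 / 2 + 3 (E_k d_k^2)^2 / 2]
   also sum_k E d_k^4.  Stein's identity
     p E[F phi(F)] = sum_k E[d_k (phi(F) - phi(E_k F))] ~ E[phi'(F) Gamma]
   concludes, with phi the solution of phi' - x phi = psi.  Test functions psi
   with compact support and Gaussian mean 0 suffice; for those phi has compact
   support too, so no further regularity estimate on phi is needed. *)

From HB Require Import structures.
From mathcomp Require Import all_boot all_order all_algebra.
From mathcomp Require Import ring lra zify.

Set Implicit Arguments.
Unset Strict Implicit.
Unset Printing Implicit Defensive.
Import Order.TTheory GRing.Theory Num.Theory.
Local Open Scope ring_scope.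

(** * Finite product spaces *)

(** Conditioning on finitely many finite-valued variables turns every conditional expectation into a
    finite weighted sum, so the Hoeffding calculus consists of identities valid at every point;
    versions, integrability and null sets appear only where F is compared with its discretisation.
    The discretisation may lose some variance, which is why the variance [s] is carried through all
    estimates.

    The value 3 is the borderline because E F^4 = sum_M E U_M^2: the component M = set0 contributes
    s^2, those with |M| = 2p at least 2 s^2 up to the influences, so the excess over 3 s^2 bounds
    everything in between. The constant 4^p in the error counts the ways of splitting two index sets
    of size p.

    All bounds depend on p, on the test function and on the tolerance but not on the space, so one
    threshold serves every n. A bounded continuous g is reduced to an admissible psi by subtracting
    a constant and multiplying by a cutoff; Chebyshev's inequality, from E F_n^2 = 1, makes the
    remaining tail small uniformly in n. *)

Section finite_product_space.
Context (R : realFieldType) (I S : finType) (p : I -> S -> R).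
Hypothesis p_ge0 : forall i s, 0 <= p i s.
Hypothesis p_sum1 : forall i, \sum_s p i s = 1.

Notation Om := {ffun I -> S}.
Implicit Types (x y z : Om) (u v : Om -> R) (A B L M : {set I}) (k : I).

Definition wt x := \prod_i p i (x i).

Definition Ex u := \sum_x wt x * u x.

Definition mix A y x : Om := [ffun i => if i \in A then y i else x i].

(* [A] is the set of coordinates that are integrated out, so that
   E[u | F_L] is [ce (~: L) u]. *)
Definition ce A u x := Ex (fun y => u (mix A y x)).

(** Required at every point, weight zero included, so that such functions can be taken out of [ce A]
    pointwise and not merely almost surely. *)
Definition free_of A u := forall y x, u (mix A y x) = u x.

Lemma wt_ge0 x : 0 <= wt x.
Proof. exact: prodr_ge0. Qed.

Lemma wt_sum1 : \sum_x wt x = 1.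
Proof.
rewrite -(bigA_distr_bigA (fun i s => p i s)) /=.
by rewrite big1// => i _; rewrite p_sum1.
Qed.

Lemma eq_Ex u v : u =1 v -> Ex u = Ex v.
Proof. by move=> uv; apply: eq_bigr => x _; rewrite uv. Qed.

Lemma Ex_cst c : Ex (fun=> c) = c.
Proof. by rewrite /Ex -mulr_suml wt_sum1 mul1r. Qed.

Lemma ExZ c u : Ex (fun x => c * u x) = c * Ex u.
Proof. by rewrite /Ex mulr_sumr; apply: eq_bigr => x _; rewrite mulrCA. Qed.

Lemma ExZr c u : Ex (fun x => u x * c) = Ex u * c.
Proof. by rewrite mulrC -ExZ; apply: eq_Ex => x; rewrite mulrC. Qed.

Lemma ExD u v : Ex (fun x => u x + v x) = Ex u + Ex v.
Proof. by rewrite /Ex -big_split/=; apply: eq_bigr => x _; rewrite mulrDr. Qed.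

Lemma ExN u : Ex (fun x => - u x) = - Ex u.
Proof. by rewrite /Ex -sumrN; apply: eq_bigr => x _; rewrite mulrN. Qed.

Lemma ExB u v : Ex (fun x => u x - v x) = Ex u - Ex v.
Proof. by rewrite ExD ExN. Qed.

Lemma Ex_sum (J : finType) (P : pred J) (U : J -> Om -> R) :
  Ex (fun x => \sum_(j | P j) U j x) = \sum_(j | P j) Ex (U j).
Proof.
rewrite /Ex exchange_big /=; apply: eq_bigr => x _; exact: mulr_sumr.
Qed.

Lemma ler_Ex u v : (forall x, u x <= v x) -> Ex u <= Ex v.
Proof. by move=> uv; apply: ler_sum => x _; rewrite ler_wpM2l// wt_ge0. Qed.

Lemma Ex_ge0 u : (forall x, 0 <= u x) -> 0 <= Ex u.
Proof. by move=> u0; rewrite -(Ex_cst 0); exact: ler_Ex. Qed.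

Lemma ler_norm_Ex u : `|Ex u| <= Ex (fun x => `|u x|).
Proof.
apply: le_trans (ler_norm_sum _ _ _) _; apply: ler_sum => x _.
by rewrite normrM (ger0_norm (wt_ge0 _)).
Qed.

(** Some weights may vanish, so a zero second moment determines [u] only where [wt] is positive; the
    factor [wt x] records this. *)
Lemma Ex_sqr_eq0 u : Ex (fun x => u x ^+ 2) = 0 -> forall x, wt x * u x = 0.
Proof.
move=> /eqP; rewrite psumr_eq0 => [/allP u0 x|x _]; last first.
  by rewrite mulr_ge0 ?wt_ge0 ?sqr_ge0.
have /implyP/(_ isT) := u0 x (mem_index_enum x).
by rewrite mulf_eq0 sqrf_eq0 -mulf_eq0 => /eqP.
Qed.

Lemma mix_mix A B z y x :
  mix B z (mix A y x) = mix (A :|: B) (mix B z y) x.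
Proof.
by apply/ffunP => i; rewrite !ffunE inE; case: (i \in A); case: (i \in B).
Qed.

Lemma mixC A y x : mix (~: A) x y = mix A y x.
Proof. by apply/ffunP => i; rewrite !ffunE inE; case: (i \in A). Qed.

Lemma mix_sub A B y x : B \subset A -> mix A (mix B y x) x = mix B y x.
Proof.
move=> /subsetP BA; apply/ffunP => i; rewrite !ffunE.
by case: (boolP (i \in B)) => [/BA->//|]; case: (i \in A).
Qed.

Lemma mix0 y x : mix set0 y x = x.
Proof. by apply/ffunP => i; rewrite !ffunE inE. Qed.

Lemma mixT y x : mix setT y x = y.
Proof. by apply/ffunP => i; rewrite !ffunE inE. Qed.

Lemma wt_mix A y x : wt (mix A y x) * wt (mix A x y) = wt y * wt x.
Proof.
rewrite /wt -!big_split/=; apply: eq_bigr => i _; rewrite !ffunE.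
by case: ifP => // _; rewrite mulrC.
Qed.

(** Fubini as a symmetry: [sw] exchanges the coordinates in [A] of two independent copies. By
    [wt_mix] this preserves the weight of the pair, and it turns [mix A y x] into [x], so that the
    second copy sums to 1. *)
Lemma Ex_ce A u : Ex (ce A u) = Ex u.
Proof.
transitivity (\sum_x \sum_y wt y * wt x * u (mix A y x)).
  apply: eq_bigr => x _; rewrite mulr_sumr; apply: eq_bigr => y _.
  by rewrite mulrCA mulrA.
rewrite pair_big /=.
pose sw (q : Om * Om) := (mix A q.2 q.1, mix A q.1 q.2).
have swK : involutive sw.
  by case=> x y; rewrite /sw/=; f_equal; apply/ffunP => i; rewrite !ffunE; case: (i \in A).
rewrite (reindex_inj (inv_inj swK)) /=.
transitivity (\sum_(q : Om * Om) wt q.1 * u q.1 * wt q.2).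
  apply: eq_bigr => -[x y] _ /=.
  rewrite wt_mix /=.
  have E a b : mix A (mix A a b) (mix A b a) = a.
    by apply/ffunP => i; rewrite !ffunE; case: (i \in A).
  by rewrite !E mulrAC.
rewrite -(pair_bigA _ (fun x y => wt x * u x * wt y)) /=.
by apply: eq_bigr => x _; rewrite -mulr_sumr wt_sum1 mulr1.
Qed.

Lemma eq_ce A u v : u =1 v -> ce A u =1 ce A v.
Proof. by move=> uv x; rewrite /ce; apply: eq_Ex => y; rewrite uv. Qed.

(** In terms of retained coordinates this reads E[E[u | F_K] | F_L] = E[u | F_(K cap L)], which is
    where the product form of the weights enters. *)
Lemma ce_ce A B u x : ce A (ce B u) x = ce (A :|: B) u x.
Proof.
rewrite [RHS]/ce -[RHS](Ex_ce B); apply: eq_Ex => y; apply: eq_Ex => z.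
by rewrite mix_mix.
Qed.

Lemma ce_pull A u v x :
  free_of A u -> ce A (fun x => u x * v x) x = u x * ce A v x.
Proof. by move=> Au; rewrite /ce -ExZ; apply: eq_Ex => y; rewrite Au. Qed.

Lemma ce_id A u x : free_of A u -> ce A u x = u x.
Proof. by move=> Au; rewrite -[RHS]Ex_cst /ce; apply: eq_Ex => y; rewrite Au. Qed.

Lemma inv_ce A u : free_of A (ce A u).
Proof.
by move=> y x; rewrite /ce; apply: eq_Ex => z; rewrite mix_mix setUid; congr u;
  apply/ffunP => i; rewrite !ffunE; case: (i \in A).
Qed.

Lemma inv_ceW A B u : free_of B u -> free_of B (ce A u).
Proof.
move=> Bu y x; rewrite /ce; apply: eq_Ex => z; rewrite -[RHS](Bu y); rewrite !mix_mix.
rewrite -(Bu z) -[RHS](Bu z) !mix_mix; congr u.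
by apply/ffunP => i; rewrite !ffunE !inE; case: (i \in A); case: (i \in B).
Qed.

Lemma invS A B u : B \subset A -> free_of A u -> free_of B u.
Proof. by move=> BA Au y x; rewrite -(mix_sub _ _ BA) Au. Qed.

Lemma invU A B u : free_of A u -> free_of B u -> free_of (A :|: B) u.
Proof.
move=> Au Bu y x; rewrite -[RHS](Au y) -[RHS](Bu y) mix_mix; congr u.
by apply/ffunP => i; rewrite !ffunE !inE; case: (i \in A); case: (i \in B).
Qed.

Lemma inv_comp A u (g : R -> R) : free_of A u -> free_of A (g \o u).
Proof. by move=> Au y x /=; rewrite Au. Qed.

Lemma invM A u v : free_of A u -> free_of A v -> free_of A (fun x => u x * v x).
Proof. by move=> Au Av y x; rewrite Au Av. Qed.

Lemma inv_sum A (J : finType) (P : pred J) (U : J -> Om -> R) :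
  (forall j, P j -> free_of A (U j)) -> free_of A (fun x => \sum_(j | P j) U j x).
Proof. by move=> AU y x; apply: eq_bigr => j Pj; rewrite AU. Qed.

Lemma Ex_pull A u v : free_of A u ->
  Ex (fun x => u x * v x) = Ex (fun x => u x * ce A v x).
Proof.
by move=> Au; rewrite -(Ex_ce A); apply: eq_Ex => x; rewrite ce_pull.
Qed.

(** The main source of vanishing expectations: given the coordinates outside [A], [u] is constant
    and [v] has mean 0. *)
Lemma Ex_orth A u v : free_of A u -> (forall x, ce A v x = 0) ->
  Ex (fun x => u x * v x) = 0.
Proof.
move=> Au v0; rewrite (Ex_pull _ Au) -[RHS](Ex_cst 0).
by apply: eq_Ex => x; rewrite v0 mulr0.
Qed.

Lemma Ex_indep A u v : free_of A u -> free_of (~: A) v ->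
  Ex (fun x => u x * v x) = Ex u * Ex v.
Proof.
move=> Au Av; rewrite (Ex_pull _ Au) -ExZr; apply: eq_Ex => x; congr (_ * _).
by rewrite /ce; apply: eq_Ex => y; rewrite -mixC Av.
Qed.

Lemma ceD A u v x : ce A (fun x => u x + v x) x = ce A u x + ce A v x.
Proof. exact: ExD. Qed.

Lemma ceB A u v x : ce A (fun x => u x - v x) x = ce A u x - ce A v x.
Proof. exact: ExB. Qed.

Lemma ceZ A c u x : ce A (fun x => c * u x) x = c * ce A u x.
Proof. exact: ExZ. Qed.

Lemma ce_sum A (J : finType) (P : pred J) (U : J -> Om -> R) x :
  ce A (fun x => \sum_(j | P j) U j x) x = \sum_(j | P j) ce A (U j) x.
Proof. exact: Ex_sum. Qed.

Lemma ce0 u x : ce set0 u x = u x.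
Proof. by rewrite -[RHS]Ex_cst /ce; apply: eq_Ex => y; rewrite mix0. Qed.

Lemma ceT u x : ce setT u x = Ex u.
Proof. by rewrite /ce; apply: eq_Ex => y; rewrite mixT. Qed.

(* AM-GM, after writing the product of two integrals as a double integral. *)
Lemma ce_mul_le A (a b a' b' : Om -> R) x :
  ce A (fun x => a x * b x) x * ce A (fun x => a' x * b' x) x <=
  2^-1 * (ce A (fun x => a x ^+ 2) x * ce A (fun x => b' x ^+ 2) x +
          ce A (fun x => b x ^+ 2) x * ce A (fun x => a' x ^+ 2) x).
Proof.
have H (u v : Om -> R) :
    ce A u x * ce A v x = Ex (fun y => Ex (fun z => u (mix A y x) * v (mix A z x))).
  by rewrite -ExZr; apply: eq_Ex => y; rewrite ExZ.
rewrite !H -ExD -ExZ; apply: ler_Ex => y; rewrite -ExD -ExZ.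
apply: ler_Ex => z.
have := sqr_ge0 (a (mix A y x) * b' (mix A z x) - b (mix A y x) * a' (mix A z x)).
move: (a _) (b _) (a' _) (b' _) => t1 t2 t3 t4; nra.
Qed.

(** The inclusion-exclusion of [Hoeffding_comp], pointwise: [L] is the set of retained coordinates,
    hence its complement under [ce]. *)
Definition hproj M u x :=
  \sum_(L : {set I} | L \subset M) (-1) ^+ #|M :\: L| * ce (~: L) u x.

Lemma eq_proj M u v : u =1 v -> hproj M u =1 hproj M v.
Proof. by move=> uv x; apply: eq_bigr => L _; rewrite (eq_ce _ uv). Qed.

Lemma hproj_sum M (J : finType) (P : pred J) (U : J -> Om -> R) x :
  hproj M (fun x => \sum_(j | P j) U j x) x = \sum_(j | P j) hproj M (U j) x.
Proof.
rewrite /hproj exchange_big; apply: eq_bigr => L _ /=.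
by rewrite ce_sum mulr_sumr.
Qed.

Lemma hproj_ce M A u x : hproj M (ce A u) x = ce A (hproj M u) x.
Proof.
rewrite /hproj ce_sum; apply: eq_bigr => L _.
by rewrite ceZ !ce_ce setUC.
Qed.

(** Sign-reversing involution: adding or removing [k] changes the parity of a subset, which makes
    alternating sums over families stable under it cancel. *)
Definition toggle k L := if k \in L then L :\ k else k |: L.

Lemma toggleK k : involutive (toggle k).
Proof.
move=> L; rewrite /toggle; case: (boolP (k \in L)) => kL.
  by rewrite !inE eqxx /= setD1K.
by rewrite !inE eqxx /= setU1K.
Qed.

Lemma toggle_sum0 k (P : pred {set I}) (g : {set I} -> R) :
  (forall L, P (toggle k L) = P L) ->
  (forall L, P L -> g (toggle k L) = - g L) ->
  \sum_(L | P L) g L = 0.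
Proof.
move=> tP tg; have : \sum_(L | P L) g L = - \sum_(L | P L) g L.
  rewrite {1}(reindex_inj (inv_inj (toggleK k))) -sumrN.
  by apply: eq_big => // L /[!tP] /tg.
lra.
Qed.

Lemma toggle_subset k L M : k \in M -> (toggle k L \subset M) = (L \subset M).
Proof.
move=> kM; rewrite /toggle; case: ifP => kL; last first.
  by rewrite subUset sub1set kM.
by rewrite subDset; apply/idP/idP => [/subset_trans|] H;
  [apply: H; rewrite subUset sub1set kM/=|apply: subset_trans H _; exact: subsetUr].
Qed.

Lemma toggle_sign k L M : k \in M ->
  (-1) ^+ #|M :\: toggle k L| = - (-1) ^+ #|M :\: L| :> R.
Proof.
move=> kM; rewrite /toggle; case: ifPn => kL.
  have -> : M :\: (L :\ k) = k |: (M :\: L).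
    apply/setP => i; rewrite !inE; case: eqVneq => //= -> //.
  by rewrite cardsU1 !inE kL /= add1n exprS mulN1r.
have -> : M :\: L = k |: (M :\: (k |: L)).
  by apply/setP => i; rewrite !inE; case: eqVneq => //= ->; rewrite kM kL.
by rewrite [in RHS]cardsU1 !inE eqxx /= add1n exprS mulN1r opprK.
Qed.

(** Once [k] is integrated out, the terms of [L] and [toggle k L] involve the same conditional
    expectation with opposite signs. *)
Lemma hproj_nul M u k x : k \in M -> ce [set k] (hproj M u) x = 0.
Proof.
move=> kM; rewrite /hproj ce_sum; apply: (@toggle_sum0 k) => L.
  exact: toggle_subset.
have kE : [set k] :|: ~: toggle k L = [set k] :|: ~: L.
  apply/setP => i; rewrite /toggle; case: ifP => kL; rewrite !inE;
    by case: eqVneq.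
by move=> _; rewrite toggle_sign// !ceZ !ce_ce kE mulNr.
Qed.

Lemma hproj_inv M u : free_of (~: M) (hproj M u).
Proof.
apply: inv_sum => L LM y x; congr (_ * _).
by apply: (invS _ (@inv_ce (~: L) u)); rewrite setCS.
Qed.

(** Moebius inversion: for fixed [L] the signs over all [M] containing [L] cancel by toggling some
    [k] outside [L], unless [L] is the full set, whose term is [u] itself. *)
Lemma hproj_sumE u x : \sum_M hproj M u x = u x.
Proof.
rewrite /hproj (exchange_big_dep xpredT)//=.
under eq_bigr do rewrite -mulr_suml.
rewrite (bigD1 setT)//= [X in _ + X]big1 ?addr0 => [|L LT].
  rewrite (big_pred1 setT); last by move=> M; rewrite /= subTset.
  by rewrite setDv cards0 expr0 mul1r setCT ce0.
have [k kL] : exists k, k \notin L.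
  move: LT; rewrite -subTset => /subsetPn[k _ kL].
  by exists k.
rewrite [X in X * _](_ : _ = 0) ?mul0r//; apply: (@toggle_sum0 k) => M.
  rewrite /toggle; case: ifPn => kM.
    by rewrite subsetD1 kL andbT.
  apply/idP/idP => [H|/subset_trans->//]; last exact: subsetUr.
  apply/subsetP => i iL; have /subsetP/(_ _ iL) := H.
  by rewrite !inE => /orP[/eqP ik|//]; rewrite -ik iL in kL.
move=> LM; rewrite /toggle; case: ifPn => kM.
  rewrite [in RHS](_ : M :\: L = k |: ((M :\ k) :\: L)) ?cardsU1 ?inE ?eqxx ?andbF/=.
    by rewrite add1n exprS mulN1r opprK.
  by apply/setP => i; rewrite !inE; case: eqVneq => //= ->; rewrite kM kL.
rewrite (_ : _ :\: L = k |: (M :\: L)).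
  by rewrite cardsU1 !inE (negbTE kM) andbF/= add1n exprS mulN1r.
by apply/setP => i; rewrite !inE; case: eqVneq => //= ->; rewrite kL.
Qed.

Lemma hproj_eq0_inv M u k x : free_of [set k] u -> k \in M -> hproj M u x = 0.
Proof.
move=> ku kM; rewrite -(@hproj_nul M u k x kM) -hproj_ce.
by apply: eq_proj => y; rewrite ce_id.
Qed.

Lemma hproj_eq0_nul M u k x : (forall x, ce [set k] u x = 0) -> k \notin M ->
  hproj M u x = 0.
Proof.
move=> ku kM; have kM' : [set k] \subset ~: M by rewrite sub1set inE.
rewrite -(@ce_id [set k] (hproj M u)); last exact: (invS kM' (@hproj_inv M u)).
rewrite -hproj_ce /hproj big1// => L _.
by rewrite (eq_ce _ ku) [ce _ _ _]Ex_cst mulr0.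
Qed.

(** Such a [u] is a pure component of index [N]: a coordinate in which [M] and [N] differ is either
    one that [u] does not see or one in which [u] is centred. *)
Lemma hproj_eq0 M N u x : M != N ->
  (forall k, k \in N -> forall x, ce [set k] u x = 0) -> free_of (~: N) u ->
  hproj M u x = 0.
Proof.
rewrite eqEsubset negb_and => /orP[/subsetPn[k kM kN]|/subsetPn[k kN kM]] uN uC.
  by apply: (@hproj_eq0_inv _ _ k) => //; apply: invS uC; rewrite sub1set inE.
by apply: (@hproj_eq0_nul _ _ k) => //; exact: uN.
Qed.

Lemma hproj_orth M N u v : M != N ->
  Ex (fun x => hproj M u x * hproj N v x) = 0.
Proof.
rewrite eqEsubset negb_and => /orP[/subsetPn[k kM kN]|/subsetPn[k kN kM]].
  rewrite (eq_Ex (fun x => mulrC _ _)); apply: (@Ex_orth [set k]).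
    by apply: invS (@hproj_inv N v); rewrite sub1set inE.
  by move=> x; exact: hproj_nul.
apply: (@Ex_orth [set k]).
  by apply: invS (@hproj_inv M u); rewrite sub1set inE.
by move=> x; exact: hproj_nul.
Qed.

(** Multiplying the component [M] by a scalar depending on [M] is a diagonal operator. Indicators of
    [k \in M] yield the influences, the factors [2m - |M|] the carre du champ. *)
Lemma Ex_proj_sum (a b : {set I} -> R) u :
  Ex (fun x => (\sum_M a M * hproj M u x) * (\sum_M b M * hproj M u x)) =
  \sum_M a M * b M * Ex (fun x => hproj M u x ^+ 2).
Proof.
under eq_Ex do rewrite mulr_suml.
rewrite Ex_sum; apply: eq_bigr => M _.
under eq_Ex do rewrite mulr_sumr.
rewrite Ex_sum (bigD1 M)//= big1 ?addr0 => [|N NM].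
  by rewrite -ExZ; apply: eq_Ex => x; rewrite mulrACA expr2.
under eq_Ex do rewrite mulrACA.
by rewrite ExZ hproj_orth ?mulr0// eq_sym.
Qed.

Lemma parseval u : Ex (fun x => u x ^+ 2) = \sum_M Ex (fun x => hproj M u x ^+ 2).
Proof.
have := Ex_proj_sum (fun=> 1) (fun=> 1) u.
under [RHS]eq_bigr do rewrite !mul1r.
move=> <-; apply: eq_Ex => x.
by under eq_bigr do rewrite mul1r; rewrite hproj_sumE expr2.
Qed.

Lemma Ex_proj_self M u :
  Ex (fun x => u x * hproj M u x) = Ex (fun x => hproj M u x ^+ 2).
Proof.
have := Ex_proj_sum (fun=> 1) (fun N => (N == M)%:R) u.
rewrite (bigD1 M)//= eqxx !mul1r big1 ?addr0 => [<-|N /negbTE ->].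
  apply: eq_Ex => x; under eq_bigr do rewrite mul1r.
  rewrite hproj_sumE (bigD1 M)//= eqxx mul1r big1 ?addr0// => N /negbTE ->.
  by rewrite mul0r.
by rewrite mulr0 mul0r.
Qed.

Lemma sub_ce_proj k u x :
  u x - ce [set k] u x = \sum_(M : {set I} | k \in M) hproj M u x.
Proof.
rewrite -[in LHS]hproj_sumE.
have -> : ce [set k] u x = \sum_M ce [set k] (hproj M u) x.
  by rewrite -ce_sum; apply: eq_ce => y; rewrite hproj_sumE.
rewrite -sumrB [RHS]big_mkcond; apply: eq_bigr => M _; case: ifPn => kM.
  by rewrite hproj_nul// subr0.
by rewrite ce_id ?subrr//; apply: invS (@hproj_inv M u); rewrite sub1set inE.
Qed.

(** The component [M] survives exactly in the terms with [k \in M], so the sum of all operators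
    [1 - E_k] has eigenvalue [|M|] on it. *)
Lemma sum_sub_ce u x :
  \sum_k (u x - ce [set k] u x) = \sum_(M : {set I}) #|M|%:R * hproj M u x.
Proof.
under eq_bigr do rewrite sub_ce_proj.
rewrite (exchange_big_dep xpredT)//=; apply: eq_bigr => M _.
by rewrite sumr_const mulr_natl.
Qed.

End finite_product_space.

(** * Moments of degenerate functions *)

Lemma disjointP (I : finType) (A B : {set I}) :
  reflect (forall i, ~~ ((i \in A) && (i \in B))) [disjoint A & B].
Proof.
rewrite -setI_eq0; apply: (iffP eqP) => [AB0 i|H].
  by rewrite -in_setI AB0 inE.
by apply/setP => i; rewrite !inE; exact/negbTE/H.
Qed.

Lemma subset_implyb (I : finType) (A B : {set I}) :
  A \subset B -> forall i, (i \in A) ==> (i \in B).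
Proof. by move=> /subsetP AB i; apply/implyP; exact: AB. Qed.

Section degenerate.
Context (R : realFieldType) (I S : finType) (p : I -> S -> R).
Hypothesis p_ge0 : forall i s, 0 <= p i s.
Hypothesis p_sum1 : forall i, \sum_s p i s = 1.

Notation Om := {ffun I -> S}.
Notation Ex := (Ex p).
Notation ce := (ce p).
Notation hproj := (hproj p).
Implicit Types (x y z : Om) (A B C D L M : {set I}) (k : I).

Variables (m : nat) (F : Om -> R).
Hypothesis m_gt0 : (0 < m)%N.
Hypothesis F_deg : forall M, #|M| != m -> forall x, hproj M F x = 0.

Let f M := hproj M F.
Let nrm M := Ex (fun x => f M x ^+ 2).
(** The variance, because [m_gt0] makes the component [set0], which is the mean, vanish. It is not
    normalised to 1, since discretisation may lower it. *)
Let s := Ex (fun x => F x ^+ 2).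

Let f_nul M k x : k \in M -> ce [set k] (f M) x = 0.
Proof. exact: hproj_nul. Qed.

Let f_inv M A : A \subset ~: M -> free_of A (f M).
Proof. by move=> AM; apply: (invS AM); exact: hproj_inv. Qed.

Let f_deg M x : #|M| != m -> f M x = 0.
Proof. by move=> Mm; exact: F_deg. Qed.

Let FE x : F x = \sum_M f M x.
Proof. by rewrite hproj_sumE. Qed.

Let nrm_ge0 M : 0 <= nrm M.
Proof. by apply: Ex_ge0 => // x; exact: sqr_ge0. Qed.

Let nrm_deg M : #|M| != m -> nrm M = 0.
Proof.
move=> Mm; rewrite /nrm -[RHS](Ex_cst p_sum1); apply: eq_Ex => x.
by rewrite f_deg// expr0n.
Qed.

Let sE : s = \sum_M nrm M.
Proof. exact: parseval. Qed.

Let infl k := Ex (fun x => (F x - ce [set k] F x) ^+ 2).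

Let inflE k : infl k = \sum_(M : {set I} | k \in M) nrm M.
Proof.
have := Ex_proj_sum p_sum1 (fun M => (k \in M)%:R) (fun M => (k \in M)%:R) F.
move=> E; transitivity (\sum_(M : {set I}) (k \in M)%:R * (k \in M)%:R * nrm M).
  rewrite -E; apply: eq_Ex => x; rewrite sub_ce_proj// -expr2.
  rewrite big_mkcond /=; congr (_ ^+ _); apply: eq_bigr => M _.
  by case: (k \in M); rewrite ?mul1r ?mul0r.
rewrite [RHS]big_mkcond; apply: eq_bigr => M _.
by case: (k \in M); rewrite ?mul1r ?mul0r.
Qed.

(** Each index set carrying mass has [m] elements and is counted once for each of them. *)
Let sum_infl : \sum_k infl k = m%:R * s.
Proof.
under eq_bigr do rewrite inflE.
rewrite (exchange_big_dep xpredT)//= sE mulr_sumr; apply: eq_bigr => M _.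
rewrite sumr_const mulr_natl; have [->//|Mm] := eqVneq #|M| m.
by rewrite nrm_deg// !mul0rn.
Qed.

Let sum_delta x : \sum_k (F x - ce [set k] F x) = m%:R * F x.
Proof.
rewrite sum_sub_ce// FE mulr_sumr; apply: eq_bigr => M _.
have [->//|Mm] := eqVneq #|M| m.
by rewrite [hproj _ _ _]f_deg// f_deg// !mulr0.
Qed.

Section influence_bound.
Variable r : R.
Hypothesis infl_le : forall k, infl k <= r.

(** Count an intersecting pair at its common elements: the sum is at most that of [infl k * infl k],
    hence at most [r] times the total influence. *)
Let pairs_meet : \sum_(q : {set I} * {set I} | ~~ [disjoint q.1 & q.2])
    nrm q.1 * nrm q.2 <= r * (m%:R * s).
Proof.
rewrite -sum_infl mulr_sumr.
apply: (@le_trans _ _ (\sum_k infl k * infl k)); last first.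
  apply: ler_sum => k _; apply: ler_wpM2r => //.
  by apply: Ex_ge0 => // x; exact: sqr_ge0.
have -> : \sum_k infl k * infl k = \sum_(q : {set I} * {set I})
    \sum_(k | (k \in q.1) && (k \in q.2)) nrm q.1 * nrm q.2.
  rewrite [RHS](exchange_big_dep xpredT)//=; apply: eq_bigr => k _.
  by rewrite inflE big_distrlr/= pair_big.
rewrite big_mkcond; apply: ler_sum => -[A B] _ /=; case: ifPn => AB.
  have /exists_inP[k kA kB] : [exists k in A, k \in B].
    apply: contraR AB => /exists_inPn H; apply/disjointP => i.
    by rewrite negb_and; case: (boolP (i \in A)) => //= /H.
  rewrite (bigD1 k) ?kA//= lerDl; apply: sumr_ge0 => *; exact: mulr_ge0.
by apply: sumr_ge0 => *; exact: mulr_ge0.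
Qed.

(** * Lower bound for the part of highest order of F^2 *)

Let T A B C D := Ex (fun x => f A x * f B x * (f C x * f D x)).

(* In the notation I = A + B, J = C + D, K = A + C, L = B + D the conditions
   I, J disjoint, K, L disjoint and I + J = K + L say that A, B, C, D are
   pairwise disjoint; [c B C A] integrates out A (and D). *)
Let c B C A := ce (~: (B :|: C)) (fun x => f (A :|: B) x * f (A :|: C) x).

(** The part of [F^2] of order [2m], as [hproj_V] shows; written with disjoint pairs, its second
    moment becomes a sum over four index sets. *)
Let V x := \sum_(q : {set I} * {set I} | [disjoint q.1 & q.2]) f q.1 x * f q.2 x.

(** A coordinate of [A] or [B] outside [C] and [D] occurs in just one of the four factors, as [A]
    and [B] are disjoint, and that factor is centred in it. *)
Let T_eq0 A B C D : ~~ (A :|: B \subset C :|: D) -> [disjoint A & B] ->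
  T A B C D = 0.
Proof.
move=> /subsetPn[k kAB]; rewrite inE negb_or => /andP[kC kD] /disjointP/(_ k).
rewrite /T; move: kAB; rewrite inE => /orP[kA|kB]; rewrite ?kA ?kB ?andbT /= => kN.
  under eq_Ex => x do rewrite -mulrA mulrC.
  apply: (@Ex_orth _ _ _ p p_sum1 [set k]) => [|x]; last exact: f_nul.
  by do !apply: invM; apply: f_inv; rewrite sub1set inE.
under eq_Ex => x do rewrite (mulrC (f A x)) -mulrA mulrC.
apply: (@Ex_orth _ _ _ p p_sum1 [set k]) => [|x]; last exact: f_nul.
by do !apply: invM; apply: f_inv; rewrite sub1set inE.
Qed.

(** By [T_eq0] only pairs of partitions of one and the same set survive. Two such partitions are the
    rows and the columns of a two by two table of disjoint blocks [A, B, C, D], which are recovered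
    as the four intersections. *)
Let V2E : Ex (fun x => V x ^+ 2) =
  \sum_(bc : {set I} * {set I} | [disjoint bc.1 & bc.2])
   \sum_(ad : {set I} * {set I} | [&& ad.1 \subset ~: (bc.1 :|: bc.2),
        ad.2 \subset ~: (bc.1 :|: bc.2) & [disjoint ad.1 & ad.2]])
     T (ad.1 :|: bc.1) (bc.2 :|: ad.2) (ad.1 :|: bc.2) (bc.1 :|: ad.2).
Proof.
transitivity (\sum_(t : ({set I} * {set I}) * ({set I} * {set I}) |
    [disjoint t.1.1 & t.1.2] && [disjoint t.2.1 & t.2.2])
    T t.1.1 t.1.2 t.2.1 t.2.2).
  under eq_Ex => x do rewrite expr2 /V big_distrlr/= pair_big/=.
  by rewrite Ex_sum.
rewrite (bigID (fun t : ({set I} * {set I}) * ({set I} * {set I}) =>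
   t.1.1 :|: t.1.2 == t.2.1 :|: t.2.2))/= [X in _ + X]big1 ?addr0; last first.
  move=> [[A B] [C D]] /= /andP[/andP[AB CD]].
  rewrite eqEsubset negb_and => /orP[] H; first exact: T_eq0.
  by rewrite /T (eq_Ex _ (fun x => mulrC _ _)); exact: T_eq0.
rewrite [RHS]pair_big_dep/=.
rewrite (reindex_onto
  (fun t : ({set I} * {set I}) * ({set I} * {set I}) =>
     ((t.2.1 :|: t.1.1, t.1.2 :|: t.2.2), (t.2.1 :|: t.1.2, t.1.1 :|: t.2.2)))
  (fun t : ({set I} * {set I}) * ({set I} * {set I}) =>
     ((t.1.1 :&: t.2.2, t.1.2 :&: t.2.1), (t.1.1 :&: t.2.1, t.1.2 :&: t.2.2))))/=.
  apply: eq_bigl => -[[B C] [A D]] /=; apply/idP/idP.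
    move=> /andP[/andP[/andP[/disjointP H1 /disjointP H2] /eqP H3] _].
    apply/and4P; split.
    - by apply/disjointP => i; move: (H1 i) (H2 i); rewrite !inE;
        do 4 case: (i \in _).
    - by apply/subsetP => i iA; move: (H1 i) (H2 i); rewrite !inE iA;
        do 3 case: (i \in _).
    - by apply/subsetP => i iA; move: (H1 i) (H2 i); rewrite !inE iA;
        do 3 case: (i \in _).
    - by apply/disjointP => i; move: (H1 i) (H2 i); rewrite !inE;
        do 4 case: (i \in _).
  move=> /and4P[/disjointP H1 /subsetP H2 /subsetP H3 /disjointP H4].
  have H i := conj (conj (H1 i) (H2 i)) (conj (H3 i) (H4 i)).
  have {H1 H2 H3 H4} H i : ~~ ((i \in B) && (i \in C)) &&
     ((i \in A) ==> (i \notin B) && (i \notin C)) &&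
     ((i \in D) ==> (i \notin B) && (i \notin C)) && ~~ ((i \in A) && (i \in D)).
    move: (H1 i) (H2 i) (H3 i) (H4 i); rewrite !inE.
    by do 4 case: (i \in _) => //=; try (move=> _ /(_ isT)); try (move=> _ _ /(_ isT)).
  apply/andP; split; [apply/andP; split; [apply/andP; split|]|].
  - by apply/disjointP => i; move: (H i); rewrite !inE; do 4 case: (i \in _).
  - by apply/disjointP => i; move: (H i); rewrite !inE; do 4 case: (i \in _).
  - by apply/eqP/setP => i; move: (H i); rewrite !inE; do 4 case: (i \in _).
  - by apply/eqP; congr ((_, _), (_, _)); apply/setP => i; move: (H i);
     rewrite !inE; do 4 case: (i \in _).
move=> [[A B] [C D]] /= /andP[/andP[/disjointP H1 /disjointP H2] /eqP/setP H3].
congr ((_, _), (_, _)); apply/setP => i; move: (H1 i) (H2 i) (H3 i);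
  rewrite !inE; by do 4 case: (i \in _).
Qed.

(** Given the coordinates in [B] and [C], the products [f_AB f_AC] and [f_DB f_DC] depend on the
    disjoint sets [A] and [D], hence are conditionally independent. *)
Let TcE A B C D : A \subset ~: (B :|: C) -> D \subset ~: (B :|: C) ->
    [disjoint A & D] ->
  T (A :|: B) (C :|: D) (A :|: C) (B :|: D) = Ex (fun x => c B C A x * c B C D x).
Proof.
move=> /subsetP AZ /subsetP DZ /disjointP AD; rewrite /T.
set Z := ~: (B :|: C).
pose a x := f (A :|: B) x * f (A :|: C) x.
pose b x := f (D :|: B) x * f (D :|: C) x.
have aZ x : ce A a x = ce Z a x.
  have -> : Z = A :|: (Z :\: A).
    by apply/setP => i; rewrite !inE; case: (boolP (i \in A)) => //= /AZ;
      rewrite !inE => ->.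
  rewrite -ce_ce//; apply: eq_ce => y; rewrite ce_id//.
  by apply: invM; apply: f_inv; apply/subsetP => i; rewrite !inE;
    do 3 case: (i \in _).
transitivity (Ex (fun x => b x * a x)).
  apply: eq_Ex => x; rewrite /a /b (setUC D B) (setUC D C); ring.
have bA : free_of A b.
  by apply: invM; apply: f_inv; apply/subsetP => i iA; move: (AD i) (AZ i iA);
    rewrite !inE iA; do 3 case: (i \in _).
rewrite (Ex_pull p_sum1 _ bA).
under eq_Ex => x do rewrite aZ mulrC.
rewrite (Ex_pull p_sum1 _ (@inv_ce _ _ _ p Z a)).
by [].
Qed.

(** After everything outside [B] and [C] is integrated out, the first factor depends on [B] only and
    the second on [C] only. *)
Let Ex_indep_ce B C u v : [disjoint B & C] -> free_of C u -> free_of B v ->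
  Ex (fun x => ce (~: (B :|: C)) u x * ce (~: (B :|: C)) v x) = Ex u * Ex v.
Proof.
move=> /disjointP BC Cu Bv; rewrite (@Ex_indep _ _ _ p p_sum1 C).
- by rewrite !Ex_ce.
- exact: inv_ceW.
- apply: (@invS _ _ _ (~: (B :|: C) :|: B)).
    by apply/subsetP => i; move: (BC i); rewrite !inE; do 2 case: (i \in _).
  by apply: invU; [exact: inv_ce|exact: inv_ceW].
Qed.

Let cc_le B C A D : [disjoint B & C] ->
    A \subset ~: (B :|: C) -> D \subset ~: (B :|: C) ->
  Ex (fun x => c B C A x * c B C D x) <=
  2^-1 * (nrm (A :|: B) * nrm (C :|: D) + nrm (A :|: C) * nrm (B :|: D)).
Proof.
move=> BC /subsetP AZ /subsetP DZ.
set Z := ~: (B :|: C).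
apply: (@le_trans _ _ (Ex (fun x => 2^-1 *
   (ce Z (fun x => f (A :|: B) x ^+ 2) x * ce Z (fun x => f (D :|: C) x ^+ 2) x +
    ce Z (fun x => f (A :|: C) x ^+ 2) x * ce Z (fun x => f (D :|: B) x ^+ 2) x)))).
  by apply: (ler_Ex p_ge0) => x; exact: ce_mul_le.
rewrite /Z.
have /disjointP BC' := BC.
have iC (X : {set I}) : X \subset ~: (B :|: C) -> free_of C (fun x => f (X :|: B) x ^+ 2).
  move=> /subsetP XZ; apply: (@inv_comp _ _ _ C _ (fun t : R => t ^+ 2)).
  apply: f_inv; apply/subsetP => i iC; move: (XZ i) (BC' i); rewrite !inE iC.
  by do 2 case: (i \in _) => //=; move=> /(_ isT).
have iB (X : {set I}) : X \subset ~: (B :|: C) -> free_of B (fun x => f (X :|: C) x ^+ 2).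
  move=> /subsetP XZ; apply: (@inv_comp _ _ _ B _ (fun t : R => t ^+ 2)).
  apply: f_inv; apply/subsetP => i iB; move: (XZ i) (BC' i); rewrite !inE iB.
  by do 2 case: (i \in _) => //=; move=> /(_ isT).
rewrite ExZ ExD ler_wpM2l ?invr_ge0// Ex_indep_ce//; last 2 first.
  by apply: iC; exact/subsetP.
  by apply: iB; exact/subsetP.
under [X in _ + X]eq_Ex => x do rewrite mulrC.
rewrite Ex_indep_ce//; last 2 first.
  by apply: iC; exact/subsetP.
  by apply: iB; exact/subsetP.
by rewrite (setUC D C) (setUC D B) (mulrC (Ex (fun x => f (B :|: D) x ^+ 2))).
Qed.

(** Completing the square: the sum over disjoint [A, D] is the full double sum, which is a square,
    minus the terms with a common index; those are bounded by [cc_le]. *)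
Let inner_ge B C : [disjoint B & C] ->
  \sum_(ad : {set I} * {set I} | [&& ad.1 \subset ~: (B :|: C),
        ad.2 \subset ~: (B :|: C) & [disjoint ad.1 & ad.2]])
     T (ad.1 :|: B) (C :|: ad.2) (ad.1 :|: C) (B :|: ad.2) >=
  Ex (fun x => (\sum_(A : {set I} | A \subset ~: (B :|: C)) c B C A x) ^+ 2) -
  \sum_(ad : {set I} * {set I} | [&& ad.1 \subset ~: (B :|: C),
        ad.2 \subset ~: (B :|: C) & ~~ [disjoint ad.1 & ad.2]])
    2^-1 * (nrm (ad.1 :|: B) * nrm (C :|: ad.2) +
            nrm (ad.1 :|: C) * nrm (B :|: ad.2)).
Proof.
move=> BC; set Z := ~: (B :|: C).
have -> : Ex (fun x => (\sum_(A : {set I} | A \subset Z) c B C A x) ^+ 2) =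
    \sum_(ad : {set I} * {set I} | (ad.1 \subset Z) && (ad.2 \subset Z))
      Ex (fun x => c B C ad.1 x * c B C ad.2 x).
  under eq_Ex => x do rewrite expr2 big_distrlr/= pair_big/=.
  by rewrite Ex_sum.
rewrite (bigID (fun ad : {set I} * {set I} => [disjoint ad.1 & ad.2]))/=.
have -> : \sum_(i : {set I} * {set I} | (i.1 \subset Z) && (i.2 \subset Z) && [disjoint i.1 & i.2])
     Ex (fun x => c B C i.1 x * c B C i.2 x) =
  \sum_(ad : {set I} * {set I} | [&& ad.1 \subset Z, ad.2 \subset Z & [disjoint ad.1 & ad.2]])
     T (ad.1 :|: B) (C :|: ad.2) (ad.1 :|: C) (B :|: ad.2).
  apply: eq_big => [ad|[A D]/= /andP[/andP[AZ DZ] AD]]; first by rewrite andbA.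
  by rewrite TcE.
rewrite -addrA gerDl subr_le0.
rewrite (eq_bigl (fun ad : {set I} * {set I} => [&& ad.1 \subset Z,
  ad.2 \subset Z & ~~ [disjoint ad.1 & ad.2]])); last by move=> ad; rewrite andbA.
by apply: ler_sum => -[A D] /= /and3P[AZ DZ _]; exact: cc_le.
Qed.

(* The two contributions s^2 to the main term come from B = C = set0 and from
   A = set0, |B| = |C| = m. *)
Let diag_ge B C : [disjoint B & C] ->
  (B == set0)%:R * (C == set0)%:R * s ^+ 2 + nrm B * nrm C <=
  Ex (fun x => (\sum_(A : {set I} | A \subset ~: (B :|: C)) c B C A x) ^+ 2).
Proof.
move=> BC.
have [/andP[/eqP-> /eqP->]|BC0] := boolP ((B == set0) && (C == set0)).
  rewrite eqxx !mul1r (@nrm_deg set0) ?mul0r ?addr0; last first.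
    by rewrite cards0 eq_sym -lt0n.
  rewrite -[leLHS](Ex_cst p_sum1); apply: (ler_Ex p_ge0) => x.
  rewrite le_eqVlt; apply/orP; left; apply/eqP; congr (_ ^+ 2).
  rewrite sE setU0 setC0; apply: eq_big => A; first by rewrite subsetT.
  by move=> _; rewrite /c !setU0 setC0 ceT.
rewrite -natrM mulnb (negbTE BC0) mul0r add0r.
have [Bm|Bm] := eqVneq #|B| m; last first.
  by rewrite nrm_deg// mul0r; apply: Ex_ge0 => // x; exact: sqr_ge0.
have [Cm|Cm] := eqVneq #|C| m; last first.
  by rewrite (@nrm_deg C)// mulr0; apply: Ex_ge0 => // x; exact: sqr_ge0.
have /disjointP BC' := BC.
rewrite -(@Ex_indep _ _ _ p p_sum1 (~: B) (fun x => f B x ^+ 2)); last 2 first.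
- by apply: (@inv_comp _ _ _ _ _ (fun t : R => t ^+ 2)); exact: f_inv.
- apply: (@inv_comp _ _ _ _ _ (fun t : R => t ^+ 2)); apply: f_inv.
  by apply/subsetP => i; move: (BC' i); rewrite !inE; do 2 case: (i \in _).
apply: (ler_Ex p_ge0) => x; rewrite -exprMn.
rewrite le_eqVlt; apply/orP; left; apply/eqP; congr (_ ^+ 2).
(* Only [A = set0] contributes: since [|B| = m], adding a nonempty [A] disjoint from [B] gives an
   index set of the wrong size. *)
rewrite (bigD1 set0) ?sub0set//= big1 ?addr0 => [|A /andP[/subsetP AZ A0]].
  rewrite /c !set0U ce_id//; apply: invM; apply: f_inv; rewrite setCS.
    exact: subsetUl.
  exact: subsetUr.
rewrite /c -[RHS](Ex_cst p_sum1); apply: eq_Ex => y; rewrite f_deg ?mul0r//.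
have AB : A :&: B = set0.
  apply/setP => i; rewrite !inE; case: (boolP (i \in A)) => //= /AZ.
  by rewrite !inE negb_or => /andP[/negbTE->].
rewrite cardsU AB cards0 subn0 Bm -[X in _ != X]add0n eqn_add2r.
by rewrite cards_eq0.
Qed.

(** Nonzero terms have [K = A + B] and [L = C + D] of size [m], and [A], [D] are subsets of them: at
    most [2^m * 2^m] terms for each pair [K, L]. A common index of [A] and [D] is common to [K] and
    [L], so [pairs_meet] applies. *)
Let quad_le : \sum_(bc : {set I} * {set I} | [disjoint bc.1 & bc.2])
   \sum_(ad : {set I} * {set I} | [&& ad.1 \subset ~: (bc.1 :|: bc.2),
        ad.2 \subset ~: (bc.1 :|: bc.2) & ~~ [disjoint ad.1 & ad.2]])
     nrm (ad.1 :|: bc.1) * nrm (bc.2 :|: ad.2) <=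
  4 ^+ m * (r * (m%:R * s)).
Proof.
rewrite pair_big_dep/=.
rewrite (reindex_onto
  (fun t : ({set I} * {set I}) * ({set I} * {set I}) =>
     ((t.1.1 :\: t.2.1, t.1.2 :\: t.2.2), (t.2.1, t.2.2)))
  (fun t : ({set I} * {set I}) * ({set I} * {set I}) =>
     ((t.2.1 :|: t.1.1, t.1.2 :|: t.2.2), (t.2.1, t.2.2))))/=; last first.
  move=> [[B C] [A D]] /= /and4P[/disjointP H1 /subset_implyb H2 /subset_implyb H3 _].
  congr ((_, _), (_, _)); apply/setP => i; move: (H1 i) (H2 i) (H3 i); rewrite !inE;
   by do 4 case: (i \in _).
apply: (@le_trans _ _ (\sum_(t : ({set I} * {set I}) * ({set I} * {set I}) |
   [&& ~~ [disjoint t.1.1 & t.1.2], t.2.1 \subset t.1.1 & t.2.2 \subset t.1.2])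
     nrm t.1.1 * nrm t.1.2)).
  rewrite big_mkcond [leRHS]big_mkcond; apply: ler_sum => -[[K L] [A D]] _ /=.
  case: ifPn => [|_]; last by case: ifP => // _; exact: mulr_ge0.
  move=> /andP[/and4P[_ _ _ AD]]; rewrite xpair_eqE => /andP[/eqP E _].
  have AK : A :|: (K :\: A) = K by case: E.
  have DL : L :\: D :|: D = L by case: E.
  have -> : A \subset K by rewrite -AK subsetUl.
  have -> : D \subset L by rewrite -DL subsetUr.
  rewrite AK DL !andbT ifT//; apply: contra AD; rewrite -AK -DL => /disjointP H.
  by apply/disjointP => i; move: (H i); rewrite !inE; do 4 case: (i \in _).
rewrite -(pair_big_dep (fun q : {set I} * {set I} => ~~ [disjoint q.1 & q.2])
  (fun q q' : {set I} * {set I} => (q'.1 \subset q.1) && (q'.2 \subset q.2))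
  (fun q _ => nrm q.1 * nrm q.2))/=.
apply: (@le_trans _ _ (4 ^+ m * \sum_(q : {set I} * {set I} | ~~ [disjoint q.1 & q.2])
    nrm q.1 * nrm q.2)); last first.
  by rewrite ler_wpM2l// exprn_ge0.
rewrite mulr_sumr; apply: ler_sum => -[K L] /= KL.
have [Km|Km] := eqVneq #|K| m; last first.
  by rewrite nrm_deg// mul0r mulr0 big1.
have [Lm|Lm] := eqVneq #|L| m; last first.
  by rewrite (@nrm_deg L)// !mulr0 big1.
rewrite -(pair_big (fun A => A \subset K) (fun A => A \subset L)
  (fun _ _ => nrm K * nrm L))/= !sumr_const.
have E (X : {set I}) : #|[pred A : {set I} | A \subset X]| = (2 ^ #|X|)%N.
  by rewrite -card_powerset; apply: eq_card => A; rewrite !inE.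
rewrite !E Km Lm -mulrnA -[leLHS]mulr_natl -expnMn natrX.
by rewrite lexx.
Qed.

Let quad_le' : \sum_(bc : {set I} * {set I} | [disjoint bc.1 & bc.2])
   \sum_(ad : {set I} * {set I} | [&& ad.1 \subset ~: (bc.1 :|: bc.2),
        ad.2 \subset ~: (bc.1 :|: bc.2) & ~~ [disjoint ad.1 & ad.2]])
     nrm (ad.1 :|: bc.2) * nrm (bc.1 :|: ad.2) <=
  4 ^+ m * (r * (m%:R * s)).
Proof.
apply: le_trans quad_le.
have swK : involutive (fun q : {set I} * {set I} => (q.2, q.1)) by case.
rewrite (reindex_inj (inv_inj swK))/= le_eqVlt; apply/orP; left; apply/eqP.
apply: eq_big => [bc|bc _]; first by rewrite disjoint_sym.
by apply: eq_bigl => ad; rewrite setUC.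
Qed.

(** In the error, [4 ^+ m] pays for the intersecting [A, D], and [1] for the intersecting [B, C]
    that are absent from the diagonal terms. *)
Let top_ge : 2 * s ^+ 2 - (4 ^+ m + 1) * (r * (m%:R * s)) <= Ex (fun x => V x ^+ 2).
Proof.
rewrite V2E; apply: le_trans (ler_sum _ (fun bc => @inner_ge bc.1 bc.2)).
rewrite sumrB.
have -> : 2 * s ^+ 2 - (4 ^+ m + 1) * (r * (m%:R * s)) =
  (2 * s ^+ 2 - r * (m%:R * s)) - 4 ^+ m * (r * (m%:R * s)) by ring.
apply: lerB; last first.
  under eq_bigr do under eq_bigr do rewrite mulrDr.
  under eq_bigr do rewrite big_split -!mulr_sumr/=.
  rewrite big_split -!mulr_sumr/=.
  move: quad_le quad_le'; lra.
apply: le_trans (ler_sum _ (fun bc => @diag_ge bc.1 bc.2)).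
rewrite big_split/= (bigD1 (set0, set0))/=; last by rewrite -setI_eq0 setI0.
rewrite eqxx !mul1r [X in _ + X + _]big1 ?addr0 => [|[B C] /andP[_ BC]]; last first.
  rewrite /= -natrM mulnb; move: BC; rewrite xpair_eqE => /negbTE ->.
  by rewrite mul0r.
have E : s ^+ 2 = \sum_(q : {set I} * {set I}) nrm q.1 * nrm q.2.
  by rewrite expr2 sE big_distrlr/= pair_big.
have : s ^+ 2 - r * (m%:R * s) <=
    \sum_(q : {set I} * {set I} | [disjoint q.1 & q.2]) nrm q.1 * nrm q.2.
  rewrite E (bigID (fun q : {set I} * {set I} => [disjoint q.1 & q.2]))/=.
  by rewrite lerBlDr lerD2l; exact: pairs_meet.
lra.
Qed.

(** * Hoeffding components of F^2 *)

Let u x := F x ^+ 2.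

Let uE x : u x = \sum_(q : {set I} * {set I}) f q.1 x * f q.2 x.
Proof. by rewrite /u expr2 FE big_distrlr/= pair_big. Qed.

Let hproj_ff_sub0 M A B x : ~~ (M \subset A :|: B) ->
  hproj M (fun x => f A x * f B x) x = 0.
Proof.
move=> /subsetPn[k kM]; rewrite inE negb_or => /andP[kA kB].
apply: (@hproj_eq0_inv _ _ _ _ p_sum1 _ _ k) => //.
by apply: invM; apply: f_inv; rewrite sub1set inE.
Qed.

Let hproj_cst0 M x v : (forall x, v x = 0) -> hproj M v x = 0.
Proof.
move=> v0; rewrite /hproj big1// => L _; rewrite (_ : ce _ _ _ = 0) ?mulr0//.
by rewrite (eq_ce _ _ v0) /ce Ex_cst.
Qed.

Let hproj_u_big M x : (m.*2 < #|M|)%N -> hproj M u x = 0.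
Proof.
move=> Mm; rewrite (eq_proj _ _ uE) hproj_sum big1// => -[A B] _ /=.
have [Am|Am] := eqVneq #|A| m; last first.
  by apply: hproj_cst0 => y; rewrite f_deg// mul0r.
have [Bm|Bm] := eqVneq #|B| m; last first.
  by apply: hproj_cst0 => y; rewrite (@f_deg B)// mulr0.
apply: hproj_ff_sub0; apply: contraL Mm => /subset_leq_card ML.
rewrite -leqNgt (leq_trans ML)// (leq_trans (leq_card_setU _ _))//.
by rewrite Am Bm addnn.
Qed.

(** For disjoint [A, B] of size [m] the product [f A * f B] is a pure component of index [A :|: B],
    of order [2m]; for intersecting ones the union is too small to reach that order. *)
Let hproj_V M x : hproj M V x = if #|M| == m.*2 then hproj M u x else 0.
Proof.
case: ifPn => Mm.
  rewrite (eq_proj _ _ uE) /V !hproj_sum [RHS](bigID (fun q : {set I} * {set I} =>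
    [disjoint q.1 & q.2]))/= [X in _ + X]big1 ?addr0// => -[A B] /= AB.
  have [Am|Am] := eqVneq #|A| m; last first.
    by apply: hproj_cst0 => y; rewrite f_deg// mul0r.
  have [Bm|Bm] := eqVneq #|B| m; last first.
    by apply: hproj_cst0 => y; rewrite (@f_deg B)// mulr0.
  apply: hproj_ff_sub0; apply: contra AB => /subset_leq_card.
  rewrite (eqP Mm) cardsU Am Bm addnn -setI_eq0 -cards_eq0.
  have : (#|A :&: B| <= m)%N by rewrite -Am subset_leq_card// subsetIl.
  move: m_gt0; move: #|_ :&: _| => n; rewrite -addnn; lia.
rewrite hproj_sum big1// => -[A B] /= AB.
have [Am|Am] := eqVneq #|A| m; last first.
  by apply: hproj_cst0 => y; rewrite f_deg// mul0r.
have [Bm|Bm] := eqVneq #|B| m; last first.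
  by apply: hproj_cst0 => y; rewrite (@f_deg B)// mulr0.
have /disjointP AB' := AB.
apply: (@hproj_eq0 _ _ _ _ p_sum1 M (A :|: B)).
- apply: contra Mm => /eqP->.
  by move: AB; rewrite -setI_eq0 => /eqP AB; rewrite cardsU AB cards0 subn0 Am Bm addnn.
- move=> k; rewrite inE => /orP[kA|kB] y.
    under eq_ce => z do rewrite mulrC.
    rewrite ce_pull ?f_nul ?mulr0//; apply: f_inv.
    by rewrite sub1set inE; move: (AB' k); rewrite kA.
  rewrite ce_pull ?f_nul ?mulr0//; apply: f_inv.
  by rewrite sub1set inE; move: (AB' k); rewrite kB andbT.
- by apply: invM; apply: f_inv; rewrite setCS ?subsetUl ?subsetUr.
Qed.

Let a M := Ex (fun x => hproj M u x ^+ 2).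

Let a_ge0 M : 0 <= a M.
Proof. by apply: Ex_ge0 => // x; exact: sqr_ge0. Qed.

Let a_big M : (m.*2 < #|M|)%N -> a M = 0.
Proof.
move=> Mm; rewrite /a -[RHS](Ex_cst p_sum1); apply: eq_Ex => x.
by rewrite hproj_u_big// expr0n.
Qed.

Let a0 : a set0 = s ^+ 2.
Proof.
rewrite /a -[RHS](Ex_cst p_sum1); apply: eq_Ex => x; congr (_ ^+ 2).
rewrite /hproj (big_pred1 set0) => [|L]; last by rewrite subset0.
by rewrite setD0 cards0 expr0 mul1r setC0 ceT.
Qed.

Let q := Ex (fun x => F x ^+ 4).

(* The Hoeffding components of F^2 that have to vanish in the limit. *)
Let mid := \sum_(M : {set I} | (M != set0) && (#|M| != m.*2)) a M.

(** Parseval for [F^2], split by order into the mean, the middle and the top; [m_gt0] keeps the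
    first and the last apart. *)
Let qE : q = s ^+ 2 + mid + Ex (fun x => V x ^+ 2).
Proof.
have -> : q = \sum_M a M.
  rewrite -parseval//; apply: eq_Ex => x; rewrite /u; ring.
rewrite (bigD1 set0)//= a0 -addrA; congr (_ + _).
rewrite (bigID (fun M : {set I} => #|M| == m.*2))/= addrC; congr (_ + _).
rewrite (parseval p_sum1) big_mkcond [RHS]big_mkcond; apply: eq_bigr => M _.
case: ifPn => [/andP[M0 Mm]|].
  by apply: eq_Ex => x; rewrite hproj_V Mm.
rewrite negb_and negbK => M0m.
rewrite -[LHS](Ex_cst p_sum1); apply: eq_Ex => x.
rewrite hproj_V; case: ifPn; rewrite ?expr0n// => Mm.
move: M0m; rewrite Mm orbF => /eqP M0; move: Mm; rewrite M0 cards0 eq_sym.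
by rewrite double_eq0 -[m == 0]negbK -lt0n m_gt0.
Qed.

(** The fourth cumulant of [F] plus the error of [top_ge]: the one quantity that all remaining
    estimates need to be small besides the influences. *)
Let kappa := q - 3 * s ^+ 2 + (4 ^+ m + 1) * (r * (m%:R * s)).

Let mid_le : mid <= kappa.
Proof. by move: top_ge; rewrite /kappa qE; lra. Qed.

(** * Carre du champ and fourth moments of the increments *)

Let delta k x := F x - ce [set k] F x.
Let var k := ce [set k] (fun x => delta k x ^+ 2).
(* Twice the carre du champ operator. *)
Let Gamma x := \sum_k (delta k x ^+ 2 + var k x).

Let delta_nul k x : ce [set k] (delta k) x = 0.
Proof. by rewrite ceB ce_ce// setUid subrr. Qed.

(** Each summand equals [2 F delta k - (F^2 - E_k F^2)]; summed over [k], the first term is [2m F^2]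
    and the second multiplies the component [M] by [|M|]. *)
Let GammaE x : Gamma x = \sum_(M : {set I}) (2 * m%:R - #|M|%:R) * hproj M u x.
Proof.
transitivity (2 * m%:R * u x - \sum_k (u x - ce [set k] u x)); last first.
  rewrite sum_sub_ce// -[u x in LHS](hproj_sumE p_sum1) mulr_sumr -sumrB.
  by apply: eq_bigr => M _; rewrite mulrBl.
have -> : 2 * m%:R * u x = \sum_k 2 * F x * delta k x.
  by rewrite -mulr_sumr sum_delta /u; ring.
rewrite -sumrB; apply: eq_bigr => k _.
have -> : var k x = ce [set k] u x - ce [set k] F x ^+ 2.
  have E : (fun x => delta k x ^+ 2) =1 (fun x => u x + (ce [set k] F x *
     ((-2) * F x + ce [set k] F x))).
    by move=> y; rewrite /delta /u; ring.
  rewrite /var (eq_ce _ _ E) ceD ce_pull; last exact: inv_ce.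
  rewrite ceD ceZ ce_ce// setUid; ring.
rewrite /delta /u; ring.
Qed.

(** The component [set0] is the mean. The multiplier [2m - |M|] vanishes at order [2m] and lies
    between 0 and [2m] at the lower orders, so its square is at most [4 m^2] on the middle part. *)
Let Gamma_var : Ex (fun x => (Gamma x - 2 * m%:R * s) ^+ 2) <= 4 * m%:R ^+ 2 * kappa.
Proof.
apply: (@le_trans _ _ (4 * m%:R ^+ 2 * mid)); last first.
  by rewrite ler_wpM2l// mulr_ge0// exprn_ge0.
have -> : Ex (fun x => (Gamma x - 2 * m%:R * s) ^+ 2) =
    \sum_(M : {set I}) ((M != set0)%:R * (2 * m%:R - #|M|%:R)) ^+ 2 * a M.
  transitivity (\sum_(M : {set I}) ((M != set0)%:R * (2 * m%:R - #|M|%:R)) *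
    ((M != set0)%:R * (2 * m%:R - #|M|%:R)) * a M); last first.
    by apply: eq_bigr => M _; rewrite expr2.
  rewrite -Ex_proj_sum//; apply: eq_Ex => x; rewrite -expr2; congr (_ ^+ 2).
  rewrite GammaE (bigD1 set0)//= [RHS](bigD1 set0)//= eqxx !mul0r add0r cards0 subr0.
  have -> : hproj set0 u x = s.
    rewrite /hproj (big_pred1 set0) => [|L]; last by rewrite subset0.
    by rewrite setD0 cards0 expr0 mul1r setC0 ceT.
  rewrite addrAC -[RHS]add0r; congr (_ + _); first ring.
  by apply: eq_bigr => M ->; rewrite mul1r.
rewrite mulr_sumr [leRHS]big_mkcond; apply: ler_sum => M _.
have [->|M0] := eqVneq M set0; first by rewrite mul0r expr0n mul0r.
rewrite mul1r /=; case: ifPn => [Mm|]; last first.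
  by rewrite negbK => /eqP ->; rewrite -mul2n natrM subrr expr0n mul0r.
have [Mb|Mb] := leqP #|M| m.*2; last by rewrite a_big// !mulr0.
rewrite ler_wpM2r//.
have h1 : #|M|%:R <= 2 * m%:R :> R by rewrite -natrM ler_nat mul2n.
have h2 : 0 <= #|M|%:R :> R by [].
nra.
Qed.

Let F2Gamma : Ex (fun x => F x ^+ 2 * Gamma x) <= 2 * m%:R * (s ^+ 2 + kappa).
Proof.
apply: (@le_trans _ _ (2 * m%:R * (s ^+ 2 + mid))); last first.
  by rewrite ler_wpM2l ?lerD2l ?mulr_ge0.
have -> : Ex (fun x => F x ^+ 2 * Gamma x) =
    \sum_(M : {set I}) 1 * (2 * m%:R - #|M|%:R) * a M.
  rewrite -Ex_proj_sum//; apply: eq_Ex => x; rewrite -GammaE; congr (_ * _).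
  by under eq_bigr do rewrite mul1r; rewrite hproj_sumE.
rewrite (bigD1 set0)//= cards0 subr0 mul1r a0 mulrDr lerD2l mulr_sumr.
rewrite big_mkcondr/=; rewrite big_mkcond [leRHS]big_mkcond; apply: ler_sum => M _.
case: ifPn => // M0; rewrite mul1r; case: ifPn => [Mm|]; last first.
  by rewrite negbK => /eqP ->; rewrite -mul2n natrM subrr mul0r.
by rewrite ler_wpM2r// gerBl.
Qed.

(** Expand [F = b + delta k]. The terms [e1] to [e4] vanish because [delta k] and
    [var k - delta k ^+ 2] have conditional mean 0 and their cofactors do not involve the coordinate
    [k]. *)
Let fourth_id k : 3 * Ex (fun x => F x ^+ 2 * (delta k x ^+ 2 + var k x)) -
   2 * Ex (fun x => delta k x * F x ^+ 3) =
   Ex (fun x => delta k x ^+ 4) + 3 * Ex (fun x => var k x ^+ 2).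
Proof.
pose b := ce [set k] F.
have bi : free_of [set k] b by exact: inv_ce.
have vi : free_of [set k] (var k) by exact: inv_ce.
have vd x : ce [set k] (fun x => var k x - delta k x ^+ 2) x = 0.
  by rewrite ceB ce_ce// setUid subrr.
have e1 : Ex (fun x => b x ^+ 2 * (var k x - delta k x ^+ 2)) = 0.
  apply: (Ex_orth p_sum1 _ vd).
  by apply: (@inv_comp _ _ _ _ _ (fun t : R => t ^+ 2)).
have e2 : Ex (fun x => (b x * var k x) * delta k x) = 0.
  apply: (Ex_orth p_sum1 _ (delta_nul k)); exact: invM.
have e3 : Ex (fun x => var k x * (var k x - delta k x ^+ 2)) = 0.
  exact: (Ex_orth p_sum1 _ vd).
have e4 : Ex (fun x => b x ^+ 3 * delta k x) = 0.
  apply: (Ex_orth p_sum1 _ (delta_nul k)).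
  by apply: (@inv_comp _ _ _ _ _ (fun t : R => t ^+ 3)).
have E x : 3 * (F x ^+ 2 * (delta k x ^+ 2 + var k x)) -
     2 * (delta k x * F x ^+ 3) =
   (delta k x ^+ 4 + 3 * var k x ^+ 2) +
   (3 * (b x ^+ 2 * (var k x - delta k x ^+ 2)) +
    (6 * (b x * var k x * delta k x) +
    ((-3) * (var k x * (var k x - delta k x ^+ 2)) +
     (-2) * (b x ^+ 3 * delta k x)))).
  have -> : F x = b x + delta k x by rewrite /delta /b; ring.
  ring.
rewrite -!ExZ -ExB -ExD (eq_Ex _ E) ExD !(ExD, ExZ) e1 e2 e3 e4.
ring.
Qed.

(** Summing [fourth_id] bounds the left side by [6m (s^2 + kappa) - 2m q], and inserting [q] from
    the definition of [kappa] cancels the terms in [s^2]. *)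
Let sum_fourth : \sum_k Ex (fun x => delta k x ^+ 4) <=
  4 * m%:R * kappa + 2 * m%:R * (4 ^+ m + 1) * (r * (m%:R * s)).
Proof.
apply: (@le_trans _ _ (\sum_k (Ex (fun x => delta k x ^+ 4) +
    3 * Ex (fun x => var k x ^+ 2)))).
  apply: ler_sum => k _; rewrite lerDl mulr_ge0//; apply: Ex_ge0 => // x.
  exact: sqr_ge0.
under eq_bigr do rewrite -fourth_id.
rewrite sumrB -!mulr_sumr -!Ex_sum.
have -> : Ex (fun x => \sum_k F x ^+ 2 * (delta k x ^+ 2 + var k x)) =
    Ex (fun x => F x ^+ 2 * Gamma x).
  by apply: eq_Ex => x; rewrite /Gamma mulr_sumr.
have -> : Ex (fun x => \sum_k delta k x * F x ^+ 3) = m%:R * q.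
  by rewrite /q -ExZ; apply: eq_Ex => x; rewrite -mulr_suml sum_delta; ring.
by move: F2Gamma; rewrite /kappa; lra.
Qed.

(** * Stein's identity with remainder *)

Section stein.
Variables (phi phi' : R -> R) (B eps C : R).
Hypothesis C_ge0 : 0 <= C.
(** A modulus [eps + C t^2] of [phi'] replaces a bound on a second derivative; multiplied by squared
    increments it leads to influences and fourth moments only. *)
Hypothesis phi_taylor : forall t t',
  `|phi t - phi t' - phi' t' * (t - t')| <= `|t - t'| * (eps + C * (t - t') ^+ 2).
Hypothesis phi'_mod : forall t t', `|phi' t - phi' t'| <= eps + C * (t - t') ^+ 2.
Hypothesis phi'_le : forall t, `|phi' t| <= B.

Let stein_k k :
  `|2 * Ex (fun x => delta k x * phi (F x)) -
    Ex (fun x => phi' (F x) * (delta k x ^+ 2 + var k x))| <=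
  4 * (eps * infl k + C * Ex (fun x => delta k x ^+ 4)).
Proof.
pose b := ce [set k] F.
have b_inv : free_of [set k] b by exact: inv_ce.
have bi (g : R -> R) : free_of [set k] (fun x => g (b x)).
  by move=> y x; rewrite b_inv.
have vi : free_of [set k] (var k) by exact: inv_ce.
have vd x : ce [set k] (fun x => var k x - delta k x ^+ 2) x = 0.
  by rewrite ceB ce_ce// setUid subrr.
have v_ge0 x : 0 <= var k x by apply: Ex_ge0 => // y; exact: sqr_ge0.
have Fb x : F x = b x + delta k x by rewrite /delta /b; ring.
have e1 : Ex (fun x => phi (b x) * delta k x) = 0.
  exact: (Ex_orth p_sum1 (bi phi) (delta_nul k)).
have e2 : Ex (fun x => phi' (b x) * (var k x - delta k x ^+ 2)) = 0.
  exact: (Ex_orth p_sum1 (bi phi') vd).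
have e3 : Ex (fun x => var k x * (var k x - delta k x ^+ 2)) = 0.
  exact: (Ex_orth p_sum1 vi vd).
have e4 : Ex (var k) = infl k by rewrite Ex_ce.
have e5 : 0 <= Ex (fun x => (var k x - delta k x ^+ 2) ^+ 2).
  by apply: Ex_ge0 => // x; exact: sqr_ge0.
(* The last two terms have mean 0 by [e1] and [e2]; what remains is a Taylor remainder and an
   increment of [phi']. *)
have E x : 2 * (delta k x * phi (F x)) - phi' (F x) * (delta k x ^+ 2 + var k x) =
   2 * (delta k x * (phi (F x) - phi (b x) - phi' (F x) * delta k x)) +
   ((phi' (b x) - phi' (F x)) * (var k x - delta k x ^+ 2) +
   (2 * (phi (b x) * delta k x) +
   (-1) * (phi' (b x) * (var k x - delta k x ^+ 2)))) by ring.
rewrite -ExZ -ExB (eq_Ex _ E) ExD ExD ExD !ExZ e1 e2 !mulr0 !addr0 -ExZ -ExD.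
apply: le_trans (ler_norm_Ex p_ge0 _) _.
(* The last two terms encode [E[var k delta k^2] = E[var k^2] <= E[delta k^4]]: the negative square
   is discarded afterwards, and the other term has mean 0 by [e3]. *)
apply: (@le_trans _ _ (Ex (fun x => (3 * eps) * delta k x ^+ 2 +
   (eps * var k x + (4 * C * delta k x ^+ 4 +
    ((- C) * (var k x - delta k x ^+ 2) ^+ 2 + C * (var k x * (var k x - delta k x ^+ 2)))))))).
  apply: (ler_Ex p_ge0) => x; apply: le_trans (ler_normD _ _) _.
  have h1 : `|2 * (delta k x * (phi (F x) - phi (b x) - phi' (F x) * delta k x))|
      <= 2 * (delta k x ^+ 2 * (eps + C * delta k x ^+ 2)).
    rewrite normrM ger0_norm// ler_wpM2l// normrM.
    have := phi_taylor (b x) (F x).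
    have -> : b x - F x = - delta k x by rewrite Fb; ring.
    rewrite normrN sqrrN mulrN opprK => H.
    have -> : phi (F x) - phi (b x) - phi' (F x) * delta k x =
      - (phi (b x) - phi (F x) + phi' (F x) * delta k x) by ring.
    rewrite normrN.
    apply: le_trans (ler_wpM2l (normr_ge0 _) H) _.
    by rewrite mulrA -expr2 real_normK ?num_real.
  have h2 : `|(phi' (b x) - phi' (F x)) * (var k x - delta k x ^+ 2)| <=
      (eps + C * delta k x ^+ 2) * (var k x + delta k x ^+ 2).
    rewrite normrM; apply: ler_pM => //.
      have := phi'_mod (b x) (F x).
      have -> : b x - F x = - delta k x by rewrite Fb; ring.
      by rewrite sqrrN.
    have := v_ge0 x; have := sqr_ge0 (delta k x) => H1 H2.
    by rewrite ler_norml; apply/andP; split; lra.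
  apply: le_trans (lerD h1 h2) _; rewrite le_eqVlt; apply/orP; left; apply/eqP.
  ring.
rewrite !ExD !ExZ e3 e4 mulr0 addr0.
have -> : Ex (fun x => delta k x ^+ 2) = infl k by [].
have : 0 <= C * Ex (fun x => (var k x - delta k x ^+ 2) ^+ 2) by exact: mulr_ge0.
lra.
Qed.

(** The inequality [t <= eta / 2 + t^2 / (2 eta)] takes the place of Cauchy-Schwarz, so that no
    square root is taken in the ordered field [R]; [eta] stays free until the final choice of
    constants. *)
Let stein_bound (eta : R) : 0 < eta ->
  `|Ex (fun x => phi' (F x) - F x * phi (F x))| <=
  B * (`|1 - s| + (eta + kappa / eta) / 2) + 2 * eps * s +
  4 * C * (2 * kappa + (4 ^+ m + 1) * (r * (m%:R * s))).
Proof.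
move=> eta_gt0.
have m0 : 0 < m%:R :> R by rewrite ltr0n.
have h1 : `|2 * m%:R * Ex (fun x => F x * phi (F x)) -
     Ex (fun x => phi' (F x) * Gamma x)| <=
   4 * (eps * (m%:R * s) + C * (4 * m%:R * kappa + 2 * m%:R * (4 ^+ m + 1) * (r * (m%:R * s)))).
  have -> : 2 * m%:R * Ex (fun x => F x * phi (F x)) =
      \sum_k 2 * Ex (fun x => delta k x * phi (F x)).
    rewrite -mulr_sumr -Ex_sum -mulrA -ExZ; congr (_ * _); apply: eq_Ex => x.
    by rewrite -mulr_suml sum_delta mulrA.
  have -> : Ex (fun x => phi' (F x) * Gamma x) =
      \sum_k Ex (fun x => phi' (F x) * (delta k x ^+ 2 + var k x)).
    by rewrite -Ex_sum; apply: eq_Ex => x; rewrite mulr_sumr.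
  rewrite -sumrB; apply: le_trans (ler_norm_sum _ _ _) _.
  apply: le_trans (ler_sum _ (fun k _ => stein_k k)) _.
  rewrite -mulr_sumr big_split/= -!mulr_sumr sum_infl ler_wpM2l// lerD2l.
  by rewrite ler_wpM2l.
have h2 : `|Ex (fun x => phi' (F x)) -
     (2 * m%:R)^-1 * Ex (fun x => phi' (F x) * Gamma x)| <=
   B * (`|1 - s| + (eta + kappa / eta) / 2).
  have B0 : 0 <= B by apply: le_trans (phi'_le 0).
  rewrite -ExZ -ExB; apply: le_trans (ler_norm_Ex p_ge0 _) _.
  apply: (@le_trans _ _ (Ex (fun x => B * (`|1 - s| + eta / 2 +
     (2 * eta)^-1 * ((2 * m%:R)^-2 * (Gamma x - 2 * m%:R * s) ^+ 2))))).
    apply: (ler_Ex p_ge0) => x.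
    have -> : phi' (F x) - (2 * m%:R)^-1 * (phi' (F x) * Gamma x) =
       phi' (F x) * ((1 - s) - (2 * m%:R)^-1 * (Gamma x - 2 * m%:R * s)).
      by field; rewrite gt_eqF.
    rewrite normrM; apply: ler_pM => //; apply: le_trans (ler_normB _ _) _.
    rewrite -addrA lerD2l.
    have -> : (2 * m%:R)^-2 * (Gamma x - 2 * m%:R * s) ^+ 2 =
        `|(2 * m%:R)^-1 * (Gamma x - 2 * m%:R * s)| ^+ 2.
      by rewrite real_normK ?num_real// [RHS]exprMn exprVn.
    move: `|_| => t.
    have -> : eta / 2 + (2 * eta)^-1 * t ^+ 2 = t + (2 * eta)^-1 * (eta - t) ^+ 2.
      by field; rewrite gt_eqF.
    by rewrite lerDl mulr_ge0 ?sqr_ge0// invr_ge0 mulr_ge0// ltW.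
  rewrite ExZ ler_wpM2l// ExD Ex_cst// !ExZ.
  have : (2 * eta)^-1 * ((2 * m%:R)^-2 * Ex (fun x => (Gamma x - 2 * m%:R * s) ^+ 2)) <=
      kappa / eta / 2.
    rewrite (_ : kappa / eta / 2 = (2 * eta)^-1 * kappa); last first.
      by field; rewrite gt_eqF.
    rewrite ler_wpM2l//; first by rewrite invr_ge0 mulr_ge0// ltW.
    rewrite ler_pdivrMl ?exprn_gt0 ?mulr_gt0// exprMn -natrX.
    exact: Gamma_var.
  lra.
rewrite ExB.
have -> : Ex (fun x => phi' (F x)) - Ex (fun x => F x * phi (F x)) =
  (Ex (fun x => phi' (F x)) - (2 * m%:R)^-1 * Ex (fun x => phi' (F x) * Gamma x)) -
  (2 * m%:R)^-1 * (2 * m%:R * Ex (fun x => F x * phi (F x)) -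
     Ex (fun x => phi' (F x) * Gamma x)).
  by field; rewrite gt_eqF.
apply: le_trans (ler_normB _ _) _; rewrite -addrA; apply: lerD => //.
rewrite normrM gtr0_norm ?invr_gt0 ?mulr_gt0// ler_pdivrMl ?mulr_gt0//.
apply: le_trans h1 _.
rewrite le_eqVlt; apply/orP; left; apply/eqP; ring.
Qed.

Lemma degenerate_stein_bound (eta : R) : 0 < eta ->
  `|Ex (fun x => phi' (F x) - F x * phi (F x))| <=
  B * (`|1 - Ex (fun x => F x ^+ 2)| + (eta +
   (Ex (fun x => F x ^+ 4) - 3 * Ex (fun x => F x ^+ 2) ^+ 2 +
    (4 ^+ m + 1) * (r * (m%:R * Ex (fun x => F x ^+ 2)))) / eta) / 2) +
  2 * eps * Ex (fun x => F x ^+ 2) +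
  4 * C * (2 * (Ex (fun x => F x ^+ 4) - 3 * Ex (fun x => F x ^+ 2) ^+ 2 +
    (4 ^+ m + 1) * (r * (m%:R * Ex (fun x => F x ^+ 2)))) +
    (4 ^+ m + 1) * (r * (m%:R * Ex (fun x => F x ^+ 2)))).
Proof. exact: stein_bound. Qed.

End stein.
End influence_bound.
End degenerate.

Require Import Defs.
From mathcomp Require Import finmap.
From mathcomp Require Import all_classical all_reals all_analysis.
From mathcomp Require Import measurable_realfun.

Import numFieldNormedType.Exports.
Local Open Scope classical_set_scope.
Local Open Scope ring_scope.

(** * The Stein equation *)

Section compact_support.
Context (R : realType) (f : R -> R) (L : R).
Hypothesis fc : continuous f.
Hypothesis f0 : forall x, L < `|x| -> f x = 0.

Lemma compact_support_bounded : exists2 B, 0 <= B & forall x, `|f x| <= B.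
Proof.
have nfc : continuous (fun x => `|f x|).
  by move=> x; apply: (@continuous_comp _ _ _ f Num.norm); [exact: fc|exact: norm_continuous].
have [c _ cmax] : exists2 c, c \in `[(- `|L|), `|L|] &
    forall t, t \in `[(- `|L|), `|L|] -> `|f t| <= `|f c|.
  apply: EVT_max; last exact: continuous_subspaceT.
  by rewrite -subr_ge0 opprK addr_ge0.
exists `|f c| => // x; have [xL|Lx] := leP `|x| `|L|.
  by apply: cmax; rewrite in_itv/= -ler_norml.
by rewrite f0 ?normr0// (le_lt_trans _ Lx)// ler_norm.
Qed.

(** Compactness gives one [d] on an interval that exceeds the support by 1 on each side; with
    [d < 1], a point outside that interval and its neighbour both lie off the support. *)
Lemma compact_support_unif (e : R) : 0 < e ->
  exists2 d, 0 < d & forall x y, `|x - y| < d -> `|f x - f y| < e.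
Proof.
move=> e0; pose K := `[(- `|L| - 1), `|L| + 1]%classic.
have := @segment_compact R (- `|L| - 1) (`|L| + 1) => /compact_near_coveringP.
move=> /(_ R (0^'+) (fun d x => forall y, `|x - y| < d -> `|f x - f y| < e)) H.
have : \forall d \near 0^'+, K `<=` (fun x => forall y, `|x - y| < d -> `|f x - f y| < e).
  apply: H => x _.
  have /cvgrPdist_lt/(_ (e / 2)) := @fc x.
  rewrite divr_gt0// => /(_ isT) [r /= r0 Hr].
  exists (ball x (r / 2), [set d | d < r / 2]).
    split; first exact: nbhsx_ballx (divr_gt0 _ _).
    by apply: nbhs_right_lt; rewrite divr_gt0.
  move=> [x' d] /= [xx' dr] y x'y.
  have xy : `|x - y| < r.
    rewrite (splitr r) -(subrKA x') (le_lt_trans (ler_normD _ _))// ltrD//.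
    exact: lt_trans dr.
  rewrite (splitr e) -(subrKA (f x)) (le_lt_trans (ler_normD _ _))// ltrD//.
    rewrite distrC; apply: Hr => /=; apply: lt_trans xx' _.
    by rewrite ltr_pdivrMr// ltr_pMr// ltr1n.
  exact: Hr.
move=> HK; have [d [d0 d1 dK]] : exists d, [/\ 0 < d, d < 1 &
    K `<=` (fun x => forall y, `|x - y| < d -> `|f x - f y| < e)].
  near (0 : R)^'+ => d; exists d; split; near: d => //.
  - exact: nbhs_right_gt.
  - exact: nbhs_right_lt.
exists d => // x y xy; have [xK|xK] := leP `|x| (`|L| + 1).
  by apply: dK => //; rewrite /K/= in_itv/= -opprD -ler_norml.
have Lx : `|L| < `|x| by rewrite (le_lt_trans _ xK)// lerDl.
have Ly : `|L| < `|y|.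
  have : `|x| <= `|y| + `|x - y| by rewrite -{1}(subrK y x) addrC ler_normD.
  by move: xy d1 xK; lra.
have LL := ler_norm L.
by rewrite (f0 (le_lt_trans LL Lx)) (f0 (le_lt_trans LL Ly)) subrr normr0.
Unshelve. all: by end_near. Qed.

(** Close points are handled by uniform continuity; for distant ones the trivial bound [2 * B] is at
    most [2 * B / d^2 * (x - y)^2]. *)
Lemma compact_support_modulus (e : R) : 0 < e ->
  exists2 C, 0 <= C & forall x y, `|f x - f y| <= e + C * (x - y) ^+ 2.
Proof.
move=> e0; have [B B0 fB] := compact_support_bounded.
have [d d0 fd] := compact_support_unif e0.
have C0 : 0 <= 2 * B / d ^+ 2 by apply: divr_ge0; [exact: mulr_ge0|exact: sqr_ge0].
exists (2 * B / d ^+ 2) => // x y; have [xyd|dxy] := ltP `|x - y| d.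
  by rewrite ltW// (lt_le_trans (fd _ _ xyd))// lerDl; apply: mulr_ge0 => //; exact: sqr_ge0.
have h1 : `|f x - f y| <= 2 * B.
  by rewrite (le_trans (ler_normB _ _))// mulr_natl mulr2n lerD.
have h2 : 2 * B <= 2 * B / d ^+ 2 * (x - y) ^+ 2.
  rewrite -[(x - y) ^+ 2]real_normK ?num_real// -mulrA ler_peMr ?mulr_ge0//.
  rewrite ler_pdivlMl ?exprn_gt0// mulr1 lerXn2r// ?nnegrE//.
  exact: ltW.
by apply: le_trans h1 _; apply: le_trans h2 _; rewrite lerDr ltW.
Qed.

End compact_support.

Section gaussian.
Context (R : realType).
Notation mu := (@lebesgue_measure R).
Notation gamma := (normal_prob 0 1 : probability (measurableTypeR R) R).
Notation pdf := (normal_pdf (0 : R) 1).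

Lemma integral_normal_prob (f : R -> R) : gamma.-integrable setT (EFin \o f) ->
  (\int[gamma]_x (f x)%:E = \int[mu]_x (f x * pdf x)%:E)%E.
Proof.
move=> intf; have mf := measurable_int _ intf.
rewrite -(Radon_Nikodym_change_of_variables (@normal_prob_dominates R 0 1))//=.
apply: ae_eq_integral => //.
- apply: emeasurable_funM => //; apply: (measurable_int mu).
  by apply: Radon_Nikodym_integrable; exact: normal_prob_dominates.
- apply/measurable_EFinP; apply: measurable_funM; last exact: measurable_normal_pdf.
  exact/measurable_EFinP.
- under [X in ae_eq _ _ _ X]eq_fun do rewrite EFinM.
  apply: ae_eqe_mul2l => /=.
  rewrite Radon_NikodymE//=; first exact: normal_prob_dominates.
  move=> dom; case: cid => /= h [h1 h2 h3].
  apply: integral_ae_eq => //=.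
  + by apply/measurable_EFinP; exact: measurable_normal_pdf.
  + by move=> E _ mE; rewrite -h3.
Qed.

Definition cutoff (K x : R) : R := Num.max 0 (Num.min 1 (K + 1 - `|x|)).

Lemma cutoff_ge0 K x : 0 <= cutoff K x.
Proof. by rewrite /cutoff le_max lexx. Qed.

Lemma cutoff_le1 K x : cutoff K x <= 1.
Proof. by rewrite /cutoff ge_max ler01 ge_min lexx. Qed.

Lemma cutoff_eq1 K x : `|x| <= K -> cutoff K x = 1.
Proof.
move=> xK; rewrite /cutoff; apply/eqP; rewrite eq_le cutoff_le1 le_max le_min lexx.
by apply/orP; right; rewrite /=; lra.
Qed.

Lemma cutoff_eq0 K x : K + 1 < `|x| -> cutoff K x = 0.
Proof.
move=> xK; apply/eqP; rewrite eq_le cutoff_ge0 andbT /cutoff ge_max lexx/=.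
by rewrite ge_min; apply/orP; right; lra.
Qed.

Lemma continuous_cutoff K : continuous (cutoff K).
Proof.
move=> x; apply: (@continuous_max _ _ (cst 0) (fun x => Num.min 1 (K + 1 - `|x|))).
  exact: cst_continuous.
apply: (@continuous_min _ _ (cst 1) (fun x => K + 1 - `|x|)).
  exact: cst_continuous.
apply: (@cvgB _ R^o); first exact: cvg_cst.
exact: norm_continuous.
Qed.

(** Chebyshev's inequality before integration. *)
Lemma cutoff_tail K x : 0 < K -> 1 - cutoff K x <= (x / K) ^+ 2.
Proof.
move=> K0; have [xK|xK] := leP `|x| K.
  by rewrite cutoff_eq1// subrr sqr_ge0.
apply: (@le_trans _ _ 1); first by rewrite gerBl cutoff_ge0.
rewrite -[leRHS]real_normK ?num_real// exprn_ege1// normrM normfV (gtr0_norm K0).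
by rewrite ler_pdivlMr// mul1r ltW.
Qed.

(** Continuity from below of the measure along the intervals [[-n, n]] suffices. *)
Lemma normal_tail (e : R) : 0 < e ->
  exists2 K0, 0 < K0 & forall K, K0 <= K ->
   (\int[gamma]_x (1 - cutoff K x)%:E <= e%:E)%E.
Proof.
move=> e0; pose A n := [set x : R | `|x| <= n%:R].
have mA n : measurable (A n : set (measurableTypeR R)).
  rewrite (_ : A n = `[(- n%:R : R), n%:R]%classic); first exact: measurable_itv.
  by apply/seteqP; split => x; rewrite /A/= in_itv/= -ler_norml.
have AT : \bigcup_n A n = setT.
  rewrite -subTset => x _; exists (Num.Def.truncn `|x|).+1 => //.
  by rewrite /A/= ltW//; exact: truncnS_gt.
have ndA : nondecreasing_seq A.
  move=> n m nm; apply/subsetPset => x; rewrite /A/=.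
  by move=> /le_trans; apply; rewrite ler_nat.
have := @nondecreasing_cvg_mu _ _ _ gamma A mA; rewrite AT.
move=> /(_ measurableT ndA) Acvg.
have : gamma (A n) @[n --> \oo] --> 1%E.
  by rewrite -(probability_setT gamma); exact: Acvg.
move=> /fine_cvgP[_] /cvgrPdist_le/(_ _ e0)[N _ /(_ _ (leqnn N))/= AN].
exists N.+1%:R => // K NK.
have mC : measurable (~` A N : set (measurableTypeR R)) by exact: measurableC.
apply: (@le_trans _ _ (\int[gamma]_x (\1_(~` A N) x)%:E)%E).
  apply: ge0_le_integral => //.
  - by move=> x _; rewrite lee_fin subr_ge0 cutoff_le1.
  - apply/measurable_EFinP; apply: measurable_funB => //.
    by apply: continuous_measurable_fun; exact: continuous_cutoff.
  - exact/measurable_EFinP/measurable_indic.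
  - move=> x _; rewrite lee_fin indicE; case: (boolP (x \in ~` A N)) => xA.
      by rewrite gerBl cutoff_ge0.
    rewrite cutoff_eq1 ?subrr//; move: xA; rewrite notin_setE /= => /contrapT.
    rewrite /A/= => /le_trans; apply.
    by rewrite (le_trans _ NK)// ler_nat.
rewrite integral_indic// setIT.
apply: (@le_trans _ _ (1 - gamma (A N))%E).
  by rewrite -(probability_setC gamma (mA N)).
have : gamma (A N) \is a fin_num by exact: fin_num_measure.
move=> /fineK <-; rewrite -EFinB lee_fin.
exact: le_trans (ler_norm _) AN.
Qed.

Variables (psi : R -> R) (L : R).
Hypothesis psi_cont : continuous psi.
Hypothesis psi0 : forall x, L < `|x| -> psi x = 0.
Hypothesis psi_mean : (\int[gamma]_x (psi x)%:E = 0)%E.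

Let psi_meas : measurable_fun setT psi.
Proof. exact: continuous_measurable_fun. Qed.

Let k x := psi x * pdf x.

Let pdfE x : pdf x = normal_peak 1 * expR (- (x ^+ 2 / 2)).
Proof.
rewrite normal_pdfE ?oner_neq0// /normal_fun subr0 expr1n; congr (_ * expR _).
by rewrite mulNr.
Qed.

Let k_int : mu.-integrable setT (EFin \o k).
Proof.
have [B B0 psiB] := compact_support_bounded psi_cont psi0.
apply: (@le_integrable _ _ _ mu _ measurableT _ (fun x => (B * pdf x)%:E)).
- apply/measurable_EFinP; apply: measurable_funM => //.
  exact: measurable_normal_pdf.
- move=> x _; rewrite /= lee_fin !normrM ler_wpM2r//.
  by rewrite (ger0_norm B0).
- under eq_fun do rewrite EFinM.
  apply: integrableZl => //; exact: integrable_normal_pdf.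
Qed.

(* Vanishes on both sides of the support of [psi], since [psi] has mean 0. *)
Let Phi x := \int[mu]_(t in `]-oo, x]) k t.

Let kc : continuous k.
Proof.
move=> x; apply: cvgM; first exact: psi_cont.
by apply: continuous_normal_pdf; exact: oner_neq0.
Qed.

Let Phi_derive (x : R) : is_derive x 1 Phi (k x).
Proof.
have := @continuous_FTC1 R k -oo%O x (x + 1).
rewrite ltrDl ltr01 => /(_ isT) [].
- by apply: integrableS k_int.
- by rewrite /Order.lt/=.
- exact: kc.
move=> dPhi; rewrite derive1E => Phi'; exact: (DeriveDef dPhi Phi').
Qed.

Let Phi0 x : L < `|x| -> Phi x = 0.
Proof.
move=> Lx; have [x0|x0] := ltP x 0.
  transitivity (\int[mu]_(t in `]-oo, x]) (0 : R)); last first.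
    by rewrite Rintegral_cst// mul0r.
  apply: eq_Rintegral => t; rewrite inE/= in_itv/= => tx.
  rewrite /k psi0 ?mul0r// (lt_le_trans Lx)// !ltr0_norm ?lerN2//.
  exact: le_lt_trans x0.
transitivity (\int[mu]_t k t); last first.
  rewrite /Rintegral -integral_normal_prob ?psi_mean//.
  have [B B0 psiB] := compact_support_bounded psi_cont psi0.
  apply: (@le_integrable _ _ _ gamma _ measurableT _ (fun x => B%:E)).
  - exact/measurable_EFinP.
  - by move=> y _; rewrite /= lee_fin (ger0_norm B0).
  - apply/integrableP; split => //.
    rewrite integral_cst//= probability_setT mule1; exact: ltry.
rewrite /Phi Rintegral_mkcond; apply: eq_Rintegral => t _.
rewrite patchE; case: ifPn => //; rewrite notin_setE/= in_itv/= => /negP.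
rewrite -ltNge => xt; rewrite /k psi0 ?mul0r// (lt_le_trans Lx)//.
by rewrite !ger0_norm// ltW// (le_lt_trans x0).
Qed.

Let c0 : 0 < normal_peak (1 : R).
Proof. by rewrite normal_peak_gt0// oner_neq0. Qed.

(** The reciprocal of the Gaussian density. It solves [y' = x y] and is thus the integrating factor
    of the Stein equation: [Phi * ipdf] is a solution. *)
Let ipdf x := (normal_peak 1)^-1 * expR (x ^+ 2 / 2) : R.

Let ipdf_derive (x : R) : is_derive x 1 ipdf (x * ipdf x).
Proof.
have d1 : is_derive x 1 (fun t : R => t ^+ 2 / 2) x.
  have := is_deriveZ 2^-1 (DeriveDef (@exprn_derivable R 2 x 1) (@exp_derive R 2 x 1)).
  have -> : 2^-1 *: (2%:R *: x ^+ 2.-1 *: 1) = x.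
    by rewrite /GRing.scale/= mulr1 mulrA mulVf ?mul1r// pnatr_eq0.
  have -> // : 2^-1 \*: (@GRing.exp R ^~ 2) = (fun t : R => t ^+ 2 / 2).
  by apply/funext => t; rewrite /= mulrC.
have d2 := @is_derive1_comp R expR (fun t : R => t ^+ 2 / 2) x _ _
  (is_derive_expR _) d1.
have -> : x * ipdf x = (normal_peak 1)^-1 *: (expR (x ^+ 2 / 2) * x).
  by rewrite /ipdf mulrCA (mulrC x).
exact: is_deriveZ.
Qed.

Lemma stein_solution : exists phi phi' : R -> R,
  [/\ forall x : R, is_derive x 1 phi (phi' x), continuous phi',
      forall x, L < `|x| -> phi' x = 0 &
      forall x, phi' x - x * phi x = psi x].
Proof.
pose phi x := Phi x * ipdf x.
have dphi (x : R) : is_derive x 1 phi (psi x + x * phi x).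
  have -> : psi x + x * phi x = Phi x *: (x * ipdf x) + ipdf x *: k x.
    rewrite /k pdfE /ipdf/= expRN.
    have := expR_gt0 (x ^+ 2 / 2); have := c0; rewrite /phi /ipdf.
    move: (expR _) (normal_peak 1) => E c c_gt0 E_gt0.
    change (psi x + x * (Phi x * (c^-1 * E)) = Phi x * (x * (c^-1 * E)) +
      c^-1 * E * (psi x * (c * E^-1))).
    by field; rewrite !gt_eqF.
  exact: is_deriveM.
(* The derivative is read off the equation, which makes its continuity and its support evident. *)
exists phi, (fun x => psi x + x * phi x); split => //.
- move=> x; apply: cvgD; first exact: psi_cont.
  apply: cvgM; first exact: cvg_id.
  by apply/differentiable_continuous/derivable1_diffP; have [] := dphi x.
- by move=> x Lx; rewrite psi0// /phi Phi0// !mul0r mulr0 addr0.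
- by move=> x; rewrite addrK.
Qed.

Lemma stein_test_function : exists (phi phi' : R -> R) (B : R),
  [/\ 0 <= B, forall x, `|phi' x| <= B,
      forall x, phi' x - x * phi x = psi x &
      forall e, 0 < e -> exists C, [/\ 0 <= C,
        forall t t', `|phi t - phi t' - phi' t' * (t - t')| <=
                     `|t - t'| * (e + C * (t - t') ^+ 2) &
        forall t t', `|phi' t - phi' t'| <= e + C * (t - t') ^+ 2]].
Proof.
have [phi [phi' [dphi phi'c phi'0 phiE]]] := stein_solution.
have [B B0 phi'B] := compact_support_bounded phi'c phi'0.
exists phi, phi', B; split => // e e0.
have [C C0 phi'C] := compact_support_modulus phi'c phi'0 e0.
exists C; split => // t t'.
have mvt a b : a <= b -> exists2 c, a <= c <= b & phi b - phi a = phi' c * (b - a).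
  move=> ab; have [|c] := @MVT_segment R phi phi' a b ab (fun x _ => dphi x).
    apply: continuous_subspaceT => x.
    by apply/differentiable_continuous/derivable1_diffP; have [] := dphi x.
  by rewrite in_itv/=; exists c.
(* By the mean value theorem the Taylor remainder is an increment of [phi'] between [t'] and a point
   [c] no farther from [t'] than [t] is. *)
have [c ct ->] : exists2 c, (c - t') ^+ 2 <= (t - t') ^+ 2 &
    phi t - phi t' = phi' c * (t - t').
  have [tt'|/ltW tt'] := leP t t'.
    have [c /andP[tc ct'] E] := mvt _ _ tt'; exists c.
      rewrite -sqrrN opprB -[leRHS]sqrrN opprB lerXn2r ?nnegrE ?subr_ge0//.
      by rewrite lerD2l lerN2.
    by rewrite -opprB E -mulrN opprB.
  by have [c /andP[tc ct'] E] := mvt _ _ tt'; exists c => //;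
    rewrite lerXn2r ?nnegrE ?subr_ge0// lerD2r.
rewrite -mulrBl normrM mulrC ler_wpM2l//.
by apply: le_trans (phi'C _ _) _; rewrite lerD2l ler_wpM2l.
Qed.

End gaussian.

(** [delta] is chosen before the space, the weights and [F]; this uniformity lets the bound pass to
    arbitrary spaces, where the discretisation depends on the accuracy wanted. *)
Lemma degenerate_almost_normal (R : realType) (m : nat) (psi : R -> R) (L : R) :
  (0 < m)%N -> continuous psi -> (forall x, L < `|x| -> psi x = 0) ->
  (\int[(normal_prob 0 1 : probability (measurableTypeR R) R)]_x (psi x)%:E = 0)%E ->
  forall e : R, 0 < e -> exists2 delta : R, 0 < delta &
  forall (I S : finType) (p : I -> S -> R) (F : {ffun I -> S} -> R),
  (forall i s, 0 <= p i s) -> (forall i, \sum_s p i s = 1) ->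
  (forall M : {set I}, #|M| != m -> forall x, hproj p M F x = 0) ->
  (forall k, Ex p (fun x => (F x - ce p [set k] F x) ^+ 2) <= delta) ->
  1 - delta <= Ex p (fun x => F x ^+ 2) <= 1 ->
  Ex p (fun x => F x ^+ 4) <= 3 + delta ->
  `|Ex p (fun x => psi (F x))| <= e.
Proof.
move=> m0 psic psi0 psiE e e0.
have [phi [phi' [B [B0 phi'B phiE phiC]]]] := stein_test_function psic psi0 psiE.
have [|C [C0 phi_taylor phi'C]] := phiC (e / 8); first by rewrite divr_gt0.
pose c : R := (4 ^+ m + 1) * m%:R.
have c0 : 0 <= c by rewrite mulr_ge0// addr_ge0// exprn_ge0.
(* From [q <= 3 + delta] and [s >= 1 - delta] one gets [q - 3 s^2 <= 7 delta], and [c * delta]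
   bounds the influence term; together the cumulant term is at most [D * delta]. *)
pose D := 7 + c.
pose eta := e / (4 * (B + 1)).
have eta0 : 0 < eta by rewrite divr_gt0// mulr_gt0// ltr_wpDl.
have Beta : B * eta <= e / 4.
  rewrite /eta mulrA ler_pdivrMr ?mulr_gt0 ?ltr_wpDl//.
  have -> : e / 4 * (4 * (B + 1)) = e * (B + 1) by field.
  nra.
(* Coefficients of [delta] in the bound: [B] from [|1 - s|], the next from the cumulant divided by
   [eta], then the fourth moments; the final 1 makes [Q] positive. The terms in [eta] and [e / 8]
   cost at most [e / 8] and [e / 4], and [e / 2] is reserved for these. *)
pose Q := B + B * (D / (2 * eta)) + 12 * C * D + 1.
have Q0 : 0 < Q.
  have D0 : 0 <= D by rewrite addr_ge0.
  have E0 : 0 <= D / (2 * eta) by rewrite divr_ge0// mulr_ge0// ltW.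
  rewrite /Q; apply: ltr_wpDl => //; apply: addr_ge0; last by do 2 apply: mulr_ge0 => //.
  by apply: addr_ge0 => //; exact: mulr_ge0.
exists (Num.min 1 (e / (2 * Q))).
  by rewrite lt_min ltr01 divr_gt0// mulr_gt0.
set delta := Num.min _ _.
have delta0 : 0 < delta by rewrite lt_min ltr01 divr_gt0// mulr_gt0.
have delta1 : delta <= 1 by rewrite ge_min lexx.
have deltaQ : Q * delta <= e / 2.
  apply: (@le_trans _ _ (Q * (e / (2 * Q)))).
    by apply: ler_wpM2l; [exact: ltW|rewrite ge_min lexx orbT].
  rewrite le_eqVlt; apply/orP; left; apply/eqP; field.
  by rewrite gt_eqF.
move=> I S p F p0 p1 Fdeg Finf Fs Fq.
have := degenerate_stein_bound p0 p1 m0 Fdeg Finf C0 phi_taylor phi'C phi'B eta0.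
have e8 : 0 <= e / 8 by rewrite divr_ge0// ltW.
rewrite (eq_Ex p (fun x => phiE (F x))).
move: Fs Fq; move: (Ex p (fun x => F x ^+ 2)) (Ex p (fun x => F x ^+ 4)) => s q.
move=> /andP[s1 s2] q3 H; apply: le_trans H _.
have s0 : 0 <= s by lra.
have cs : (4 ^+ m + 1) * (delta * (m%:R * s)) <= c * delta.
  have -> : (4 ^+ m + 1) * (delta * (m%:R * s)) = c * delta * s by rewrite /c; ring.
  by rewrite ler_piMr// mulr_ge0// ltW.
set k := q - _ + _; set z := _ * (delta * _) in k cs *.
have kD : k <= D * delta.
  by rewrite /k /D; nra.
have -> : `|1 - s| = 1 - s by rewrite ger0_norm// subr_ge0.
have h1 : B * (k / eta / 2) <= B * (D / (2 * eta)) * delta.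
  rewrite -[leRHS]mulrA ler_wpM2l//.
  rewrite (_ : k / eta / 2 = (2 * eta)^-1 * k); last by field; rewrite gt_eqF.
  rewrite (_ : D / (2 * eta) * delta = (2 * eta)^-1 * (D * delta)); last by ring.
  by rewrite ler_wpM2l// invr_ge0 mulr_ge0// ltW.
have h2 : C * (2 * k + z) <= C * (3 * D * delta).
  by rewrite ler_wpM2l//; move: kD cs; rewrite /D; nra.
have h3 : B * (1 - s) <= B * delta by rewrite ler_wpM2l//; lra.
have h4 : e / 8 * s <= e / 8 by rewrite ler_piMr.
have {}deltaQ : B * delta + B * (D / (2 * eta)) * delta + 12 * C * D * delta + delta <= e / 2.
  apply: le_trans deltaQ; rewrite le_eqVlt; apply/orP; left; apply/eqP.
  rewrite /Q; ring.
apply: (@le_trans _ _ (B * (1 - s) + B * eta / 2 + B * (k / eta / 2) +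
    2 * (e / 8 * s) + 4 * (C * (2 * k + z)))).
  rewrite le_eqVlt; apply/orP; left; apply/eqP; ring.
have {}h2 : 4 * (C * (2 * k + z)) <= 12 * C * D * delta.
  apply: (@le_trans _ _ (4 * (C * (3 * D * delta)))); first by rewrite ler_wpM2l.
  rewrite le_eqVlt; apply/orP; left; apply/eqP; ring.
move: h1 h2 h3 h4 deltaQ Beta delta0 e0; clear.
move: (B * (1 - s)) (B * (k / eta / 2)) (4 * (C * _)) (B * (D / (2 * eta)) * delta).
move: (12 * C * D * delta) (e / 8 * s) (B * delta) (B * eta) => *; lra.
Qed.

(** * Discretisation of random variables *)

(** Phrased by fibres, so that [S] carries no sigma-field and the same map can be tested against
    different sigma-fields on its domain. *)
Definition fin_measurable d (T : measurableType d) (S : finType) (xi : T -> S) :=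
  forall s, measurable (xi @^-1` [set s]).

Section finite_valued.
Context d (T : measurableType d) (R : realType).

Lemma fin_measurable_preimage (S : finType) (xi : T -> S) (A : set S) :
  fin_measurable xi -> measurable (xi @^-1` A).
Proof.
move=> mxi; have -> : xi @^-1` A = \big[setU/set0]_(s : S | s \in A) (xi @^-1` [set s]).
  apply/seteqP; split => w /=.
    by move=> Aw; rewrite -bigcup_seq_cond; exists (xi w) => //=;
      rewrite mem_index_enum; apply/mem_set.
  by rewrite -bigcup_seq_cond => -[s /= /andP[_ sA] ->]; exact/set_mem.
exact: bigsetU_measurable.
Qed.

Lemma fin_measurable_fun (S : finType) (xi : T -> S) (u : S -> R) :
  fin_measurable xi -> measurable_fun setT (u \o xi).
Proof.
by move=> mxi _ B mB; rewrite setTI comp_preimage; exact: fin_measurable_preimage.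
Qed.

Lemma fin_measurable_pair (S S' : finType) (xi : T -> S) (xi' : T -> S') :
  fin_measurable xi -> fin_measurable xi' ->
  fin_measurable (fun w => (xi w, xi' w)).
Proof.
move=> m1 m2 [s s'].
rewrite (_ : _ @^-1` _ = (xi @^-1` [set s]) `&` (xi' @^-1` [set s'])).
  exact: measurableI.
by apply/seteqP; split => w /= [-> ->].
Qed.

Lemma fin_measurable_ffun (I S : finType) (xi : I -> T -> S) :
  (forall i, fin_measurable (xi i)) -> fin_measurable (fun w => [ffun i => xi i w]).
Proof.
move=> mxi x.
rewrite (_ : _ @^-1` _ = \big[setI/setT]_(i : I) (xi i @^-1` [set x i])).
  by apply: bigsetI_measurable => i _; exact: mxi.
rewrite -bigcap_seq; apply/seteqP; split => w /=.
  by move=> /ffunP H i _ /=; rewrite -H ffunE.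
move=> H; apply/ffunP => i; rewrite ffunE; apply: H.
exact: mem_index_enum.
Qed.

Lemma fin_discretize (Y : T -> R) (K n : nat) : (0 < n)%N ->
  measurable_fun setT Y ->
  exists m (c : 'I_m -> R) (xi : T -> 'I_m), [/\ fin_measurable xi,
    forall w, `|Y w| < K%:R -> `|Y w - c (xi w)| <= n%:R^-1 &
    forall w, K%:R <= `|Y w| -> c (xi w) = 0].
Proof.
move=> n0 mY; have n0R : 0 < n%:R :> R by rewrite ltr0n.
pose t w := (Y w + K%:R) * n%:R.
have mt : measurable_fun setT t.
  by apply: measurable_funM => //; exact: measurable_funD.
(* Cell 0 collects the points with [|Y| >= K] and gets the value 0; the cells of the grid of mesh
   [1 / n] are therefore shifted by one. *)
pose j w := if `|Y w| < K%:R then (Num.truncn (t w)).+1 else 0%N.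
have tge0 w : `|Y w| < K%:R -> 0 <= t w.
  by rewrite ltr_norml => /andP[H _]; rewrite mulr_ge0// ?ltW//; lra.
have jm w : (j w < (2 * K * n).+2)%N.
  rewrite /j; case: ifPn => // YK; rewrite ltnS ltnS -(@ler_nat R).
  have /andP[H _] := truncn_itv (tge0 _ YK).
  apply: le_trans H _; rewrite /t !natrM ler_pM2r//.
  by move: YK; rewrite ltr_norml => /andP[_]; lra.
exists (2 * K * n).+2, (fun i => if i == ord0 then 0 else i.-1%:R / n%:R - K%:R),
  (fun w => inord (j w)); split.
- move=> i.
  have -> : (fun w => inord (j w)) @^-1` [set i] =
      [set w | j w = i].
    apply/seteqP; split => w /= => [<-|ji]; first by rewrite inordK.
    by apply/val_inj; rewrite /= inordK.
  case: (posnP i) => [->|i0].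
    rewrite (_ : mkset _ = (fun w => `|Y w|) @^-1` `[K%:R, +oo[%classic).
      rewrite -[X in measurable X]setTI; apply: measurableT_comp => //.
    by apply/seteqP; split => w /=; rewrite in_itv/= andbT leNgt /j; case: ifP.
  rewrite (_ : mkset _ = ((fun w => `|Y w|) @^-1` `]-oo, K%:R[%classic) `&`
      (t @^-1` `[i.-1%:R, i%:R[%classic)).
    apply: measurableI; last by rewrite -[X in measurable X]setTI; exact: mt.
    by rewrite -[X in measurable X]setTI; apply: measurableT_comp.
  apply/seteqP; split => w /=.
    rewrite /j !in_itv/=; case: ifPn => [YK /esym iE|_ iE]; last by rewrite -iE in i0.
    split => //; have := truncn_itv (tge0 _ YK).
    by rewrite iE.
  rewrite /j !in_itv/= => -[YK H]; rewrite YK.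
  have : Num.truncn (t w) == i.-1 by rewrite truncn_eq ?tge0// prednK.
  by move=> /eqP ->; rewrite prednK.
- move=> w YK; have := jm w; rewrite /j YK => jw.
  have -> : (inord (Num.truncn (t w)).+1 == ord0 :> 'I_(2 * K * n).+2) = false.
    by apply/negbTE; rewrite -val_eqE /= inordK.
  rewrite inordK//=.
  have /andP[H1 H2] := truncn_itv (tge0 _ YK).
  have -> : Y w = t w / n%:R - K%:R by rewrite /t mulfK ?gt_eqF// addrK.
  rewrite (_ : _ - _ = (t w - (Num.truncn (t w))%:R) / n%:R); last by ring.
  rewrite normrM [X in _ * X]gtr0_norm ?invr_gt0// ler_piMl ?invr_ge0 ?ltW//.
  by rewrite ger0_norm ?subr_ge0// ltrBlDl natr1.
- move=> w KY; have -> : j w = 0%N by rewrite /j ltNge KY.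
  have -> : (inord 0 == ord0 :> 'I_(2 * K * n).+2) by rewrite -val_eqE /= inordK.
  by [].
Qed.

End finite_valued.

(** * Real-valued expectation and square-integrable functions *)

Section square_integrable.
Context d (T : measurableType d) (R : realType) (P : probability T R).
Implicit Types f g : T -> R.

Notation integ f := (P.-integrable [set: T] (EFin \o f)).

Lemma integD f g : integ f -> integ g -> integ (fun w => f w + g w).
Proof. by move=> mf mg; exact: (integrableD measurableT mf mg). Qed.

Lemma integB f g : integ f -> integ g -> integ (fun w => f w - g w).
Proof. by move=> mf mg; exact: (integrableB measurableT mf mg). Qed.

Lemma integZ c f : integ f -> integ (fun w => c * f w).
Proof. by move=> mf; exact: (integrableZl measurableT c mf). Qed.

Lemma integ_sum (I : finType) (Q : pred I) (f : I -> T -> R) :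
  (forall i, Q i -> integ (f i)) -> integ (fun w => \sum_(i | Q i) f i w).
Proof.
move=> fi; under [X in _.-integrable _ X]eq_fun do rewrite /= -sumEFin.
exact: integrable_sum.
Qed.

Lemma integ_cst c : integ (fun=> c).
Proof.
apply: (@measurable_bounded_integrable _ T _ P (cst c)) => //.
- by change (P [set: T] < +oo)%E; rewrite probability_setT ltry.
- exists `|c|; split => // M cM w _ /=; exact: ltW.
Qed.

Lemma integ_meas f : integ f -> measurable_fun setT f.
Proof. by move=> /measurable_int/measurable_EFinP. Qed.

Lemma integ_le f g : measurable_fun setT f -> (forall w, `|f w| <= g w) ->
  integ g -> integ f.
Proof.
move=> mf fg; apply: le_integrable => //; first exact/measurable_EFinP.
by move=> w _; rewrite /= lee_fin (le_trans (fg w))// ler_norm.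
Qed.

Lemma integ_abs f : integ f -> integ (fun w => `|f w|).
Proof.
by move=> fi; exact: (integrable_abse fi).
Qed.

Lemma integ_mulbd f g C : integ f -> measurable_fun setT g ->
  (forall w, `|g w| <= C) -> integ (fun w => f w * g w).
Proof.
move=> fi mg gC; apply: (@integ_le _ (fun w => C * `|f w|)).
- by apply: measurable_funM => //; exact: integ_meas.
- by move=> w; rewrite normrM mulrC ler_wpM2r.
- exact/integZ/integ_abs.
Qed.

Definition sq_int f := measurable_fun setT f /\ integ (fun w => f w ^+ 2).

Lemma sq_intM f g : sq_int f -> sq_int g -> integ (fun w => f w * g w).
Proof.
move=> [mf fi] [mg gi]; apply: (@integ_le _ (fun w => f w ^+ 2 + g w ^+ 2)).
- exact: measurable_funM.
- move=> w; rewrite normrM -(real_normK (num_real (f w))).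
  rewrite -(real_normK (num_real (g w))).
  by have := sqr_ge0 (`|f w| - `|g w|); have := normr_ge0 (f w);
   have := normr_ge0 (g w); nra.
- exact: integD.
Qed.

Lemma sq_intZ c f : sq_int f -> sq_int (fun w => c * f w).
Proof.
move=> [mf fi]; split; first exact: measurable_funM.
by under eq_fun do rewrite exprMn; exact: integZ.
Qed.

Lemma sq_intD f g : sq_int f -> sq_int g -> sq_int (fun w => f w + g w).
Proof.
move=> Hf Hg; have := sq_intM Hf Hg; case: Hf => mf fi; case: Hg => mg gi fgi.
split; first exact: measurable_funD.
under eq_fun do rewrite sqrrD.
apply: integD => //; apply: integD => //.
by under eq_fun do rewrite -mulr_natl; exact: integZ.
Qed.

Lemma sq_intB f g : sq_int f -> sq_int g -> sq_int (fun w => f w - g w).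
Proof.
move=> Hf Hg; have := sq_intD Hf (sq_intZ (-1) Hg).
by under eq_fun do rewrite mulN1r.
Qed.

Lemma sq_int_bd f C : measurable_fun setT f -> (forall w, `|f w| <= C) ->
  sq_int f.
Proof.
move=> mf fC; split => //; apply: (@integ_le _ (fun=> C ^+ 2)).
- exact: measurable_funX.
- move=> w; rewrite normrX lerXn2r ?nnegrE//.
  by apply: le_trans (fC w).
- exact: integ_cst.
Qed.

Lemma sq_int_integ f : sq_int f -> integ f.
Proof.
move=> Hf; have H1 : sq_int (fun=> 1) by apply: (@sq_int_bd _ 1) => // w; rewrite normr1.
by have := sq_intM Hf H1; under eq_fun do rewrite mulr1.
Qed.

(** Real-valued, so that linear arithmetic applies; [EFin_Es] returns to the extended integral under
    integrability. *)
Definition Es f : R := \int[P]_w f w.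

Lemma EsD f g : integ f -> integ g -> Es (fun w => f w + g w) = Es f + Es g.
Proof. by move=> ? ?; exact: RintegralD. Qed.

Lemma EsB f g : integ f -> integ g -> Es (fun w => f w - g w) = Es f - Es g.
Proof. by move=> ? ?; exact: RintegralB. Qed.

Lemma EsZ c f : integ f -> Es (fun w => c * f w) = c * Es f.
Proof. by move=> ?; exact: RintegralZl. Qed.

Lemma Es_cst c : Es (fun=> c) = c.
Proof.
transitivity (c * fine (P [set: T])); first exact: Rintegral_cst.
by rewrite probability_setT mulr1.
Qed.

Lemma eq_Es f g : f =1 g -> Es f = Es g.
Proof. by move=> fg; apply: eq_Rintegral => w _; exact: fg. Qed.

Lemma Es_le f g : integ f -> integ g -> (forall w, f w <= g w) -> Es f <= Es g.
Proof. by move=> fi gi fg; exact: le_Rintegral. Qed.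

Lemma Es_ge0 f : (forall w, 0 <= f w) -> 0 <= Es f.
Proof. by move=> f0; exact: Rintegral_ge0. Qed.

Lemma Es_abs f : integ f -> `|Es f| <= Es (fun w => `|f w|).
Proof. by move=> fi; exact: le_normr_Rintegral. Qed.

Lemma EFin_Es f : integ f -> ((Es f)%:E = \int[P]_w (f w)%:E)%E.
Proof.
by move=> fi; rewrite /Es /Rintegral fineK//; exact: integrable_fin_num.
Qed.

Lemma Es_sum (I : finType) (Q : pred I) (f : I -> T -> R) :
  (forall i, integ (f i)) ->
  Es (fun w => \sum_(i | Q i) f i w) = \sum_(i | Q i) Es (f i).
Proof.
move=> fi; apply: EFin_inj; rewrite EFin_Es; last exact: integ_sum.
under eq_integral do rewrite -sumEFin.
rewrite integral_sum// -sumEFin; apply: eq_bigr => i _; exact/esym/EFin_Es.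
Qed.

Lemma Es_indic A : measurable A -> Es \1_A = fine (P A).
Proof. by move=> mA; rewrite /Es /Rintegral integral_indic// setIT. Qed.

Lemma integ_fin (S : finType) (xi : T -> S) (u : S -> R) :
  fin_measurable xi -> integ (u \o xi).
Proof.
move=> mxi; apply: (@integ_le _ (fun=> \sum_s `|u s|)).
- exact: fin_measurable_fun.
- by move=> w /=; rewrite (bigD1 (xi w))//= lerDl sumr_ge0.
- exact: integ_cst.
Qed.

Lemma integ_mulfin f (S : finType) (xi : T -> S) (u : S -> R) :
  integ f -> fin_measurable xi -> integ (fun w => f w * u (xi w)).
Proof.
move=> fi mxi; apply: (@integ_mulbd _ (u \o xi) (\sum_s `|u s|)) => //.
- exact: fin_measurable_fun.
- by move=> w /=; rewrite (bigD1 (xi w))//= lerDl sumr_ge0.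
Qed.

Lemma sq_int_fin (S : finType) (xi : T -> S) (u : S -> R) :
  fin_measurable xi -> sq_int (u \o xi).
Proof.
move=> mxi; apply: (@sq_int_bd _ (\sum_s `|u s|)).
- exact: fin_measurable_fun.
- by move=> w /=; rewrite (bigD1 (xi w))//= lerDl sumr_ge0.
Qed.

Lemma Es_mulfin f (S : finType) (xi : T -> S) (u : S -> R) :
  integ f -> fin_measurable xi ->
  Es (fun w => f w * u (xi w)) =
  \sum_s u s * Es (fun w => f w * \1_(xi @^-1` [set s]) w).
Proof.
move=> fi mxi.
have mulI s : integ (fun w => f w * \1_(xi @^-1` [set s]) w).
  apply: (@integ_mulbd _ _ 1) => // w.
  by rewrite indicE ger0_norm// lern1 leq_b1.
rewrite (@eq_Es _ (fun w => \sum_s u s * (f w * \1_(xi @^-1` [set s]) w))).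
  rewrite Es_sum; last by move=> s; exact: integZ.
  by apply: eq_bigr => s _; rewrite EsZ.
move=> w; rewrite (bigD1 (xi w))//= indicE mem_set// mulr1 mulrC.
rewrite big1 ?addr0// => s sw; rewrite indicE memNset ?mulr0//=.
by move=> H; rewrite -H eqxx in sw.
Qed.

Lemma Es_fin (S : finType) (xi : T -> S) (u : S -> R) :
  fin_measurable xi ->
  Es (fun w => u (xi w)) = \sum_s u s * fine (P (xi @^-1` [set s])).
Proof.
move=> mxi; have := @Es_mulfin (fun=> 1) _ _ u (integ_cst 1) mxi.
under eq_Es do rewrite mul1r.
move=> ->; apply: eq_bigr => s _; rewrite -Es_indic//; congr (_ * _).
by apply: eq_Es => w; rewrite mul1r.
Qed.

(** Monotone convergence along the sets [|Y| < K], which exhaust the space because [Y] is finite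
    everywhere. *)
Lemma Es_tail f (Y : T -> R) (e : R) : integ f -> (forall w, 0 <= f w) ->
  measurable_fun setT Y -> 0 < e ->
  exists K : nat, Es (fun w => f w * \1_[set w | K%:R <= `|Y w|] w) <= e.
Proof.
move=> fi f0 mY e0.
pose A K := [set w | `|Y w| < K%:R].
have mA K : measurable (A K).
  rewrite (_ : A K = (fun w => `|Y w|) @^-1` `]-oo, K%:R[%classic); last first.
    by apply/seteqP; split => w; rewrite /A/= in_itv.
  by rewrite -[X in measurable X]setTI; apply: measurableT_comp.
have ndA : {homo A : n m / (n <= m)%N >-> (n <= m)%O}.
  move=> n m nm; apply/subsetPset => w; rewrite /A/= => /lt_le_trans; apply.
  by rewrite ler_nat.
have AT : \bigcup_K A K = setT.
  rewrite -subTset => w _; exists (Num.truncn `|Y w|).+1 => //.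
  exact: truncnS_gt.
have := @ge0_nondecreasing_set_cvg_integral _ _ _ A (EFin \o f) P ndA mA.
have mf K : measurable_fun (A K) (EFin \o f).
  by apply: measurable_funTS; exact: measurable_int fi.
move=> /(_ mf) /(_ (fun i w _ => f0 w)); rewrite AT -EFin_Es//.
have EA K : (\int[P]_(w in A K) (EFin \o f) w = (Es (fun w => f w * \1_(A K) w))%:E)%E.
  rewrite EFin_Es; last first.
    apply: (@integ_mulbd _ _ 1) => //.
    by move=> w; rewrite indicE ger0_norm// lern1 leq_b1.
  rewrite integral_mkcond; apply: eq_integral => w _; rewrite patchE indicE.
  by case: ifP => wA; rewrite /= ?mulr1 ?mulr0.
under eq_cvg do rewrite EA.
move=> /fine_cvgP[_] /cvgrPdist_le/(_ _ e0)[N _ /(_ _ (leqnn N))/= H].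
exists N; apply: le_trans H; apply: le_trans (ler_norm _).
rewrite -EsB//; last first.
  apply: (@integ_mulbd _ _ 1) => //.
  by move=> w; rewrite indicE ger0_norm// lern1 leq_b1.
rewrite le_eqVlt; apply/orP; left; apply/eqP; apply: eq_Es => w.
rewrite (_ : [set w | N%:R <= `|Y w|] = ~` A N).
  rewrite !indicE in_setC; case: (w \in A N) => /=; ring.
by apply/seteqP; split => v; rewrite /A/= leNgt => /negP.
Qed.

End square_integrable.

(** * Conditional expectation given a sub-sigma-field *)

Section sub_sigma_algebra.
Context d (T : measurableType d) (R : realType) (P : probability T R).
Variable G : set (set T).
Hypothesis Gm : G `<=` measurable.
Implicit Types Y F : T -> R.

Notation TG := (g_sigma_algebraType G).
Notation integ f := (P.-integrable [set: T] (EFin \o f)).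
Notation Es := (Es P).

Lemma sub_sigma_measurable : <<s G >> `<=` @measurable _ T.
Proof. by apply: smallest_sub => //; exact: sigma_algebra_measurable. Qed.

Lemma sub_sigma_fin (S : finType) (xi : T -> S) :
  fin_measurable (xi : TG -> S) -> fin_measurable xi.
Proof. by move=> mxi s; exact: sub_sigma_measurable (mxi s). Qed.

Lemma sub_sigma_fun Y : measurable_fun [set: TG] Y -> measurable_fun [set: T] Y.
Proof.
by move=> mY _ B mB; rewrite setTI; apply: sub_sigma_measurable;
  have := mY measurableT B mB; rewrite setTI.
Qed.

Lemma Es_indic_mul Y (A : set T) : measurable A ->
  Es (fun w => Y w * \1_A w) = fine (\int[P]_(w in A) (Y w)%:E).
Proof.
move=> mA; rewrite /Es /Rintegral [in RHS]integral_mkcond; congr fine.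
apply: eq_integral => w _; rewrite patchE indicE.
by case: ifP => wA; rewrite ?mulr1 ?mulr0.
Qed.

(** Conditional expectation is characterised on sets; summing over the fibres of [xi] gives its
    defining property for finite-valued test functions. *)
Lemma cond_exp_fin F Y (S : finType) (xi : T -> S) (u : S -> R) :
  integ F -> is_cond_exp P G F Y -> fin_measurable (xi : TG -> S) ->
  Es (fun w => Y w * u (xi w)) = Es (fun w => F w * u (xi w)).
Proof.
move=> iF [mY iY YF] mxi; rewrite !Es_mulfin//; try exact: sub_sigma_fin.
apply: eq_bigr => s _; congr (_ * _).
have mxis := mxi s; have mxis' := sub_sigma_measurable mxis.
by rewrite !Es_indic_mul// YF.
Qed.

(** Beyond the level [K] the approximation is 0 and the tail costs [e / 2]; below it the error is at
    most [1 / n <= 1], and its [r]-th power is no larger because [0 < r]. *)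
Lemma fin_approx Y (r : nat) (e : R) : (0 < r)%N ->
  measurable_fun [set: TG] Y -> integ (fun w => `|Y w| ^+ r) -> 0 < e ->
  exists m (c : 'I_m -> R) (xi : T -> 'I_m), [/\ fin_measurable (xi : TG -> 'I_m),
    integ (fun w => `|Y w - c (xi w)| ^+ r) &
    Es (fun w => `|Y w - c (xi w)| ^+ r) <= e].
Proof.
move=> r0 mY iY e0; have mY' := sub_sigma_fun mY.
have e20 : 0 < e / 2 by rewrite divr_gt0.
have Yr0 w : 0 <= `|Y w| ^+ r by exact: exprn_ge0.
have [K HK] := Es_tail iY Yr0 mY' e20.
pose n := (Num.truncn (e / 2)^-1).+1.
have n1 : n%:R^-1 <= e / 2.
  rewrite -[leRHS]invrK lef_pV2 ?posrE ?ltr0n ?invr_gt0 ?divr_gt0//.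
  by rewrite ltW// truncnS_gt.
have [m [c [xi [mxi xi1 xi2]]]] := @fin_discretize _ TG _ Y K n isT mY.
have mxi' := sub_sigma_fin mxi.
have mA : measurable [set w | K%:R <= `|Y w|].
  rewrite (_ : mkset _ = (fun w => `|Y w|) @^-1` `[K%:R, +oo[%classic).
    by rewrite -[X in measurable X]setTI; apply: measurableT_comp.
  by apply/seteqP; split => w /=; rewrite in_itv/= andbT.
have it : integ (fun w => `|Y w| ^+ r * \1_[set w | K%:R <= `|Y w|] w).
  apply: (@integ_mulbd _ _ _ _ _ _ 1) => //.
  by move=> w; rewrite indicE ger0_norm// lern1 leq_b1.
have bd w : `|Y w - c (xi w)| ^+ r <=
    n%:R^-1 + `|Y w| ^+ r * \1_[set w | K%:R <= `|Y w|] w.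
  rewrite indicE; have [YK|KY] := ltP (`|Y w|) K%:R.
    rewrite memNset ?mulr0 ?addr0; last by rewrite /= leNgt YK.
    have h := xi1 _ YK; apply: le_trans h.
    have h1 : `|Y w - c (xi w)| <= 1.
      by rewrite (le_trans (xi1 _ YK))// invf_le1// ?ltr0n// ler1n.
    by case: r r0 {iY HK it Yr0} => // r _; rewrite exprS ler_piMr// exprn_ile1.
  by rewrite mem_set//= mulr1 xi2// subr0 lerDr invr_ge0.
have mZ : measurable_fun setT (fun w => Y w - c (xi w)).
  apply: measurable_funB => //; exact: (fin_measurable_fun c mxi').
have iYc : integ (fun w => `|Y w - c (xi w)| ^+ r).
  apply: (@integ_le _ _ _ _ _ (fun w => n%:R^-1 +
      `|Y w| ^+ r * \1_[set w | K%:R <= `|Y w|] w)).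
  - by apply: measurable_funX; exact: measurableT_comp.
  - by move=> w; rewrite ger0_norm// exprn_ge0.
  - by apply: integD => //; exact: integ_cst.
exists m, c, xi; split => //.
apply: (@le_trans _ _ (Es (fun w => n%:R^-1 +
      `|Y w| ^+ r * \1_[set w | K%:R <= `|Y w|] w))).
  by apply: Es_le => //; apply: integD => //; exact: integ_cst.
rewrite EsD//; last exact: integ_cst.
by rewrite Es_cst (splitr e) lerD.
Qed.

(* Without square integrability of [Y], [cond_var] would be the default 0. *)
Lemma cond_exp_sq_int F Y : sq_int P F -> is_cond_exp P G F Y -> sq_int P Y.
Proof.
move=> F2 HY; have iF := sq_int_integ F2; have [mY iY _] := HY.
have mY' := sub_sigma_fun mY; split => //.
(* Where [|Y| < K], [Y] is within 1 of a finite-valued [a], which is 0 elsewhere. From [E[Y a] =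
   E[F a]] follows [E a^2 <= 2 E F^2 + 2], and [Y^2 <= 2 a^2 + 2] then gives the bound
   [4 E F^2 + 6], independent of [K]. *)
pose C := 4 * Es (fun w => F w ^+ 2) + 6.
pose A K := [set w | `|Y w| < K%:R].
have mA K : measurable (A K).
  rewrite (_ : A K = (fun w => `|Y w|) @^-1` `]-oo, K%:R[%classic); last first.
    by apply/seteqP; split => w; rewrite /A/= in_itv.
  by rewrite -[X in measurable X]setTI; apply: measurableT_comp.
have ndA : {homo A : n m / (n <= m)%N >-> (n <= m)%O}.
  move=> n m nm; apply/subsetPset => w; rewrite /A/= => /lt_le_trans; apply.
  by rewrite ler_nat.
have AT : \bigcup_K A K = setT.
  rewrite -subTset => w _; exists (Num.truncn `|Y w|).+1 => //.
  exact: truncnS_gt.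
have mY2 : measurable_fun setT (EFin \o (fun w => Y w ^+ 2)).
  by apply/measurable_EFinP; exact: measurable_funX.
have AC K : (\int[P]_(w in A K) (Y w ^+ 2)%:E <= C%:E)%E.
  have [m [c [xi [mxi xi1 xi2]]]] := @fin_discretize _ TG _ Y K 1 isT mY.
  have mxi' := sub_sigma_fin mxi.
  pose a w := c (xi w).
  have a2 : sq_int P a by exact: (sq_int_fin P c mxi').
  have ia : integ a by exact: sq_int_integ.
  have iaY : integ (fun w => Y w * a w) by exact: integ_mulfin.
  have iaF : integ (fun w => F w * a w) by exact: integ_mulfin.
  have [_ ia2] := a2; have [_ iF2] := F2.
  have h1 : Es (fun w => a w ^+ 2) <= Es (fun w => Y w * a w + (4^-1 * a w ^+ 2 + 1)).
    apply: Es_le => //.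
      by apply: integD => //; apply: integD; [exact: integZ|exact: integ_cst].
    move=> w; have [YK|KY] := ltP (`|Y w|) K%:R.
      have := xi1 _ YK; rewrite invr1 -/(a w) ler_norml => /andP[h h'].
      have := sqr_ge0 (a w - 2); have := sqr_ge0 (a w + 2); nra.
    by rewrite /a xi2//; nra.
  have h2 : Es (fun w => F w * a w) <= Es (fun w => F w ^+ 2 + 4^-1 * a w ^+ 2).
    apply: Es_le => //; first by apply: integD => //; exact: integZ.
    move=> w; have := sqr_ge0 (F w - 2^-1 * a w); nra.
  have h3 : Es (fun w => a w ^+ 2) <= 2 * Es (fun w => F w ^+ 2) + 2.
    move: h1 h2; rewrite !EsD ?EsZ//; try exact: integZ; try exact: integ_cst.
      by rewrite (cond_exp_fin c iF HY mxi) Es_cst; lra.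
    by apply: integD; [exact: integZ|exact: integ_cst].
  apply: (@le_trans _ _ (\int[P]_w (2 * a w ^+ 2 + 2)%:E)%E).
    apply: (@le_trans _ _ (\int[P]_(w in A K) (2 * a w ^+ 2 + 2)%:E)%E).
      apply: ge0_le_integral => //.
      - by move=> w _; rewrite lee_fin sqr_ge0.
      - exact: measurable_funTS.
      - apply: measurable_funTS; apply/measurable_EFinP.
        apply: measurable_funD => //; apply: measurable_funM => //.
        by apply: measurable_funX; case: a2.
      - move=> w YK; rewrite lee_fin; have := xi1 _ YK.
        rewrite invr1 -/(a w) ler_norml => /andP[h h'].
        have := sqr_ge0 (Y w - 2 * a w); nra.
    apply: ge0_subset_integral => //.
      apply/measurable_EFinP; apply: measurable_funD => //.
      by apply: measurable_funM => //; apply: measurable_funX; case: a2.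
    by move=> w _; rewrite lee_fin addr_ge0// mulr_ge0// sqr_ge0.
  rewrite -EFin_Es; last by apply: integD; [exact: integZ|exact: integ_cst].
  rewrite EsD ?EsZ ?Es_cst//; [|exact: integZ|exact: integ_cst].
  by rewrite lee_fin /C; lra.
apply/integrableP; split => //.
have := @ge0_nondecreasing_set_cvg_integral _ _ _ A (EFin \o (fun w => Y w ^+ 2)) P ndA mA.
have mf K : measurable_fun (A K) (EFin \o (fun w => Y w ^+ 2)).
  exact: measurable_funTS.
have Y20 (i : nat) w : A i w -> (0 <= (EFin \o (fun w => (Y w ^+ 2)%R)) w)%E.
  by move=> _; rewrite lee_fin sqr_ge0.
move=> /(_ mf Y20); rewrite AT => H.
under eq_integral => w do rewrite /= ger0_norm ?sqr_ge0//.
apply: (@le_lt_trans _ _ C%:E); last exact: ltry.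
have : (limn (fun K => \int[P]_(w in A K) (Y w ^+ 2)%:E) <= C%:E)%E.
  by apply: lime_le; [apply/cvg_ex; eexists; exact: H|exact: nearW].
by rewrite (cvg_lim _ H).
Qed.

End sub_sigma_algebra.

(** * Independence of one variable from all the others *)

Section independence.
Context (R : realType) (d : measure_display) (T : measurableType d).
Context (P : probability T R).
Context (dE : nat -> measure_display) (E : forall k, measurableType (dE k)).
Context (X : forall k, {RV P >-> E k}).
Hypothesis indepX : independent_RVs X.

Notation integ f := (P.-integrable [set: T] (EFin \o f)).
Notation Es := (Es P).

Let mX k (B : set (E k)) : measurable B -> measurable (X k @^-1` B).
Proof. by move=> mB; exact: measurable_funPTI. Qed.

(** Pi-lambda argument: finite intersections of events not involving [X k] generate the sigma-field,
    and they satisfy the product rule by [independent_RVs] with [B] inserted at the free index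
    [k]. *)
Lemma indep_sets (k : nat) (B : set (E k)) (C : set T) : measurable B ->
  <<s RV_gen X (~` [set k]) >> C ->
  (P (X k @^-1` B `&` C) = P (X k @^-1` B) * P C)%E.
Proof.
move=> mB; set A0 := X k @^-1` B; have mA0 : measurable A0 by exact: mX.
pose CC := [set C : set T | exists (J : {fset nat}) (A : forall k, set (E k)),
  [/\ forall j, measurable (A j), k \notin J &
      C = \bigcap_(j in [set` J]) (X j @^-1` A j)]].
pose H := [set C : set T | measurable C /\ (P (A0 `&` C) = P A0 * P C)%E].
have CCI : setI_closed CC.
  move=> _ _ [J1 [A1 [mA1 kJ1 ->]]] [J2 [A2 [mA2 kJ2 ->]]].
  exists (J1 `|` J2)%fset, (fun j => (if j \in J1 then A1 j else setT) `&`
     (if j \in J2 then A2 j else setT)); split.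
  - by move=> j; apply: measurableI; case: ifP.
  - by rewrite inE negb_or kJ1.
  - apply/seteqP; split => w.
      move=> [H1 H2] j /=; rewrite inE => /orP[] jJ; split.
      + by rewrite jJ; exact: H1.
      + by case: ifP => // jJ2; exact: H2.
      + by case: ifP => // jJ2; exact: H1.
      + by rewrite jJ; exact: H2.
    move=> H1; split => j /= jJ.
      by have [|] := H1 j; rewrite /= ?inE jJ.
    by have [|] := H1 j; rewrite /= ?inE jJ ?orbT.
have CCH : CC `<=` H.
  move=> _ [J [A [mA kJ ->]]].
  have mC : measurable (\bigcap_(j in [set` J]) (X j @^-1` A j)).
    by apply: fin_bigcap_measurable => // j _; exact: mX.
  split => //; pose A' := dfwith A k B.
  have mA' j : measurable (A' j).
    by rewrite /A'; case: dfwithP.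
  have -> : A0 `&` \bigcap_(j in [set` J]) (X j @^-1` A j) =
      \bigcap_(j in [set` (k |` J)%fset]) (X j @^-1` A' j).
    apply/seteqP; split => w.
      move=> [Bw H1] j /=; rewrite !inE => /orP[/eqP ->|jJ].
        by rewrite /A' dfwithin.
      rewrite /A' dfwithout; first exact: H1.
      by apply: contraNneq kJ => ->.
    move=> H1; split.
      by have := H1 k; rewrite /= !inE eqxx /A' dfwithin; exact.
    move=> j /= jJ; have := H1 j; rewrite /= !inE jJ orbT /A' dfwithout; first exact.
    by apply: contraNneq kJ => ->.
  rewrite indepX// big_fsetU1//= {1}/A' dfwithin indepX//; congr (_ * _)%E.
  apply: eq_big_seq => j jJ; rewrite /A' dfwithout//.
  by apply: contraNneq kJ => ->.
have lH : lambda_system setT H.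
  split => //.
  - by split => //; rewrite setIT probability_setT mule1.
  - move=> A A' A'A [mA HA] [mA' HA']; split; first exact: measurableD.
    rewrite setIDA (_ : A0 `&` A `\` A' = (A0 `&` A) `\` (A0 `&` A')); last first.
      by apply/seteqP; split => w /=; tauto.
    have fin C' : measurable C' -> P C' \is a fin_num by move=> ?; exact: fin_num_measure.
    rewrite !measureD ?ltey_eq ?fin//; try exact: measurableI.
    rewrite (_ : A0 `&` A `&` (A0 `&` A') = A0 `&` A'); last first.
      by apply/seteqP; split => w /=; [tauto|move=> [? ?]; split => //; split => //; exact: A'A].
    rewrite (_ : A `&` A' = A'); last by apply/setIidPr.
    transitivity (P A0 * P A - P A0 * P A')%E; first by congr (_ - _)%E.
    by rewrite muleBr ?fin// fin_num_adde_defr// fin.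
  - move=> A ndA HA; have mA i : measurable (A i) by case: (HA i).
    have mUA : measurable (\bigcup_i A i) by exact: bigcupT_measurable.
    split => //; rewrite setI_bigcupr.
    have c1 : P (A0 `&` A i) @[i --> \oo] --> P (\bigcup_i (A0 `&` A i)).
      apply: (@nondecreasing_cvg_mu _ _ _ P (fun i => A0 `&` A i)).
      - by move=> i; exact: measurableI.
      - by rewrite -setI_bigcupr; exact: measurableI.
      - by move=> n m nm; apply/subsetPset; apply: setIS; apply/subsetPset; exact: ndA.
    have c2 : (P A0 * P (A i))%E @[i --> \oo] --> (P A0 * P (\bigcup_i A i))%E.
      apply: cvgeZl; first exact: fin_num_measure.
      exact: (@nondecreasing_cvg_mu _ _ _ P A).
    have E12 : (fun i => P (A0 `&` A i)) = (fun i => (P A0 * P (A i))%E).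
      by apply/funext => i; exact: (HA i).2.
    rewrite E12 in c1; exact: (cvg_unique _ c1 c2).
have := @lambda_system_subset _ _ CCI setT H lH CCH (fun X _ => @subsetT _ X).
move=> sub HC; apply: (sub _ _).2; move: C HC; apply: smallest_sub.
  exact: smallest_sigma_algebra.
move=> _ [j /= jk [B' mB' <-]]; apply: sub_sigma_algebra; rewrite setTI.
exists [fset j]%fset, (dfwith (fun k => setT) j B'); split.
- by move=> i; case: dfwithP.
- by rewrite inE; apply/negP => /eqP/esym.
- apply/seteqP; split => w /=.
    by move=> ? i /=; rewrite inE => /eqP ->; rewrite dfwithin.
  by move=> /(_ j); rewrite /= inE eqxx dfwithin; apply.
Qed.

(** [indep_sets] gives the rule for finite-valued functions, and approximation in L^1 extends it;
    the error enters twice, hence [e / 2]. *)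
Lemma indep_Es (k : nat) (B : set (E k)) (Y : T -> R) : measurable B ->
  measurable_fun [set: g_sigma_algebraType (RV_gen X (~` [set k]))] Y -> integ Y ->
  Es (fun w => Y w * \1_(X k @^-1` B) w) = Es Y * fine (P (X k @^-1` B)).
Proof.
move=> mB mY iY; set A0 := X k @^-1` B; have mA0 : measurable A0 by exact: mX.
have Gm := @RV_gen_measurable _ _ _ _ _ _ X (~` [set k]).
have p01 : 0 <= fine (P A0) <= 1.
  rewrite fine_ge0//= -lee_fin fineK ?probability_le1//.
  exact: fin_num_measure.
move: p01; set p := fine _ => /andP[p0 p1].
have ind1 w : `|\1_A0 w : R| <= 1.
  by rewrite indicE ger0_norm// lern1 leq_b1.
apply/eqP; rewrite -subr_eq0 -normr_le0; apply/ler_addgt0Pr => e e0; rewrite add0r.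
have [||m [c [xi [mxi iZ HZ]]]] := @fin_approx _ _ _ P _ Gm Y 1 (e / 2) isT mY.
- by under eq_fun do rewrite expr1; exact: integ_abs.
- by rewrite divr_gt0.
have {}iZ : integ (fun w => `|Y w - c (xi w)|) by move: iZ; under eq_fun do rewrite expr1.
have {}HZ : Es (fun w => `|Y w - c (xi w)|) <= e / 2.
  by move: HZ; under eq_Es do rewrite expr1.
have mxi' := sub_sigma_fin Gm mxi.
have iI : integ (\1_A0 : T -> R) by exact: integrable_indic.
have ic : integ (fun w => c (xi w)) by exact: (integ_fin P c mxi').
have cE : Es (fun w => c (xi w) * \1_A0 w) = Es (fun w => c (xi w)) * p.
  under eq_Es do rewrite mulrC.
  rewrite Es_mulfin// Es_fin// mulr_suml; apply: eq_bigr => i _.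
  rewrite -mulrA; congr (_ * _).
  have mxii := sub_sigma_measurable Gm (mxi i).
  rewrite (@eq_Es _ _ _ _ _ (\1_(A0 `&` xi @^-1` [set i]))); last first.
    by move=> w; rewrite indicI.
  rewrite Es_indic; last exact: measurableI.
  rewrite indep_sets//; last exact: (mxi i).
  by rewrite fineM ?fin_num_measure// mulrC.
have iYI : integ (fun w => Y w * \1_A0 w) by exact: (integ_mulbd iY).
have icI : integ (fun w => c (xi w) * \1_A0 w) by exact: (integ_mulbd ic).
have -> : Es (fun w => Y w * \1_A0 w) - Es Y * p =
    Es (fun w => (Y w - c (xi w)) * \1_A0 w) - Es (fun w => Y w - c (xi w)) * p.
  under [in RHS]eq_Es do rewrite mulrBl.
  by rewrite !EsB// cE; ring.
have iYc : integ (fun w => Y w - c (xi w)) by exact: integB.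
have iYcI : integ (fun w => (Y w - c (xi w)) * \1_A0 w) by exact: (integ_mulbd iYc).
rewrite (splitr e); apply: le_trans (ler_normB _ _) _; apply: lerD.
  apply: le_trans (Es_abs iYcI) _; apply: le_trans HZ.
  apply: Es_le => //; first exact: integ_abs.
  by move=> w; rewrite normrM ler_piMr.
rewrite normrM (ger0_norm p0) (le_trans _ HZ)//.
apply: le_trans (Es_abs iYc).
by rewrite ler_piMr.
Qed.

End independence.

(** * Law of a finite discretisation and projection onto it *)

Section observation.
Context (R : realType) (d : measure_display) (T : measurableType d).
Context (P : probability T R).
Context (dE : nat -> measure_display) (E : forall k, measurableType (dE k)).
Context (X : forall k, {RV P >-> E k}).
Hypothesis indepX : independent_RVs X.
Context (N : nat) (S : finType) (disc : forall k, E k -> S).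
Hypothesis mdisc : forall k, fin_measurable (@disc k).

Notation integ f := (P.-integrable [set: T] (EFin \o f)).
Notation Es := (Es P).
Notation Om := {ffun 'I_N -> S}.

Definition obs (w : T) : Om := [ffun k : 'I_N => disc (X k w)].

Definition prb (k : 'I_N) (s : S) : R := fine (P (X k @^-1` (@disc k @^-1` [set s]))).

Notation Ex := (Ex prb).
Notation ce := (ce prb).
Notation hproj := (hproj prb).

Let fdX k : fin_measurable (fun w => disc (X k w)).
Proof.
by move=> s; exact: (measurable_funPTI (X k) (@mdisc k s)).
Qed.

Lemma obs_fin : fin_measurable obs.
Proof. exact: fin_measurable_ffun. Qed.

Lemma prb_ge0 k s : 0 <= prb k s.
Proof. exact: fine_ge0. Qed.

Lemma prb_sum1 k : \sum_s prb k s = 1.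
Proof.
have := @Es_fin _ _ _ P _ _ (fun=> 1) (fdX k); rewrite Es_cst => ->.
by apply: eq_bigr => s _; rewrite mul1r.
Qed.

Lemma obs_law x : fine (P (obs @^-1` [set x])) = wt prb x.
Proof.
(* [independent_RVs] takes an event for every index in [nat]; those from [N] on get the full
   space. *)
pose A k : set (E k) := if insub k is Some i then @disc k @^-1` [set x i] else setT.
have mA k : measurable (A k) by rewrite /A; case: insubP => // i _ _; exact: mdisc.
pose J : {fset nat} := [fset k in iota 0 N]%fset.
have -> : obs @^-1` [set x] = \bigcap_(k in [set` J]) (X k @^-1` A k).
  apply/seteqP; split => w.
    move=> /= wx k /=; rewrite !inE /= mem_iota /= => kN.
    rewrite /A; case: insubP => //= i _ ik.
    by rewrite -wx ffunE; subst k.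
  move=> H; apply/ffunP => i; have := H i.
  rewrite /= !inE /= mem_iota /= => /(_ (ltn_ord i)).
  rewrite /A; case: insubP => [j _ /val_inj -> /= H'|]; last by rewrite ltn_ord.
  by rewrite ffunE.
rewrite indepX//.
have -> : (\prod_(k <- J) P (X k @^-1` A k) = \prod_(k <- iota 0 N) P (X k @^-1` A k))%E.
  apply: perm_big; apply: uniq_perm; rewrite ?fset_uniq ?iota_uniq// => k.
  by rewrite !inE.
rewrite (_ : iota 0 N = index_iota 0 N) ?big_mkord; last by rewrite /index_iota subn0.
transitivity (fine (\prod_(i < N) (prb i (x i))%:E)).
  congr fine; apply: eq_bigr => i _; rewrite /prb fineK; last first.
    by apply: fin_num_measure; exact: (@fdX i (x i)).
  by rewrite /A; case: insubP => [j _ /val_inj ->//|]; rewrite ltn_ord.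
by rewrite prodEFin.
Qed.

Lemma Es_obs u : Es (fun w => u (obs w)) = Ex u.
Proof.
rewrite (Es_fin P u obs_fin); apply: eq_bigr => x _.
by rewrite obs_law mulrC.
Qed.

(** Overwriting the coordinates in [A] by constants is what makes functions of [obs] measurable with
    respect to fewer variables. *)
Lemma mix_obs_sigma (M : set nat) (A : {set 'I_N}) y :
  (forall i : 'I_N, i \notin A -> M i) ->
  fin_measurable ((fun w => mix A y (obs w)) : g_sigma_algebraType (RV_gen X M) -> Om).
Proof.
move=> AM.
have -> : (fun w => mix A y (obs w)) =
    (fun w => [ffun i : 'I_N => if i \in A then y i else disc (X i w)]).
  by apply/funext => w; apply/ffunP => i; rewrite !ffunE.
apply: (@fin_measurable_ffun _ (g_sigma_algebraType (RV_gen X M))) => i.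
case: (boolP (i \in A)) => [iA s|iA s].
  have [->|H] := pselect ((fun _ : T => y i) @^-1` [set s] = setT).
    exact: measurableT.
  rewrite (_ : _ @^-1` _ = set0); first exact: measurable0.
  rewrite -subset0 => w /= ys; apply: H.
  by rewrite -subTset => v _.
apply: sub_sigma_algebra; exists (i : nat); first exact: AM.
by exists (@disc i @^-1` [set s]); [exact: mdisc|rewrite setTI].
Qed.

Section transfer.

(* Integrating out the k-th coordinate is invisible to functions of the
   remaining variables. *)
Lemma Es_ce_obs (k : 'I_N) (Y : T -> R) (D : Om -> R) :
  measurable_fun [set: g_sigma_algebraType (RV_gen X (~` [set (k : nat)]))] Y ->
  integ Y ->
  Es (fun w => Y w * D (obs w)) = Es (fun w => Y w * ce [set k] D (obs w)).
Proof.
move=> mY iY.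
have Gm := @RV_gen_measurable _ _ _ _ _ _ X (~` [set (k : nat)]).
pose cs s : Om := [ffun=> s].
pose h s := Es (fun w => Y w * D (mix [set k] (cs s) (obs w))).
have mixm s := @mix_obs_sigma (~` [set (k : nat)]) [set k]%SET (cs s).
have {}mixm s : fin_measurable ((fun w => mix [set k] (cs s) (obs w)) :
    g_sigma_algebraType (RV_gen X (~` [set (k : nat)])) -> Om).
  apply: mixm => i; rewrite inE => ik /= ki; move/negP: ik; apply.
  exact/eqP/val_inj.
have iYD s : integ (fun w => Y w * D (mix [set k] (cs s) (obs w))).
  by apply: (integ_mulfin D iY); exact: sub_sigma_fin (mixm s).
have mB s : measurable (@disc k @^-1` [set s]) by exact: mdisc.
transitivity (\sum_s h s * prb k s).
  transitivity (Es (fun w => \sum_s (Y w * D (mix [set k] (cs s) (obs w))) *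
      \1_(X k @^-1` (@disc k @^-1` [set s])) w)).
    apply: eq_Es => w; rewrite (bigD1 (disc (X k w)))//= indicE mem_set// mulr1.
    rewrite big1 ?addr0 => [|s sw]; last first.
      by rewrite indicE memNset ?mulr0//= => sE; rewrite -sE eqxx in sw.
    congr (_ * D _); apply/ffunP => i; rewrite !ffunE inE.
    by case: eqVneq => // ->.
  rewrite Es_sum => [|s]; last first.
    apply: (integ_mulbd (C := 1) (iYD s)) => //.
      by apply: measurable_indic; exact: (@fdX k s).
    by move=> w; rewrite indicE ger0_norm// lern1 leq_b1.
  apply: eq_bigr => s _; rewrite (indep_Es indepX (mB s))//.
  apply: measurable_funM => //.
  exact: (fin_measurable_fun D (mixm s)).
have -> : Es (fun w => Y w * ce [set k] D (obs w)) = Ex (fun y => h (y k)).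
  transitivity (Es (fun w => \sum_y wt prb y * (Y w * D (mix [set k] (cs (y k)) (obs w))))).
    apply: eq_Es => w; rewrite mulr_sumr; apply: eq_bigr => y _.
    rewrite mulrCA; congr (_ * (_ * D _)); apply/ffunP => i; rewrite !ffunE inE.
    by case: eqVneq => // ->.
  rewrite Es_sum => [|y]; last exact/integZ/iYD.
  by apply: eq_bigr => y _; rewrite EsZ.
rewrite -(Es_obs (fun y => h (y k))).
under [RHS]eq_Es => w do rewrite ffunE.
by rewrite (Es_fin P h (fdX k)).
Qed.

Variables (m : nat) (F : T -> R).
Hypothesis F2 : sq_int P F.
Hypothesis Fdeg : forall M : {fset nat}, #|` M| <> m ->
  {ae P, forall w, Hoeffding_comp X F M w = 0}.

Let iF : integ F. Proof. exact: sq_int_integ. Qed.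

Let condE (M : set nat) := cond_expP (@RV_gen_measurable _ _ _ _ _ _ X M) iF.

Lemma RV_gen_fun (M M' : set nat) (Y : T -> R) : M `<=` M' ->
  measurable_fun [set: g_sigma_algebraType (RV_gen X M)] Y ->
  measurable_fun [set: g_sigma_algebraType (RV_gen X M')] Y.
Proof.
move=> MM' mY _ B mB; have := mY measurableT B mB; rewrite !setTI.
have sub : <<s RV_gen X M >> `<=` <<s RV_gen X M' >>.
  apply: smallest_sub; first exact: smallest_sigma_algebra.
  move=> A [j Mj HA]; apply: sub_sigma_algebra; exists j => //; exact: MM'.
exact: sub.
Qed.

(** Pair the component of [F] at [M] with [W = hproj M u]. For [L] strictly inside [M] the term
    vanishes, since E[F | F_L] does not see some coordinate in which [W] is centred; for [L = M] it
    is E[F W], as [W] depends on the coordinates in [M] only. So degeneracy passes to the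
    discretisation. *)
Lemma Es_proj_obs (M : {set 'I_N}) u : #|M| != m ->
  Es (fun w => F w * hproj M u (obs w)) = 0.
Proof.
move=> Mm; pose M' : {fset nat} := [fset val i | i in M]%fset.
have M'card : #|` M'| <> m.
  rewrite /M' card_imfset; last exact: val_inj.
  by move=> H; move: Mm; rewrite cardE H eqxx.
pose W := hproj M u.
have iYW (Y : T -> R) : integ Y -> integ (fun w => Y w * W (obs w)).
  by move=> iY; exact: (integ_mulfin W iY obs_fin).
have H0 : Es (fun w => Hoeffding_comp X F M' w * W (obs w)) = 0.
  rewrite -[RHS](@Es_cst _ _ _ P 0); congr fine; apply: ae_eq_integral => //.
    apply/measurable_EFinP; apply: integ_meas; apply: iYW.
    rewrite (_ : EFin \o _ = fun w => (\sum_(L <- fpowerset M')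
       ((-1) ^+ (#|` M'| - #|` L|) * cond_exp P (RV_gen X [set` L]) F w)%:E)%E).
      apply: integrable_sum => // L _; apply: integZ.
      by have [] := condE [set` L].
    by apply/funext => w /=; rewrite /Hoeffding_comp -sumEFin.
  have [A [mA PA0 HA]] := Fdeg M'card; exists A; split => // w /= H.
  by apply: HA => /= Hw; apply: H => _; rewrite Hw mul0r.
have YL (L : {fset nat}) : L \in fpowerset M' -> L != M' ->
    Es (fun w => cond_exp P (RV_gen X [set` L]) F w * W (obs w)) = 0.
  rewrite fpowersetE => LM' LM.
  have [j jM' jL] : exists2 j, j \in M' & j \notin L.
    apply/fsubsetPn; apply: contra LM => M'L.
    by rewrite eqEfsubset LM'.
  have /imfsetP[/= i iM ji] := jM'; subst j.
  have [mY iY _] := condE [set` L].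
  rewrite (@Es_ce_obs i) //.
    rewrite -[RHS](@Es_cst _ _ _ P 0); apply: eq_Es => w.
    by rewrite /W hproj_nul ?mulr0//; exact: prb_sum1.
  apply: RV_gen_fun mY => j /= jL' ji; subst j; by rewrite jL' in jL.
have YM : Es (fun w => cond_exp P (RV_gen X [set` M']) F w * W (obs w)) =
    Es (fun w => F w * W (obs w)).
  (* [obs] involves all [N] variables. Overwriting its coordinates outside [M] does not change [W]
     and yields finite-valued maps measurable for [M'], as [cond_exp_fin] requires. *)
  have WE w : W (obs w) = \sum_y wt prb y * W (mix (~: M) y (obs w)).
    by rewrite -/(Ex _) -/(ce _ _ _) ce_id//; [exact: prb_sum1|exact: hproj_inv].
  have mixm y : fin_measurable ((fun w => mix (~: M) y (obs w)) :
      g_sigma_algebraType (RV_gen X [set` M']) -> Om).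
    apply: mix_obs_sigma => i; rewrite inE negbK => iM /=.
    by apply/imfsetP; exists i.
  have Gm := @RV_gen_measurable _ _ _ _ _ _ X [set` M'].
  have mixm' y := sub_sigma_fin Gm (mixm y).
  have exp (Y : T -> R) : integ Y -> Es (fun w => Y w * W (obs w)) =
      \sum_y wt prb y * Es (fun w => Y w * W (mix (~: M) y (obs w))).
    move=> iY.
    rewrite (@eq_Es _ _ _ _ _ (fun w => \sum_y wt prb y * (Y w * W (mix (~: M) y (obs w))))).
      rewrite Es_sum => [|y]; last exact/integZ/(integ_mulfin W iY (mixm' y)).
      by apply: eq_bigr => y _; rewrite EsZ//; exact: (integ_mulfin W iY (mixm' y)).
    by move=> w; rewrite WE mulr_sumr; apply: eq_bigr => y _; rewrite mulrCA.
  have [_ iY _] := condE [set` M'].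
  rewrite !exp//; apply: eq_bigr => y _; congr (_ * _).
  exact: (cond_exp_fin Gm W iF (condE [set` M']) (mixm y)).
rewrite -YM -H0 /Hoeffding_comp.
pose g (L : {fset nat}) w := (-1) ^+ (#|` M'| - #|` L|) *
  (cond_exp P (RV_gen X [set` L]) F w * W (obs w)).
have ig L : integ (g L) by apply/integZ/iYW; have [] := condE [set` L].
transitivity (\sum_(L <- fpowerset M') Es (g L)); last first.
  apply/esym; apply: EFin_inj; rewrite EFin_Es; last first.
    rewrite (_ : EFin \o _ = fun w => (\sum_(L <- fpowerset M') (g L w)%:E)%E).
      by apply: integrable_sum => // L _; exact: ig.
    apply/funext => w /=; rewrite mulr_suml -sumEFin; apply: eq_bigr => L _.
    by rewrite /g mulrA.
  under eq_integral => w _.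
    rewrite mulr_suml -sumEFin; under eq_bigr do rewrite -mulrA -/(g _ _).
  over.
  rewrite integral_sum// -sumEFin; apply: eq_bigr => L _; exact/esym/EFin_Es.
rewrite (bigD1_seq M')/= ?fset_uniq//; last by rewrite fpowersetE.
rewrite [X in _ + X]big1_seq ?addr0.
  by rewrite /g subnn; apply: eq_Es => w; rewrite expr0 mul1r.
move=> L /andP[LM LP]; rewrite /g EsZ; first by rewrite YL// mulr0.
by apply: iYW; have [] := condE [set` L].
Qed.

(** [f] plays the role of E[F | obs], and the second clause is the form in which it is used. For
    [|M| <> m] a component is tested against itself: its second moment equals
    [E[F * hproj M h (obs)]], which is 0 by [Es_proj_obs]. *)
Lemma discrete_projection : exists f : Om -> R,
  (forall M : {set 'I_N}, #|M| != m -> forall x, hproj M f x = 0) /\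
  (forall u, Es (fun w => F w * u (obs w)) = Ex (fun x => f x * u x)).
Proof.
(* E[F | obs = x]; at points x of weight 0 both sides below get factor 0. *)
pose h x := Es (fun w => F w * \1_(obs @^-1` [set x]) w) / wt prb x.
have hE u : Es (fun w => F w * u (obs w)) = Ex (fun x => h x * u x).
  rewrite (Es_mulfin u iF obs_fin); apply: eq_bigr => x _; rewrite /h.
  have [w0|w0] := eqVneq (wt prb x) 0; last first.
    by rewrite mulrA [wt _ _ * _]mulrC divfK// mulrC.
  rewrite w0 mul0r Es_indic_mul; last exact: obs_fin.
  rewrite /Rintegral null_set_integral ?mulr0//.
  - exact: obs_fin.
  - by apply: measurable_funTS; exact: measurable_int iF.
  - apply/eqP; rewrite -fine_eq0; last by apply: fin_num_measure; exact: obs_fin.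
    by rewrite obs_law w0.
have h0 (M : {set 'I_N}) : #|M| != m -> forall x, wt prb x * hproj M h x = 0.
  move=> Mm; apply: Ex_sqr_eq0; first exact: prb_ge0.
  by rewrite -(Ex_proj_self prb_sum1 M h) -(hE (hproj M h)) Es_proj_obs.
clearbody h.
(* [h] has the right components only up to weight 0, so the others are
   removed. *)
exists (fun x => \sum_(M : {set 'I_N} | #|M| == m) hproj M h x); split.
  move=> M Mm x; rewrite hproj_sum big1// => M' M'm.
  apply: (@hproj_eq0 _ _ _ _ prb_sum1 M M').
  - by apply: contraNneq Mm => ->.
  - by move=> k kM' y; apply: hproj_nul => //; exact: prb_sum1.
  - exact: hproj_inv.
move=> u; rewrite hE; apply: eq_bigr => x _; rewrite !mulrA; congr (_ * _).
rewrite -[in LHS](@hproj_sumE _ _ _ prb prb_sum1 h x) (bigID (fun M : {set 'I_N} => #|M| == m))/=.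
rewrite mulrDr [X in _ + X](_ : _ = 0) ?addr0// mulr_sumr big1// => M Mm.
exact: h0.
Qed.

Section projection_bounds.
Variable f : Om -> R.
Hypothesis fE : forall u, Es (fun w => F w * u (obs w)) = Ex (fun x => f x * u x).

Let Fu u : integ (fun w => F w * u (obs w)).
Proof. exact: (integ_mulfin u iF obs_fin). Qed.

Let iu (u : Om -> R) : integ (fun w => u (obs w)).
Proof. exact: (integ_fin P u obs_fin). Qed.

(** Pythagoras for the projection [f]. Taken for an approximation [g] and for [f] itself, it shows
    that [f] is at least as close to [F] as [g] is. *)
Lemma Es_sub_obs (g : Om -> R) : Es (fun w => (F w - g (obs w)) ^+ 2) =
  Es (fun w => F w ^+ 2) - Ex (fun x => f x ^+ 2) + Ex (fun x => (f x - g x) ^+ 2).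
Proof.
have [_ iF2] := F2.
rewrite (@eq_Es _ _ _ _ _ (fun w => F w ^+ 2 +
   ((-2) * (F w * g (obs w)) + (fun x => g x ^+ 2) (obs w)))); last by move=> w /=; ring.
rewrite EsD//; last by apply: integD; [exact: integZ|exact: (iu (fun x => g x ^+ 2))].
rewrite EsD; [|exact: integZ|exact: (iu (fun x => g x ^+ 2))].
rewrite EsZ// fE (Es_obs (fun x => g x ^+ 2)) -addrA; congr (_ + _).
rewrite -ExZ -ExD addrC -[RHS]ExB; apply: eq_Ex => x; ring.
Qed.

(** Conditional Jensen through the tangent inequality [a^4 >= 4 a b^3 - 3 b^4] at [b = f (obs)]; its
    right side has mean [E f^4] because [f^3] is an admissible test function in [fE]. *)
Lemma Ex_fourth_le : integ (fun w => F w ^+ 4) ->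
  Ex (fun x => f x ^+ 4) <= Es (fun w => F w ^+ 4).
Proof.
move=> iF4; apply: (@le_trans _ _ (Es (fun w => 4 * (F w * f (obs w) ^+ 3) +
    (-3) * f (obs w) ^+ 4))).
  rewrite EsD; [|exact/integZ/(Fu (fun x => f x ^+ 3))|exact/integZ/(iu (fun x => f x ^+ 4))].
  rewrite EsZ; last exact: (Fu (fun x => f x ^+ 3)).
  rewrite EsZ; last exact: (iu (fun x => f x ^+ 4)).
  rewrite (fE (fun x => f x ^+ 3)) (Es_obs (fun x => f x ^+ 4)).
  have -> : Ex (fun x => f x * f x ^+ 3) = Ex (fun x => f x ^+ 4).
    by apply: eq_Ex => x; ring.
  lra.
apply: Es_le => //.
  by apply: integD; [exact/integZ/(Fu (fun x => f x ^+ 3))|exact/integZ/(iu (fun x => f x ^+ 4))].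
move=> w; move: (F w) (f (obs w)) => a b; rewrite -subr_ge0.
have -> : a ^+ 4 - (4 * (a * b ^+ 3) + (-3) * b ^+ 4) =
  (a - b) ^+ 2 * ((a + b) ^+ 2 + 2 * b ^+ 2) by ring.
by apply: mulr_ge0; [exact: sqr_ge0|apply: addr_ge0; [exact: sqr_ge0|apply: mulr_ge0 => //; exact: sqr_ge0]].
Qed.

(** With [Y] = E[F | G_k] and [D = f - E_k f], both [Y] and [E_k f] are orthogonal to [D], so [E D^2
    = E[(F - Y) D]]; AM-GM then absorbs half of [E D^2]. *)
Lemma Ex_influence_le (k : 'I_N) (r : R) : (influence X F k <= r%:E)%E ->
  Ex (fun x => (f x - ce [set k] f x) ^+ 2) <= r.
Proof.
pose G := RV_gen X (~` [set (k : nat)]).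
have Gm : G `<=` measurable by exact: RV_gen_measurable.
have HY := condE (~` [set (k : nat)]).
have [mY iY _] := HY; set Y := cond_exp P _ F in HY mY iY.
have Y2 : sq_int P Y by exact: (cond_exp_sq_int Gm F2 HY).
have FY2 : sq_int P (fun w => F w - Y w) by exact: sq_intB.
have [_ iFY2] := FY2.
have -> : influence X F k = (Es (fun w => (F w - Y w) ^+ 2))%:E.
  have [_ _ HZ] := cond_expP Gm iFY2.
  rewrite EFin_Es// /influence unlock -HZ//.
  exact: (@measurableT _ (g_sigma_algebraType G)).
rewrite lee_fin; apply: le_trans.
pose D x := f x - ce [set k] f x.
have D0 x : ce [set k] D x = 0 by rewrite ceB (ce_ce prb_sum1) finset.setUid subrr.
have e1 : Ex (fun x => D x ^+ 2) = Es (fun w => (F w - Y w) * D (obs w)).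
  rewrite (@eq_Es _ _ _ _ _ (fun w => F w * D (obs w) - Y w * D (obs w))); last first.
    by move=> w; rewrite mulrBl.
  rewrite EsB//; last exact: (integ_mulfin D iY obs_fin).
  rewrite (Es_ce_obs _ mY iY) fE.
  rewrite (@eq_Es _ _ _ _ (fun w => Y w * _) (fun=> 0)); last by move=> w; rewrite D0 mulr0.
  rewrite Es_cst subr0.
  have := @Ex_orth _ _ _ prb prb_sum1 [set k]%SET (ce [set k] f) D (@inv_ce _ _ _ _ _ _) D0.
  move=> e; rewrite -[RHS]subr0 -[in RHS]e -ExB; apply: eq_Ex => x; rewrite /D; ring.
have e2 : Es (fun w => (F w - Y w) * D (obs w)) <=
    Es (fun w => 2^-1 * (F w - Y w) ^+ 2 + 2^-1 * (D (obs w)) ^+ 2).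
  apply: Es_le.
  - by apply: integ_mulfin; [exact: sq_int_integ|exact: obs_fin].
  - by apply: integD; [exact: integZ|exact/integZ/(iu (fun x => D x ^+ 2))].
  - by move=> w; have := sqr_ge0 (F w - Y w - D (obs w)); nra.
move: e2; rewrite -e1 EsD; [|exact: integZ|exact/integZ/(iu (fun x => D x ^+ 2))].
rewrite EsZ// EsZ; last exact: (iu (fun x => D x ^+ 2)).
rewrite (Es_obs (fun x => D x ^+ 2)) -/(D _); rewrite /D; lra.
Qed.

End projection_bounds.
End transfer.
End observation.

(** * Density in L^2 of functions of finite discretisations *)

Section density.
Context (R : realType) (d : measure_display) (T : measurableType d).
Context (P : probability T R).
Context (dE : nat -> measure_display) (E : forall k, measurableType (dE k)).
Context (X : forall k, {RV P >-> E k}).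

Notation integ f := (P.-integrable [set: T] (EFin \o f)).
Notation Es := (Es P).

Definition cylinder (G : T -> R) := exists N (S : finType) (disc : forall k, E k -> S)
  (g : {ffun 'I_N -> S} -> R),
  (forall k, fin_measurable (@disc k)) /\ G = fun w => g (obs X N disc w).

Definition approximable (F : T -> R) := sq_int P F /\ forall e, 0 < e ->
  exists2 G, cylinder G & Es (fun w => (F w - G w) ^+ 2) <= e.

Lemma cylinder_sq_int G : cylinder G -> sq_int P G.
Proof.
move=> [N [S [disc [g [mdisc ->]]]]].
exact: (sq_int_fin P g (@obs_fin _ _ _ _ _ _ X N S disc mdisc)).
Qed.

(** Two discretisations have a common refinement, with the product alphabet and the larger number of
    coordinates. *)
Lemma cylinder_op (op : R -> R -> R) G1 G2 : cylinder G1 -> cylinder G2 ->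
  cylinder (fun w => op (G1 w) (G2 w)).
Proof.
move=> [N1 [S1 [d1 [g1 [m1 ->]]]]] [N2 [S2 [d2 [g2 [m2 ->]]]]].
exists (maxn N1 N2), (S1 * S2)%type, (fun k x => (d1 k x, d2 k x)),
  (fun x => op (g1 [ffun i => (x (widen_ord (leq_maxl N1 N2) i)).1])
               (g2 [ffun i => (x (widen_ord (leq_maxr N1 N2) i)).2])); split.
  by move=> k; exact: fin_measurable_pair.
apply/funext => w; congr (op (g1 _) (g2 _)); apply/ffunP => i; by rewrite !ffunE.
Qed.

Lemma cylinder_approximable G : cylinder G -> approximable G.
Proof.
move=> cG; split; first exact: cylinder_sq_int.
move=> e e0; exists G => //.
under eq_Es do rewrite subrr expr0n.
by rewrite Es_cst ltW.
Qed.

Lemma cylinder_cst c : cylinder (fun=> c).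
Proof.
exists 0%N, unit, (fun _ _ => tt), (fun=> c); split => // k s.
rewrite (_ : _ @^-1` _ = setT)//.
by rewrite -subTset => x _ /=; case: s.
Qed.

Let Es_triangle (F F' G : T -> R) : sq_int P F -> sq_int P F' -> sq_int P G ->
  Es (fun w => (F w - G w) ^+ 2) <=
  2 * Es (fun w => (F w - F' w) ^+ 2) + 2 * Es (fun w => (F' w - G w) ^+ 2).
Proof.
move=> F2 F'2 G2.
have [_ i1] := sq_intB F2 G2; have [_ i2] := sq_intB F2 F'2.
have [_ i3] := sq_intB F'2 G2.
rewrite -!EsZ// -EsD; [|exact: integZ|exact: integZ].
apply: Es_le => //; first by apply: integD; exact: integZ.
move=> w; have := sqr_ge0 ((F w - F' w) - (F' w - G w)); nra.
Qed.

Lemma approximable_lim F : sq_int P F ->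
  (forall e, 0 < e -> exists2 F', approximable F' &
    Es (fun w => (F w - F' w) ^+ 2) <= e) -> approximable F.
Proof.
move=> F2 FF'; split => // e e0; have e4 : 0 < e / 4 by rewrite divr_gt0.
have [F' [F'2 aF'] HF'] := FF' _ e4; have [G cG HG] := aF' _ e4.
exists G => //; apply: le_trans (Es_triangle F2 F'2 (cylinder_sq_int cG)) _.
by lra.
Qed.

Lemma approximableD F1 F2 : approximable F1 -> approximable F2 ->
  approximable (fun w => F1 w + F2 w).
Proof.
move=> [F12 a1] [F22 a2]; split; first exact: sq_intD.
move=> e e0; have e4 : 0 < e / 4 by rewrite divr_gt0.
have [G1 cG1 H1] := a1 _ e4; have [G2 cG2 H2] := a2 _ e4.
exists (fun w => G1 w + G2 w); first exact: (cylinder_op +%R).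
have G12 := cylinder_sq_int cG1; have G22 := cylinder_sq_int cG2.
have := Es_triangle (sq_intD F12 F22) (sq_intD G12 F22) (sq_intD G12 G22).
have -> : Es (fun w => (F1 w + F2 w - (G1 w + F2 w)) ^+ 2) = Es (fun w => (F1 w - G1 w) ^+ 2).
  by apply: eq_Es => w; congr (_ ^+ 2); ring.
have -> : Es (fun w => (G1 w + F2 w - (G1 w + G2 w)) ^+ 2) = Es (fun w => (F2 w - G2 w) ^+ 2).
  by apply: eq_Es => w; congr (_ ^+ 2); ring.
move=> H; apply: le_trans H _; lra.
Qed.

Lemma approximableZ c F : approximable F -> approximable (fun w => c * F w).
Proof.
move=> [F2 aF]; split; first exact: sq_intZ.
move=> e e0; have e' : 0 < e / (c ^+ 2 + 1).
  by rewrite divr_gt0// ltr_wpDl// sqr_ge0.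
have [G cG HG] := aF _ e'; exists (fun w => c * G w).
  exact: (cylinder_op (fun a b => a * b) (cylinder_cst c) cG).
have [_ iFG] := sq_intB F2 (cylinder_sq_int cG).
rewrite (@eq_Es _ _ _ _ _ (fun w => c ^+ 2 * (F w - G w) ^+ 2)); last first.
  by move=> w; ring.
rewrite EsZ//; apply: (@le_trans _ _ (c ^+ 2 * (e / (c ^+ 2 + 1)))).
  by rewrite ler_wpM2l// sqr_ge0.
rewrite mulrA ler_pdivrMr ?ltr_wpDl ?sqr_ge0//.
by rewrite mulrC ler_pM2l// lerDl.
Qed.

Lemma approximable_sum (J : finType) (F : J -> T -> R) :
  (forall j, approximable (F j)) -> approximable (fun w => \sum_j F j w).
Proof.
move=> aF; elim: (index_enum J) => [|j s IH].
  under eq_fun do rewrite big_nil.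
  exact/cylinder_approximable/cylinder_cst.
by under eq_fun do rewrite big_cons; exact: approximableD.
Qed.

(** Pi-lambda argument: sets with cylinder indicator are stable under intersection, and sets with
    approximable indicator form a lambda-system, since for an increasing sequence the squared L^2
    distance of indicators is a difference of probabilities. *)
Lemma indic_approximable (C : set T) : <<s RV_gen X setT >> C ->
  approximable (\1_C : T -> R).
Proof.
have Gm := @RV_gen_measurable _ _ _ _ _ _ X setT.
have I2 C' : measurable C' -> sq_int P (\1_C' : T -> R).
  move=> mC'; apply: (@sq_int_bd _ _ _ _ _ 1); first exact: measurable_indic.
  by move=> w; rewrite indicE ger0_norm// lern1 leq_b1.
pose CC := [set C : set T | cylinder (\1_C : T -> R)].
pose H := [set C : set T | measurable C /\ approximable (\1_C : T -> R)].
have CCI : setI_closed CC.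
  move=> A B cA cB; rewrite /CC/=.
  rewrite (_ : \1_(A `&` B) = fun w => \1_A w * \1_B w :> R); last first.
    by apply/funext => w; rewrite indicI.
  exact: (cylinder_op (fun a b => a * b)).
have CCH : CC `<=` H.
  move=> A cA; split; last exact: cylinder_approximable.
  have [mA _] := cylinder_sq_int cA.
  rewrite (_ : A = (\1_A : T -> R) @^-1` [set 1]).
    by rewrite -[X in measurable X]setTI; exact: mA.
  apply/seteqP; split => w /=; first by move=> Aw; rewrite indicE mem_set.
  rewrite indicE; case: (boolP (w \in A)) => [/set_mem//|_ /= /eqP].
  by rewrite eq_sym oner_eq0.
have lH : lambda_system setT H.
  split => //.
  - split => //; rewrite indicT; exact/cylinder_approximable/cylinder_cst.
  - move=> A B BA [mA aA] [mB aB]; split; first exact: measurableD.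
    rewrite (_ : \1_(A `\` B) = fun w => \1_A w + (-1) * \1_B w :> R).
      by apply: approximableD => //; exact: approximableZ.
    apply/funext => w; rewrite !indicE in_setD.
    case: (boolP (w \in A)) => /= wA; case: (boolP (w \in B)) => /= wB; try ring.
    by move: wA; rewrite (mem_set (BA _ (set_mem wB))).
  - move=> A ndA HA; have mA i : measurable (A i) by case: (HA i).
    have mUA : measurable (\bigcup_i A i) by exact: bigcupT_measurable.
    split => //; apply: approximable_lim; first exact: I2.
    move=> e e0; have Pcvg := @nondecreasing_cvg_mu _ _ _ P A mA mUA ndA.
    have Pfin C' : measurable C' -> P C' \is a fin_num by move=> ?; exact: fin_num_measure.
    have : P (A i) @[i --> \oo] --> (fine (P (\bigcup_i A i)))%:E.
      by rewrite fineK ?Pfin.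
    move=> /fine_cvgP[_] /cvgrPdist_le/(_ _ e0).
    move=> [n _ /(_ _ (leqnn n))/= Hn].
    exists (\1_(A n)); first by case: (HA n).
    apply: le_trans Hn; apply: le_trans (ler_norm _).
    rewrite -!Es_indic// -EsB; try exact: integrable_indic.
    rewrite le_eqVlt; apply/orP; left; apply/eqP; apply: eq_Es => w.
    rewrite !indicE.
    case: (boolP (w \in A n)) => /= wA; case: (boolP (w \in \bigcup_i A i)) => /= wB; try ring.
    by move: wB; rewrite mem_set//; exists n => //; exact: set_mem.
have := @lambda_system_subset _ _ CCI setT H lH CCH (fun X _ => @subsetT _ X).
move=> sub HC; apply: (sub _ _).2; move: C HC; apply: smallest_sub.
  exact: smallest_sigma_algebra.
move=> _ [j /= _ [B mB <-]]; apply: sub_sigma_algebra; rewrite setTI.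
pose A := dfwith (fun k => setT) j B : forall k, set (E k).
have mA k : measurable (A k) by rewrite /A; case: dfwithP.
(* With [j.+1] observed coordinates, [X j] is the last one, read off at [ord_max]. *)
exists j.+1, bool, (fun k x => x \in A k), (fun x : {ffun 'I_j.+1 -> bool} => (nat_of_bool (x ord_max))%:R); split.
  move=> k b; rewrite (_ : _ @^-1` _ = if b then A k else ~` A k).
    by case: b => //; exact: measurableC.
  apply/seteqP; split => x /=; case: b => /= xA.
  - exact: set_mem.
  - by move: (negbT xA); rewrite notin_setE.
  - exact: mem_set.
  - by apply/negbTE; rewrite notin_setE.
apply/funext => w; rewrite ffunE indicE; congr (_%:R); congr nat_of_bool.
by rewrite /A dfwithin; apply/idP/idP => /set_mem H1; apply/mem_set.
Qed.

Lemma based_on_measurable (F : T -> R) : based_on X F ->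
  measurable_fun [set: g_sigma_algebraType (RV_gen X setT)] F.
Proof.
move=> [f mf Ff].
pose Xw : g_sigma_algebraType (RV_gen X setT) -> g_sigma_algebraType (prod_gen (E := E)) :=
  fun w k => X k w.
have mX : measurable_fun setT Xw.
  apply: (@measurability _ _ _ _ _ Xw (prod_gen (E := E))) => //.
  move=> _ [_ [k _ [B mB <-]] <-]; apply: sub_sigma_algebra.
  by exists k => //; exists B => //; rewrite !setTI.
rewrite (_ : F = f \o Xw); last exact/funext.
exact: (measurableT_comp mf mX).
Qed.

Lemma based_on_approximable (F : T -> R) : based_on X F -> sq_int P F ->
  approximable F.
Proof.
move=> bF F2; have mF := based_on_measurable bF.
have Gm := @RV_gen_measurable _ _ _ _ _ _ X setT.
apply: approximable_lim => // e e0.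
have [|m [c [xi [mxi _ Hxi]]]] := @fin_approx _ _ _ P _ Gm F 2 e isT mF _ e0.
  case: F2 => _; congr (_.-integrable _ _); apply/funext => w /=.
  by rewrite real_normK ?num_real.
exists (fun w => c (xi w)); last first.
  apply: le_trans Hxi; rewrite le_eqVlt; apply/orP; left; apply/eqP.
  by apply: eq_Es => w; rewrite real_normK ?num_real.
rewrite (_ : (fun w => c (xi w)) = fun w => \sum_i c i * \1_(xi @^-1` [set i]) w).
  by apply: approximable_sum => i; apply: approximableZ; apply: indic_approximable;
    exact: (mxi i).
apply/funext => w; rewrite (bigD1 (xi w))//= indicE mem_set// mulr1.
rewrite big1 ?addr0// => i iw; rewrite indicE memNset ?mulr0//=.
by move=> H; rewrite -H eqxx in iw.
Qed.

End density.

(** * Convergence in distribution *)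

Section one_space.
Context (R : realType) (d : measure_display) (T : measurableType d).
Context (P : probability T R) (F : {RV P >-> R}).
Hypothesis FL2 : (F : T -> R) \in Lfun P 2%:E.

Lemma Lfun2_sq_int : sq_int P F.
Proof.
split => //; have := Lfun2_integrable_sqr FL2.
by congr (_.-integrable _ _); apply/funext => w /=.
Qed.

Lemma normalized_second_moment : ('E_P[F] = 0)%E -> ('V_P[F] = 1)%E ->
  Es P (fun w => F w ^+ 2) = 1.
Proof.
move=> EF; rewrite varianceE// EF expe2 mule0 sube0 unlock => VF.
apply: EFin_inj; rewrite EFin_Es; last by have [] := Lfun2_sq_int.
by rewrite -VF; apply: eq_integral => w _.
Qed.

End one_space.

(** The cylinder function [g] near [F] only selects a discretisation; the comparison is made with
    the projection [f] for it, which is degenerate again and at least as close to [F]. *)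
Lemma degenerate_test_bound (R : realType) (m : nat) (psi : R -> R) (L : R) :
  (0 < m)%N -> continuous psi -> (forall x, L < `|x| -> psi x = 0) ->
  (\int[(normal_prob 0 1 : probability (measurableTypeR R) R)]_x (psi x)%:E = 0)%E ->
  forall e : R, 0 < e -> exists2 delta : R, 0 < delta &
  forall (d : measure_display) (T : measurableType d) (P : probability T R)
    (dE : nat -> measure_display) (E : forall k, measurableType (dE k))
    (X : forall k, {RV P >-> E k}) (F : {RV P >-> R}),
  independent_RVs X -> degenerate_Ustat X m F ->
  ('E_P[F] = 0)%E -> ('V_P[F] = 1)%E ->
  ('E_P[fun w => (F w ^+ 4)%R] <= (3 + delta)%:E)%E ->
  (max_influence X F <= delta%:E)%E ->
  `|Es P (fun w => psi (F w))| <= e.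
Proof.
move=> m0 psic psi0 psiE e e0.
have e2 : 0 < e / 2 by rewrite divr_gt0.
have e4 : 0 < e / 4 by rewrite divr_gt0.
have [delta delta0 Hfin] := degenerate_almost_normal m0 psic psi0 psiE e2.
have [C C0 psiC] := compact_support_modulus psic psi0 e4.
have [B B0 psiB] := compact_support_bounded psic psi0.
exists delta => // d T P dE E X F indepX [FL2 bF degF] EF VF EF4 infF.
have F2 := Lfun2_sq_int FL2.
have EF2 := normalized_second_moment FL2 EF VF.
have [_ aF] := based_on_approximable bF F2.
(* The bound [delta] keeps the second moment of [f] above [1 - delta]; the other one makes
   [C * E (F - f)^2] at most [e / 4]. *)
pose e' := Num.min delta (e / (4 * (C + 1))).
have e'0 : 0 < e' by rewrite lt_min delta0 divr_gt0// mulr_gt0// ltr_wpDl.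
have [_ [N [S [disc [g [mdisc ->]]]]] Hg] := aF _ e'0.
have [f [fdeg fE]] := discrete_projection indepX N mdisc F2 degF.
have obsm := @obs_fin _ _ _ _ _ _ X N S disc mdisc.
have dist_g := Es_sub_obs indepX mdisc F2 fE g.
have dist_f := Es_sub_obs indepX mdisc F2 fE f.
have sub0 : Ex (prb X disc) (fun x => (f x - f x) ^+ 2) = 0.
  transitivity (Ex (prb X disc) (fun _ : {ffun 'I_N -> S} => 0)).
    by apply: eq_Ex => x; rewrite subrr expr0n.
  exact: (Ex_cst (prb_sum1 X mdisc)).
rewrite sub0 EF2 addr0 in dist_f; rewrite EF2 in dist_g.
have fg0 : 0 <= Ex (prb X disc) (fun x => (f x - g x) ^+ 2).
  apply: Ex_ge0 => [k s'|k|x]; [exact: prb_ge0|exact: prb_sum1|exact: sqr_ge0].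
have Ff0 : 0 <= Es P (fun w => (F w - f (obs X N disc w)) ^+ 2).
  by apply: Es_ge0 => w; exact: sqr_ge0.
have Ff : Es P (fun w => (F w - f (obs X N disc w)) ^+ 2) <= e'.
  by apply: le_trans Hg; rewrite dist_f dist_g; lra.
have e'd : e' <= delta by rewrite ge_min lexx.
have iF4 : P.-integrable setT (EFin \o (fun w => F w ^+ 4)).
  apply/integrableP; split.
    by apply/measurable_EFinP; exact: measurable_funX.
  apply: le_lt_trans (ltry (3 + delta)); apply: le_trans EF4.
  rewrite unlock le_eqVlt; apply/orP; left; apply/eqP.
  by apply: eq_integral => w _; rewrite /= ger0_norm// exprn_even_ge0.
have fin_bound : `|Ex (prb X disc) (fun x => psi (f x))| <= e / 2.
  apply: Hfin => //.
  - by move=> k s; exact: prb_ge0.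
  - by move=> k; exact: prb_sum1.
  - move=> k; apply: (Ex_influence_le indepX mdisc F2 fE).
    by apply: le_trans infF; apply: ereal_sup_ubound; exists (k : nat).
  - by apply/andP; split; lra.
  - apply: le_trans (Ex_fourth_le indepX mdisc F2 fE iF4) _.
    by rewrite -lee_fin EFin_Es//; move: EF4; rewrite unlock.
have ipsi (Y : T -> R) : measurable_fun setT Y ->
    P.-integrable setT (EFin \o (fun w => psi (Y w))).
  move=> mY; apply: sq_int_integ; apply: (@sq_int_bd _ _ _ _ _ (B)) => //.
  by apply: (measurableT_comp _ mY); exact: continuous_measurable_fun.
have mf : measurable_fun setT (fun w => f (obs X N disc w)).
  exact: (fin_measurable_fun f obsm).
have i1 := ipsi _ (measurable_funPT F).
have i2 := ipsi _ mf.
have [_ iFf] := sq_intB F2 (sq_int_fin P f obsm).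
have h1 : `|Es P (fun w => psi (F w)) - Es P (fun w => psi (f (obs X N disc w)))| <= e / 2.
  rewrite -EsB//; apply: le_trans (Es_abs (integB i1 i2)) _.
  apply: (@le_trans _ _ (Es P (fun w => e / 4 + C * (F w - f (obs X N disc w)) ^+ 2))).
    apply: Es_le => //; first exact: integ_abs (integB i1 i2).
    by apply: integD; [exact: integ_cst|exact: integZ].
  rewrite EsD ?Es_cst ?EsZ//; [|exact: integ_cst|exact: integZ].
  have : C * Es P (fun w => (F w - f (obs X N disc w)) ^+ 2) <= e / 4.
    apply: (@le_trans _ _ (C * (e / (4 * (C + 1))))).
      by rewrite ler_wpM2l// (le_trans Ff)// ge_min lexx orbT.
    rewrite mulrA ler_pdivrMr ?mulr_gt0 ?ltr_wpDl//.
    have -> : e / 4 * (4 * (C + 1)) = (C + 1) * e by field.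
    by rewrite ler_pM2r// lerDl.
  lra.
have -> : Es P (fun w => psi (F w)) =
    (Es P (fun w => psi (F w)) - Es P (fun w => psi (f (obs X N disc w)))) +
     Ex (prb X disc) (fun x => psi (f x)).
  by rewrite -(Es_obs indepX mdisc (fun x => psi (f x))) subrK.
apply: le_trans (ler_normD _ _) _; lra.
Qed.

(** * Reduction to compactly supported test functions *)

Section test_decomposition.
Context (R : realType) (g : R -> R) (C K c : R).
Hypothesis gC : forall x, `|g x| <= C.
Hypothesis cC : `|c| <= C.
Hypothesis gc : continuous g.

Let psi x := (g x - c) * cutoff K x.

Lemma continuous_test : continuous psi.
Proof.
move=> x; apply: cvgM; last exact: continuous_cutoff.
by apply: cvgB; [exact: gc|exact: cvg_cst].
Qed.

Let C0 : 0 <= C. Proof. exact: le_trans (gC 0). Qed.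

Let gc2 x : `|g x - c| <= 2 * C.
Proof. by apply: le_trans (ler_normB _ _) _; rewrite mulr_natl mulr2n lerD. Qed.

(** The difference is the mean of [(g - c) * (1 - cutoff K)], whose first factor is at most [2 * C].
    The lemma serves both [F n] and, with the identity map, the Gaussian law. *)
Lemma Es_test (d : measure_display) (T : measurableType d) (P : probability T R)
    (F : T -> R) (t : R) :
  measurable_fun setT F ->
  Es P (fun w => 1 - cutoff K (F w)) <= t ->
  `|Es P (fun w => g (F w)) - c - Es P (fun w => psi (F w))| <= 2 * C * t.
Proof.
move=> mF tail.
have mg : measurable_fun setT (fun w => g (F w)).
  by apply: (measurableT_comp _ mF); exact: continuous_measurable_fun.
have mk : measurable_fun setT (fun w => cutoff K (F w)).
  apply: (measurableT_comp _ mF); apply: continuous_measurable_fun.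
  exact: continuous_cutoff.
have ig : P.-integrable setT (EFin \o (fun w => g (F w))).
  by apply: sq_int_integ; exact: (@sq_int_bd _ _ _ _ _ (C)).
have ipsi : P.-integrable setT (EFin \o (fun w => psi (F w))).
  apply: sq_int_integ; apply: (@sq_int_bd _ _ _ _ _ (2 * C)).
    by apply: measurable_funM => //; exact: measurable_funB.
  move=> w; rewrite /psi normrM -[leRHS]mulr1 ler_pM//.
  by rewrite ger0_norm ?cutoff_ge0// cutoff_le1.
have icut : P.-integrable setT (EFin \o (fun w => 1 - cutoff K (F w))).
  apply: sq_int_integ; apply: (@sq_int_bd _ _ _ _ _ (1)); first exact: measurable_funB.
  by move=> w; rewrite ger0_norm ?subr_ge0 ?cutoff_le1// gerBl cutoff_ge0.
have icst := integ_cst P c.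
rewrite -[c in X in `|X|](Es_cst P c) -EsB// -EsB//; last exact: integB.
have igc : P.-integrable setT (EFin \o (fun w => g (F w) - c - psi (F w))).
  by apply: integB => //; exact: integB.
apply: le_trans (Es_abs igc) _.
apply: (@le_trans _ _ (Es P (fun w => 2 * C * (1 - cutoff K (F w))))); last first.
  by rewrite EsZ// ler_wpM2l// mulr_ge0.
apply: Es_le; [exact: integ_abs|exact: integZ|] => w.
rewrite (_ : _ - _ = (g (F w) - c) * (1 - cutoff K (F w))); last by rewrite /psi; ring.
by rewrite normrM [X in _ * X]ger0_norm ?subr_ge0 ?cutoff_le1// ler_wpM2r ?subr_ge0 ?cutoff_le1.
Qed.

End test_decomposition.

Theorem corollary1p2 (R : realType) (p : nat) (p_gt0 : (0 < p)%N)
    (d : nat -> measure_display) (Omega : forall n, measurableType (d n))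
    (P : forall n, probability (Omega n) R)
    (dE : nat -> nat -> measure_display)
    (E : forall n k, measurableType (dE n k))
    (X : forall n k, {RV (P n) >-> E n k})
    (F : forall n, {RV (P n) >-> R})
    (indepX : forall n, independent_RVs (X n))
    (degF : forall n, degenerate_Ustat (X n) p (F n))
    (expF : forall n, ('E_(P n)[F n] = 0)%E)
    (varF : forall n, ('V_(P n)[F n] = 1)%E)
    (cvg_fourth_moment :
       ('E_(P n)[fun w => (F n w ^+ 4)%R] @[n --> \oo] --> 3%:E)%E)
    (cvg_influence : max_influence (X n) (F n) @[n --> \oo] --> 0%E) :
  cvg_in_distribution F (normal_prob 0 1).
Proof.
move=> g gc [C0 gC0].
have [C C_gt0 gC] : exists2 C, 0 < C & forall x, `|g x| <= C.
  exists (`|C0| + 1) => [|x]; first by rewrite ltr_wpDl.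
  by apply: le_trans (gC0 x) _; rewrite (le_trans (ler_norm _))// lerDl.
pose gamma : probability (measurableTypeR R) R := normal_prob 0 1.
have mg : measurable_fun setT g by exact: continuous_measurable_fun.
have int_bd (d' : measure_display) (T' : measurableType d') (Q : probability T' R)
    (u : T' -> R) B : measurable_fun setT u -> (forall x, `|u x| <= B) ->
    Q.-integrable setT (EFin \o u).
  by move=> mu uB; apply: sq_int_integ; exact: (@sq_int_bd _ _ _ _ _ (B)).
have ig : gamma.-integrable setT (EFin \o g) by exact: (int_bd _ _ gamma _ C mg gC).
have -> : (\int[normal_prob 0 1]_x (g x)%:E)%E = (Es gamma g)%:E.
  by rewrite EFin_Es.
have -> : (fun n => 'E_(P n)[g \o F n])%E = EFin \o (fun n => Es (P n) (fun w => g (F n w))).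
  apply/funext => n; rewrite /= unlock EFin_Es//.
  apply: (int_bd _ _ _ _ C) => //; exact: (measurableT_comp mg).
apply: cvg_EFin; first by near=> n.
apply/cvgrPdist_le => e e0.
(* The first bound makes [2 * C * e'] at most [e / 3]; the bound 1/2 keeps the Gaussian mean of the
   cutoff, the denominator of [c], away from 0. *)
pose e' := Num.min (e / (6 * C)) 2^-1.
have e'0 : 0 < e' by rewrite lt_min divr_gt0 ?mulr_gt0//= invr_gt0.
have [K0 K00 HK0] := normal_tail e'0.
(* Large enough for both tails: [K0] for the Gaussian one, [e'^-1] for that of [F n], which is at
   most [K^-2 <= K^-1 <= e'] by Chebyshev and [K >= 1]. *)
pose K := K0 + e'^-1 + 1.
have e'V : 0 < e'^-1 by rewrite invr_gt0.
have K1 : 1 <= K by rewrite /K lerDr addr_ge0// ltW.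
have K_gt0 : 0 < K by exact: lt_le_trans K1.
have tailG : Es gamma (fun x => 1 - cutoff K x) <= e'.
  rewrite -lee_fin EFin_Es.
    by apply: HK0; rewrite /K -addrA lerDl addr_ge0// ltW.
  apply: (int_bd _ _ _ _ 1).
    apply: measurable_funB => //; apply: continuous_measurable_fun.
    exact: continuous_cutoff.
  by move=> w; rewrite ger0_norm ?subr_ge0 ?cutoff_le1// gerBl cutoff_ge0.
have mcut : measurable_fun (setT : set (measurableTypeR R)) (cutoff K).
  apply: continuous_measurable_fun; exact: continuous_cutoff.
have icut : gamma.-integrable setT (EFin \o cutoff K).
  apply: (int_bd _ _ _ _ 1) => // x; rewrite ger0_norm ?cutoff_ge0//.
  exact: cutoff_le1.
have igcut : gamma.-integrable setT (EFin \o (fun x => g x * cutoff K x)).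
  apply: (integ_mulbd (C := 1) ig) => // x; rewrite ger0_norm ?cutoff_ge0//.
  exact: cutoff_le1.
have gcut : 2^-1 <= Es gamma (cutoff K).
  have e'2 : e' <= 2^-1 by rewrite ge_min lexx orbT.
  by move: tailG; rewrite EsB//; [rewrite Es_cst; lra|exact: integ_cst].
have gcut0 : 0 < Es gamma (cutoff K) by apply: lt_le_trans gcut; rewrite invr_gt0.
(* A weighted mean of [g], chosen to give [psi] Gaussian mean 0; being a mean, it inherits the bound
   [C]. *)
pose c := Es gamma (fun x => g x * cutoff K x) / Es gamma (cutoff K).
have cC : `|c| <= C.
  rewrite /c normrM normfV (gtr0_norm gcut0) ler_pdivrMr//.
  apply: le_trans (Es_abs igcut) _; rewrite -EsZ//.
  apply: Es_le; [exact: integ_abs|exact: integZ|] => x.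
  by rewrite normrM (ger0_norm (cutoff_ge0 _ _)) ler_wpM2r ?cutoff_ge0.
pose psi x := (g x - c) * cutoff K x.
have psic : continuous psi by exact: continuous_test.
have psi0 x : K + 1 < `|x| -> psi x = 0 by move=> /cutoff_eq0; rewrite /psi => ->; rewrite mulr0.
have psiE0 : Es gamma psi = 0.
  transitivity (Es gamma (fun x => g x * cutoff K x - c * cutoff K x)).
    by apply: eq_Es => x; rewrite /psi mulrBl.
  by rewrite EsB ?EsZ//; [rewrite /c divfK ?subrr// gt_eqF|exact: integZ].
have psiE : (\int[gamma]_x (psi x)%:E = 0)%E.
  rewrite -EFin_Es ?psiE0//.
  rewrite (_ : psi = fun x => g x * cutoff K x - c * cutoff K x).
    2: by apply/funext => x; rewrite /psi mulrBl.
  by apply: integB => //; exact: integZ.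
have e3 : 0 < e / 3 by rewrite divr_gt0.
have [delta delta0 Hdelta] := degenerate_test_bound p_gt0 psic psi0 psiE e3.
have tailF n : Es (P n) (fun w => 1 - cutoff K (F n w)) <= e'.
  have [FL2 _ _] := degF n.
  have [_ iF2] := Lfun2_sq_int FL2.
  apply: (@le_trans _ _ (Es (P n) (fun w => K^-2 * F n w ^+ 2))).
    apply: Es_le; last 1 first.
    - move=> w; apply: le_trans (cutoff_tail _ K_gt0) _.
      by rewrite exprMn mulrC exprVn.
    - apply: (int_bd _ _ _ _ 1).
        apply: measurable_funB => //; apply: (@measurableT_comp _ _ _ _ _ _ (cutoff K)) => //.
      by move=> w; rewrite ger0_norm ?subr_ge0 ?cutoff_le1// gerBl cutoff_ge0.
    - exact: integZ.
  rewrite EsZ// (normalized_second_moment FL2)// mulr1.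
  rewrite -[leRHS]invrK lef_pV2 ?posrE ?exprn_gt0//.
  apply: (@le_trans _ _ K); first by rewrite /K -addrA addrCA lerDl addr_ge0// ltW.
  by rewrite expr2 ler_peMr// ltW.
have Ce' : 2 * C * e' <= e / 3.
  apply: (@le_trans _ _ (2 * C * (e / (6 * C)))).
    by apply: ler_wpM2l; [rewrite mulr_ge0// ltW|rewrite ge_min lexx].
  rewrite le_eqVlt; apply/orP; left; apply/eqP; field.
  by rewrite gt_eqF.
have HG : `|Es gamma g - c - Es gamma psi| <= 2 * C * e'.
  by apply: (@Es_test R g C K c gC cC gc _ (measurableTypeR R) gamma id e' _ tailG).
near=> n.
have HF := Es_test gC cC gc (measurable_funPT (F n)) (tailF n).
have Hn : `|Es (P n) (fun w => psi (F n w))| <= e / 3.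
  apply: Hdelta (indepX n) (degF n) (expF n) (varF n) _ _; near: n.
  - case/fine_cvgP: cvg_fourth_moment => fin /cvgrPdist_le/(_ _ delta0) H.
    near=> k; rewrite -[leLHS]fineK; last by near: k.
    rewrite lee_fin -lerBlDl; apply: le_trans (ler_norm _) _.
    by rewrite distrC; near: k.
  - case/fine_cvgP: cvg_influence => fin /cvgrPdist_le/(_ _ delta0) H.
    near=> k; rewrite -[leLHS]fineK; last by near: k.
    rewrite lee_fin; apply: le_trans (ler_norm _) _.
    by rewrite -normrN -sub0r; near: k.
rewrite psiE0 subr0 in HG.
(* Three errors of at most [e / 3] each: the Gaussian tail, the tail of [F n], and the mean of
   [psi (F n)]. *)
have -> : Es gamma g - Es (P n) (fun w => g (F n w)) =
  (Es gamma g - c) - (Es (P n) (fun w => g (F n w)) - c - Es (P n) (fun w => psi (F n w)))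
   - Es (P n) (fun w => psi (F n w)) by ring.
apply: le_trans (ler_normB _ _) _.
apply: (@le_trans _ _ (2 * C * e' + 2 * C * e' + e / 3)); last by lra.
apply: lerD => //; apply: le_trans (ler_normB _ _) _; exact: lerD.
Unshelve. all: by end_near. Qed.
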